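(* Let $R$ be a Lie conformal algebra and let $M$ be an $R$-module endowed with the structure of a commutative associative algebra on which $\partial^M$ and $a_\lambda$, $a\in R$, act by derivations. Then the following wedge product and bracket define a structure of a $\mathbb Z_+$-graded Gerstenhaber algebra on the space of chains $C_\bullet(R,M)=\bigoplus_{k\ge0}C_k(R,M)$. The wedge product is $$\big(a_1\otimes\cdots\otimes a_h\otimes\phi(x_1,\dots,x_h)\big)\wedge\big(a_{h+1}\otimes\cdots\otimes a_k\otimes\psi(x_1,\dots,x_{k-h})\big)=a_1\otimes\cdots\otimes a_k\otimes\big(\phi(x_1,\dots,x_h)\psi(x_{h+1},\dots,x_k)\big),$$ and the bracket is $$\begin{aligned}&[a_1\otimes\cdots\otimes a_h\otimes\phi(x_1,\dots,x_h),\;a_{h+1}\otimes\cdots\otimes a_k\otimes\psi(x_1,\dots,x_{k-h})]\\&=\sum_{i=1}^h\sum_{j=h+1}^k(-1)^{h+j+1}\big(a_1\otimes\cdots\otimes\overset{i}{[{a_i}_{\partial_{x_i}}a_j]}\otimes\cdots\widehat{a_j}\cdots\otimes a_k\otimes\phi(x_1,\dots,x_h)\,\psi(x_{h+1},\dots,\overset{j}{y},\dots,x_{k-1})\big)\Big|_{y=x_i}\\&\quad+\sum_{i=1}^h(-1)^{h+i}a_1\otimes\cdots\widehat{a_i}\cdots\otimes a_k\otimes\big({a_i}_{\partial_y}\psi(x_h,\dots,x_{k-1})\big)\phi(x_1,\dots,\overset{i}{y},\dots,x_{h-1})\Big|_{y=0}\\&\quad+\sum_{i=h+1}^k(-1)^{h+i}a_1\otimes\cdots\widehat{a_i}\cdots\otimes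 a_k\otimes\big({a_i}_{\partial_y}\phi(x_1,\dots,x_h)\big)\psi(x_{h+1},\dots,\overset{i}{y},\dots,x_{k-1})\Big|_{y=0}.\end{aligned}$$
   Context: $\mathbb F$ is a field of characteristic $0$; tensor products are over $\mathbb F$ unless indicated. A *Lie conformal algebra* $R$ is an $\mathbb F[\partial]$-module with an $\mathbb F$-linear $\lambda$-bracket $R\otimes R\to\mathbb F[\lambda]\otimes R$, $a\otimes b\mapsto[a_\lambda b]$, such that $[\partial a_\lambda b]=-\lambda[a_\lambda b]$, $[a_\lambda\partial b]=(\partial+\lambda)[a_\lambda b]$, $[a_\lambda b]=-[b_{-\lambda-\partial}a]$ ($\partial$ moved to the left), $[a_\lambda[b_\mu c]]-[b_\mu[a_\lambda c]]=[[a_\lambda b]_{\lambda+\mu}c]$. Write $[a_\lambda b]=\sum_j\frac{\lambda^j}{j!}a_{(j)}b$. An *$R$-module* $M$ is an $\mathbb F[\partial]$-module (action of $\partial$ denoted $\partial^M$) with a $\lambda$-action $R\otimes M\to\mathbb F[\lambda]\otimes M$, $a\otimes m\mapsto a_\lambda m=\sum_n\frac{\lambda^n}{n!}a_nm$, such that $(\partial a)_\lambda m=-\lambda a_\lambda m$, $a_\lambda(\partial^Mm)=(\partial^M+\lambda)(a_\lambda m)$, $a_\lambda(b_\mu m)-b_\mu(a_\lambda m)=[a_\lambda b]_{\lambda+\mu}m$. Derivation means $a_\lambda(mn)=(a_\lambda m)n+m(a_\lambda n)$, and similarly for $\partial^M$. *Chains.* $\partial^M$ and $a_\lambda$ act on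 $M[[x_1,\dots,x_k]]$ coefficientwise. $\mathcal M_k\subset M[[x_1,\dots,x_k]]$ is the subspace of series $\phi$ with $(\partial_{x_1}+\cdots+\partial_{x_k})\phi=\partial^M\phi$; in particular $\mathcal M_0=\ker\partial^M$. The symmetric group $S_k$ acts by $(\sigma\phi)(x_1,\dots,x_k)=\phi(x_{\sigma(1)},\dots,x_{\sigma(k)})$ and $\sigma(a_1\otimes\cdots\otimes a_k)=a_{\sigma^{-1}(1)}\otimes\cdots\otimes a_{\sigma^{-1}(k)}$. $C_k(R,M)$ is the quotient of $R^{\otimes k}\otimes\mathcal M_k$ by the relations: (sesquilinearity) $a_1\otimes\cdots\partial a_i\cdots\otimes a_k\otimes\phi+a_1\otimes\cdots\otimes a_k\otimes\partial_{x_i}\phi=0$ for each $i$; (skewsymmetry) $\sigma(a_1\otimes\cdots\otimes a_k)\otimes\sigma\phi=\mathrm{sign}(\sigma)\,a_1\otimes\cdots\otimes a_k\otimes\phi$ for $\sigma\in S_k$. The superspace $C_\bullet(R,M)$ has parity induced by the $\mathbb Z_+$-grading. *Notation in the bracket.* $\widehat{a_j}$ means omission. Writing $\overset{j}{y}$ means that $y$ is inserted in place of the variable $x_j$, the remaining variables $x_\ell$, $\ell\ge j$, being shifted to the right, e.g. $\psi(x_{h+1},\dots,\overset{j}{y},\dots,x_{k-1})=\psi(x_{h+1},\dots,x_{j-1},y,x_j,\dots,x_{k-1})$. In the first sum, $[{a_i}_{\partial_{x_i}}a_j]$ sits in position $i$ and stands for $\sum_l(a_{i(l)}a_j)\frac{\partial_{x_i}^l}{l!}$,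 with $\partial_{x_i}$ acting on the power series before the substitution $y=x_i$. In the second sum $({a_i}_{\partial_y}\psi)\phi|_{y=0}$ stands for $\sum_n\frac1{n!}(a_{i,n}\psi)(\partial_y^n\phi)|_{y=0}$, where $a_{i,n}$ denotes the $n$-th coefficient operator of ${a_i}_\lambda$ on $M$ acting coefficientwise; similarly in the third sum. A *Gerstenhaber algebra* is a vector superspace $\mathcal G$ with parity $p$, a product $\wedge$ and a bracket $[\cdot,\cdot]$ such that $(\mathcal G,\wedge)$ is a commutative associative superalgebra, $(\Pi\mathcal G,[\cdot,\cdot])$ is a Lie superalgebra ($\Pi$ = parity reversal), and $[X,Y\wedge Z]=[X,Y]\wedge Z+(-1)^{(p(X)+\bar1)p(Y)}Y\wedge[X,Z]$. It is $\mathbb Z_+$-graded if $\mathcal G=\bigoplus_{n\ge0}\mathcal G_n$ with $\mathcal G_m\wedge\mathcal G_n\subset\mathcal G_{m+n}$ and $[\mathcal G_m,\mathcal G_n]\subset\mathcal G_{m+n-1}$. *)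

(* Defs.v *)
From HB Require Import structures.
From mathcomp Require Import all_boot all_order all_algebra fingroup perm.
From mathcomp Require Import boolp classical_sets functions cardinality fsbigop.

Set Implicit Arguments.
Unset Strict Implicit.
Unset Printing Implicit Defensive.

Import GRing.Theory.
Local Notation qrepr := generic_quotient.repr.
Local Open Scope classical_set_scope.
Local Open Scope ring_scope.

Section DirectSum.
Variables (F : fieldType) (I : Type) (V : I -> lmodType F).

Record dsum := DSum {
  dsum_fun :> forall i, V i;
  dsum_finite : finite_set [set i | dsum_fun i != 0] }.

HB.instance Definition _ := gen_eqMixin dsum.
HB.instance Definition _ := gen_choiceMixin dsum.

Lemma dsumP (u v : dsum) : (forall i, u i = v i) -> u = v.
Proof.
case: u v => [u pu] [v pv] /= uv.
have {}uv : u = v by exact: functional_extensionality_dep.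
by case: _ / uv pv => pv; congr DSum; exact: Prop_irrelevance.
Qed.

Fact dsum0_subproof : finite_set [set i : I | (0 : V i) != 0].
Proof. by rewrite (_ : [set _ | _] = set0) // -subset0 => i /=; rewrite eqxx. Qed.

Fact dsumN_subproof (u : dsum) : finite_set [set i | - u i != 0].
Proof. by apply: sub_finite_set (dsum_finite u) => i /=; rewrite oppr_eq0. Qed.

Fact dsumD_subproof (u v : dsum) : finite_set [set i | u i + v i != 0].
Proof.
have fin : finite_set ([set i | u i != 0] `|` [set i | v i != 0]).
  by rewrite finite_setU; split; exact: dsum_finite.
apply: sub_finite_set fin => i /=; case: (eqVneq (u i) 0) => [->|]; last by left.
by rewrite add0r; right.
Qed.

Fact dsumZ_subproof (c : F) (u : dsum) : finite_set [set i | c *: u i != 0].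
Proof.
by apply: sub_finite_set (dsum_finite u) => i /=; apply: contra_neq => ->; rewrite scaler0.
Qed.

Definition dsum0 := DSum dsum0_subproof.
Definition dsumN u := DSum (dsumN_subproof u).
Definition dsumD u v := DSum (dsumD_subproof u v).
Definition dsumZ c u := DSum (dsumZ_subproof c u).

Fact dsumDA : associative dsumD.
Proof. by move=> u v w; apply: dsumP => i /=; rewrite addrA. Qed.
Fact dsumDC : commutative dsumD.
Proof. by move=> u v; apply: dsumP => i /=; rewrite addrC. Qed.
Fact dsum0D : left_id dsum0 dsumD.
Proof. by move=> u; apply: dsumP => i /=; rewrite add0r. Qed.
Fact dsumND : left_inverse dsum0 dsumN dsumD.
Proof. by move=> u; apply: dsumP => i /=; rewrite addNr. Qed.
HB.instance Definition _ := GRing.isZmodule.Build dsum dsumDA dsumDC dsum0D dsumND.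

Fact dsumZA (a b : F) (v : dsum) : dsumZ a (dsumZ b v) = dsumZ (a * b) v.
Proof. by apply: dsumP => i /=; rewrite scalerA. Qed.
Fact dsum1Z : left_id 1 dsumZ.
Proof. by move=> u; apply: dsumP => i /=; rewrite scale1r. Qed.
Fact dsumZDr : right_distributive dsumZ +%R.
Proof. by move=> a u v; apply: dsumP => i /=; rewrite scalerDr. Qed.
Fact dsumZDl v : {morph dsumZ^~ v : a b / a + b}.
Proof. by move=> a b; apply: dsumP => i /=; rewrite scalerDl. Qed.
HB.instance Definition _ :=
  GRing.Zmodule_isLmodule.Build F dsum dsumZA dsum1Z dsumZDr dsumZDl.

End DirectSum.

Section DirectSumInj.
Variables (F : fieldType) (I : eqType) (V : I -> lmodType F).

Fact dsinj_subproof i (v : V i) :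
  finite_set [set j | dfwith (fun j => 0 : V j) v j != 0].
Proof.
apply: sub_finite_set (finite_set1 i) => j /=; case: dfwithP => //.
by move=> k ik; rewrite eqxx.
Qed.

Definition dsinj i (v : V i) : dsum V := DSum (dsinj_subproof v).

End DirectSumInj.

Section LinearQuotient.
Variables (F : fieldType) (V : lmodType F) (S : set V).

Definition in_span : {pred V} := fun x =>
  `[< forall U : {pred V}, submod_closed U -> (forall y, S y -> y \in U) -> x \in U >].

Fact in_span_closed : submod_closed in_span.
Proof.
split; first by apply/asboolP => U [].
move=> a u v /asboolP Su /asboolP Sv; apply/asboolP => U clU SU.
by case: (clU) => _; apply; [apply: Su|apply: Sv].
Qed.

HB.instance Definition _ := GRing.isSubmodClosed.Build F V in_span in_span_closed.

Definition quotmod := Quotient.quot in_span.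
HB.instance Definition _ := GRing.Zmodule.on quotmod.
HB.instance Definition _ := EqQuotient.on quotmod.

Definition qpi (x : V) : quotmod := \pi_quotmod%qT x.

Fact qpiD x y : qpi (x + y) = qpi x + qpi y.
Proof. exact: (@Quotient.pi_add _ in_span). Qed.

Lemma qpiP x y : reflect (qpi x = qpi y) (x - y \in in_span).
Proof. by rewrite Quotient.idealrBE; exact: eqP. Qed.

Definition quotmod_scale (a : F) (x : quotmod) : quotmod := qpi (a *: qrepr x).

Fact qpiZ a x : qpi (a *: x) = quotmod_scale a (qpi x).
Proof.
apply/qpiP; rewrite -scalerBr rpredZ //; apply/qpiP.
by rewrite /qpi reprK.
Qed.

Fact qpi_surj (x : quotmod) : exists y, x = qpi y.
Proof. by exists (qrepr x); rewrite /qpi reprK. Qed.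

Fact quotmod_scaleA a b x :
  quotmod_scale a (quotmod_scale b x) = quotmod_scale (a * b) x.
Proof. by case: (qpi_surj x) => y ->; rewrite -!qpiZ scalerA. Qed.
Fact quotmod_scale1 : left_id 1 quotmod_scale.
Proof. by move=> x; case: (qpi_surj x) => y ->; rewrite -qpiZ scale1r. Qed.
Fact quotmod_scaleDr : right_distributive quotmod_scale +%R.
Proof.
move=> a x y; case: (qpi_surj x) => {}x ->; case: (qpi_surj y) => {}y ->.
by rewrite -qpiD -!qpiZ scalerDr qpiD.
Qed.
Fact quotmod_scaleDl x : {morph quotmod_scale^~ x : a b / a + b}.
Proof.
by move=> a b; case: (qpi_surj x) => {}x ->; rewrite -!qpiZ scalerDl qpiD.
Qed.
HB.instance Definition _ := GRing.Zmodule_isLmodule.Build F quotmod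
  quotmod_scaleA quotmod_scale1 quotmod_scaleDr quotmod_scaleDl.

Fact qpi_is_linear : linear qpi.
Proof. by move=> a x y; rewrite qpiD qpiZ. Qed.
HB.instance Definition _ := GRing.isLinear.Build F V quotmod _ qpi qpi_is_linear.

End LinearQuotient.

(* An element of F[lambda] (x) V is a finitely supported sequence nat -> V, whose
   n-th entry is the coefficient of lambda^n; so the entry n of [a_lambda b] is
   (a_(n) b) / n!. Polynomials in lambda, mu are similarly maps nat -> nat -> V. *)
Section LambdaPoly.
Variable V : zmodType.

Definition is_poly (f : nat -> V) := exists N, forall n, (N <= n)%N -> f n = 0.

Definition polyc (v : V) : nat -> V := fun n => if n == 0%N then v else 0.
Definition mulL (f : nat -> V) : nat -> V := fun n => if n is p.+1 then f p else 0.

Definition polyc2 (v : V) : nat -> nat -> V := fun p q => if (p == 0%N) && (q == 0%N) then v else 0.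
Definition mulL2 (f : nat -> nat -> V) : nat -> nat -> V :=
  fun p q => if p is p'.+1 then f p' q else 0.
Definition mulM2 (f : nat -> nat -> V) : nat -> nat -> V :=
  fun p q => if q is q'.+1 then f p q' else 0.

(* substitution of the operator L for lambda in the polynomial c *)
Definition psubst (L : V -> V) (c : nat -> V) : V := \sum_(n \in [set: nat]) iter n L (c n).
End LambdaPoly.

Section LambdaMaps.
Variables (F : fieldType) (R M : lmodType F).

Definition is_lambda_map (B : R -> M -> nat -> M) :=
  [/\ forall m, linear (fun a => B a m), forall a, linear (B a)
    & forall a m, is_poly (B a m)].

Definition sesquilinear (dR : R -> R) (dM : M -> M) (B : R -> M -> nat -> M) :=
  (forall a m, B (dR a) m = - mulL (B a m)) /\
  (forall a m, B a (dM m) = (fun n => dM (B a m n)) + mulL (B a m)).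

(* a_lambda (b_mu m) - b_mu (a_lambda m) = [a_lambda b]_{lambda + mu} m, where p is the
   exponent of lambda and q that of mu; the right-hand side is
   sum_j lambda^j sum_n (lambda + mu)^n (B (br a b j) m n). *)
Definition lambda_jacobi (br : R -> R -> nat -> R) (B : R -> M -> nat -> M) :=
  forall a b m,
    (fun p q => B a (B b m q) p) - (fun p q => B b (B a m p) q) =
    psubst (@mulL2 M) (fun j =>
      psubst (fun f => mulL2 f + mulM2 f) (fun n => polyc2 (B (br a b j) m n))).
End LambdaMaps.

Record lieConformal (F : fieldType) := LieConformal {
  lc_sort :> lmodType F;
  lc_d : {linear lc_sort -> lc_sort};
  lc_br : lc_sort -> lc_sort -> nat -> lc_sort;
  lc_brP : is_lambda_map lc_br;
  lc_sesqui : sesquilinear lc_d lc_d lc_br;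
  (* [a_lambda b] = - [b_{- lambda - d} a] *)
  lc_skew : forall a b, lc_br a b =
    - psubst (fun f => - (mulL f + (fun n => lc_d (f n)))) (fun n => polyc (lc_br b a n));
  lc_jacobi : lambda_jacobi lc_br lc_br }.

Record lcModule (F : fieldType) (R : lieConformal F) := LcModule {
  lm_sort :> lmodType F;
  lm_d : {linear lm_sort -> lm_sort};
  lm_act : R -> lm_sort -> nat -> lm_sort;
  lm_actP : is_lambda_map lm_act;
  lm_sesqui : sesquilinear (@lc_d F R) lm_d lm_act;
  lm_jacobi : lambda_jacobi (@lc_br F R) lm_act }.

(* the associative product is not required to have a unit *)
Record lcModAlgebra (F : fieldType) (R : lieConformal F) := LcModAlgebra {
  la_mod :> lcModule R;
  la_mul : la_mod -> la_mod -> la_mod;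
  la_mul_linl : forall n, linear (fun m => la_mul m n);
  la_mul_linr : forall m, linear (la_mul m);
  la_mulA : associative la_mul;
  la_mulC : commutative la_mul;
  la_d_der : forall m n,
    lm_d la_mod (la_mul m n) = la_mul (lm_d la_mod m) n + la_mul m (lm_d la_mod n);
  la_act_der : forall (a : R) m n,
    lm_act a (la_mul m n) =
    (fun p => la_mul (lm_act a m p) n) + (fun p => la_mul m (lm_act a n p)) }.

(* An element of V[[x_1, ..., x_k]] is given by its coefficients: phi alpha is the
   coefficient of x_1^(alpha_1) ... x_k^(alpha_k). Positions are numbered from 0. *)
Notation fps k V := (('I_k -> nat) -> V).

Section Series.
Variable V : zmodType.

Definition raise k (i : 'I_k) (al : 'I_k -> nat) : 'I_k -> nat :=
  fun p => (al p + (p == i))%N.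

Definition fderiv k (i : 'I_k) (phi : fps k V) : fps k V :=
  fun al => phi (raise i al) *+ (al i).+1.

(* phi(x_{s(1)}, ..., x_{s(k)}) *)
Definition fperm k (s : 'S_k) (phi : fps k V) : fps k V :=
  fun al => phi (fun p => al (s p)).

(* the multi-index in k variables with exponent n at position j and exponents al,
   in order, at the other positions *)
Definition insert k (j : 'I_k) (n : nat) (al : 'I_k.-1 -> nat) : 'I_k -> nat :=
  fun p => if unlift j p is Some q then al q else n.

(* the substitution x_j = 0, the variables after x_j being renumbered *)
Definition feval0 k (j : 'I_k) (phi : fps k V) : fps k.-1 V :=
  fun al => phi (insert j 0 al).

(* the substitution x_j = x_i (i <> j), the variables after x_j being renumbered *)
Definition fdiag k (i j : 'I_k) (phi : fps k V) : fps k.-1 V :=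
  fun al => \sum_(q < (insert j 0 al i).+1)
    phi (fun p => (insert j q al p - q * (p == i))%N).

Definition ftotal k (phi : fps k V) : fps k V := \sum_(i < k) fderiv i phi.

End Series.

Section Series2.
Variables (V : zmodType) (mul : V -> V -> V).
(* phi(x_1, ..., x_h) psi(x_{h+1}, ..., x_{h+l}) *)
Definition fprod h l (phi : fps h V) (psi : fps l V) : fps (h + l) V :=
  fun al => mul (phi (fun p => al (lshift l p))) (psi (fun p => al (rshift h p))).
End Series2.

Section SeriesTheory.
Variable V : zmodType.
Implicit Types k : nat.

Lemma ftotalE k (phi : fps k V) al : ftotal phi al = \sum_(i < k) fderiv i phi al.
Proof. by rewrite /ftotal fct_sumE. Qed.

Lemma raiseC k (i j : 'I_k) al : raise i (raise j al) = raise j (raise i al).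
Proof. by apply: funext => p; rewrite /raise addnAC. Qed.

Lemma fderivC k (i j : 'I_k) (phi : fps k V) :
  fderiv i (fderiv j phi) = fderiv j (fderiv i phi).
Proof.
apply: funext => al; rewrite /fderiv raiseC; case: (eqVneq i j) => [-> //|ij].
by rewrite /raise [j == i]eq_sym (negPf ij) !addn0 -!mulrnA mulnC.
Qed.

Lemma fderivD k (i : 'I_k) (phi psi : fps k V) :
  fderiv i (phi + psi) = fderiv i phi + fderiv i psi.
Proof. by apply: funext => al; rewrite /fderiv fctE mulrnDl. Qed.

Lemma ftotal_fderiv k (i : 'I_k) (phi : fps k V) :
  ftotal (fderiv i phi) = fderiv i (ftotal phi).
Proof.
apply: funext => al; rewrite ftotalE [RHS]/fderiv ftotalE -sumrMnl.
by apply: eq_bigr => j _; rewrite fderivC.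
Qed.

Lemma ftotal_fperm k (s : 'S_k) (phi : fps k V) :
  ftotal (fperm s phi) = fperm s (ftotal phi).
Proof.
apply: funext => al; rewrite ftotalE [RHS]/fperm ftotalE.
rewrite (reindex_inj (@perm_inj _ s)) /=; apply: eq_bigr => i _.
rewrite /fderiv /fperm; congr (phi _ *+ _); apply: funext => p.
by rewrite /raise (inj_eq perm_inj).
Qed.

Lemma insertE k (j : 'I_k) n al q : insert j n al (lift j q) = al q.
Proof. by rewrite /insert liftK. Qed.

Lemma insert_id k (j : 'I_k) n al : insert j n al j = n.
Proof. by rewrite /insert unlift_none. Qed.

Lemma insert_raise k (j : 'I_k) n q al :
  insert j n (raise q al) = raise (lift j q) (insert j n al).
Proof.
apply: funext => p; rewrite /raise; case: (unliftP j p) => [p'|] ->.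
  by rewrite !insertE (inj_eq lift_inj).
by rewrite !insert_id (negPf (neq_lift j q)) addn0.
Qed.

Lemma ftotal_split k (j : 'I_k) (phi : fps k V) al :
  ftotal phi al = fderiv j phi al + \sum_(q < k.-1) fderiv (lift j q) phi al.
Proof. by rewrite ftotalE (bigD1_ord j). Qed.

Lemma ftotal_feval0 k (j : 'I_k) (phi : fps k V) :
  ftotal (feval0 j phi) = feval0 j (ftotal phi) - feval0 j (fderiv j phi).
Proof.
apply: funext => al; rewrite !fctE /feval0 (ftotal_split j) addrC addKr ftotalE.
apply: eq_bigr => q _; rewrite /fderiv /feval0 insert_raise.
by rewrite insertE.
Qed.

Lemma ftotal_fdiag k (i j : 'I_k) (phi : fps k V) : i != j ->
  ftotal (fdiag i j phi) = fdiag i j (ftotal phi).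
Proof.
move=> ij; apply: funext => al.
have [i' Ei] : {i' | i = lift j i'}.
  by case: (unliftP j i) ij => [i' -> _|->]; [exists i'|rewrite eqxx].
subst i; set i := lift j i'.
rewrite [RHS]/fdiag -/i insertE.
under [RHS]eq_bigr do rewrite (ftotal_split j).
rewrite big_split /= exchange_big /= (bigD1 i') //=.
rewrite ftotalE (bigD1 i') //= addrA; congr (_ + _).
  set n := al i'.
  pose P q r := phi (fun p => if p == j then q else if p == i then r else insert j 0 al p).
  have nij : (i == j) = false by rewrite eq_sym (negPf (neq_lift j i')).
  have insN p q q' a : p != j -> insert j q a p = insert j q' a p.
    by case: (unliftP j p) => [p' -> _|->]; [rewrite !insertE | rewrite eqxx].
  have insI q a : insert j q a i = a i' by rewrite /i insertE.
  have -> : fderiv i' (fdiag i j phi) al =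
      (\sum_(q < n.+2) P q (n.+1 - q)%N) *+ n.+1.
    rewrite /fderiv /fdiag insI (_ : raise i' al i' = n.+1); last first.
      by rewrite /raise eqxx addn1.
    congr (_ *+ _).
    apply: eq_bigr => q _; congr phi; apply: funext => p.
    case: (eqVneq p j) => [->|pj].
      by rewrite insert_id [j == i]eq_sym nij muln0 subn0.
    case: (eqVneq p i) => [->|pi]; first by rewrite insI /raise eqxx addn1 muln1.
    rewrite muln0 subn0 insert_raise /raise -/i (negPf pi) addn0.
    exact: insN.
  have -> : \sum_(q < n.+1)
      fderiv j phi (fun p => (insert j q al p - q * (p == i))%N) =
      \sum_(q < n.+2) P q (n.+1 - q)%N *+ q.
    rewrite [RHS]big_ord_recl /= mulr0n add0r; apply: eq_bigr => q _.
    rewrite /fderiv insert_id [j == i]eq_sym nij muln0 subn0 /bump add1n.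
    congr (phi _ *+ _); apply: funext => p; rewrite /raise.
    case: (eqVneq p j) => [->|pj].
      by rewrite insert_id [j == i]eq_sym nij muln0 subn0 addn1.
    case: (eqVneq p i) => [->|pi]; first by rewrite insI muln1 addn0 subSS.
    by rewrite muln0 subn0 addn0; exact: insN.
  have -> : \sum_(q < n.+1)
      fderiv i phi (fun p => (insert j q al p - q * (p == i))%N) =
      \sum_(q < n.+2) P q (n.+1 - q)%N *+ (n.+1 - q).
    rewrite [RHS]big_ord_recr /= subnn mulr0n addr0; apply: eq_bigr => q _.
    have qn : (q <= n)%N by rewrite -ltnS.
    rewrite /fderiv insI eqxx muln1 subSn //; congr (phi _ *+ _).
    apply: funext => p; rewrite /raise.
    case: (eqVneq p j) => [->|pj].
      by rewrite insert_id [j == i]eq_sym nij muln0 subn0 addn0.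
    case: (eqVneq p i) => [->|pi]; first by rewrite insI muln1 addn1.
    by rewrite muln0 subn0 addn0; exact: insN.
  rewrite -big_split -sumrMnl; apply: eq_bigr => q _ /=.
  by rewrite -mulrnDr subnKC // -ltnS.
apply: eq_bigr => q qi'.
rewrite /fderiv /fdiag -/i !insertE (_ : raise q al i' = al i'); last first.
  by rewrite /raise eq_sym (negPf qi') addn0.
rewrite -sumrMnl; apply: eq_bigr => n _; rewrite insertE (inj_eq lift_inj).
rewrite (negPf qi') muln0 subn0 insert_raise; congr (phi _ *+ _).
apply: funext => p; rewrite /raise.
case: (eqVneq p (lift j q)) => [->|]; last by rewrite !addn0.
by rewrite (inj_eq lift_inj) (negPf qi') muln0 !subn0.
Qed.

End SeriesTheory.

Section CoefficientSeries.
Variables (F : fieldType) (R : lieConformal F) (M : lcModule R).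
Local Notation d := (lm_d M).

Definition series_inv k : {pred fps k M} :=
  fun phi => `[< ftotal phi = (fun al => d (phi al)) >].

Lemma series_invP k (phi : fps k M) :
  reflect (forall al, ftotal phi al = d (phi al)) (phi \in @series_inv k).
Proof. by apply: (iffP (asboolP _)) => [-> //|?]; exact: funext. Qed.

Fact series_inv_closed k : submod_closed (@series_inv k).
Proof.
split; first apply/series_invP => al.
  rewrite ftotalE linear0 big1 // => i _.
  by rewrite /fderiv mul0rn.
move=> a phi psi /series_invP Hphi /series_invP Hpsi; apply/series_invP => al.
rewrite [(a *: phi + psi) al]/(a *: phi al + psi al) linearP -Hphi -Hpsi.
rewrite !ftotalE scaler_sumr -big_split; apply: eq_bigr => i _.
by rewrite /fderiv /= -scalerMnr -mulrnDl.
Qed.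
HB.instance Definition _ k :=
  GRing.isSubmodClosed.Build F (fps k M) (@series_inv k) (series_inv_closed k).

Record mseries k := MSeries {
  mseries_val :> fps k M;
  mseries_valP : mseries_val \in @series_inv k }.
HB.instance Definition _ k := [isSub for @mseries_val k].
HB.instance Definition _ k := [Choice of mseries k by <:].
HB.instance Definition _ k := [SubChoice_isSubLmodule of mseries k by <:].

Lemma mseriesP k (phi : mseries k) al : ftotal phi al = d (phi al).
Proof. by case: phi => phi /= /series_invP. Qed.

Fact mderiv_subproof k (i : 'I_k) (phi : mseries k) : fderiv i phi \in @series_inv k.
Proof.
apply/series_invP => al; rewrite ftotal_fderiv /fderiv mseriesP.
by rewrite raddfMn.
Qed.
Definition mderiv k i phi := MSeries (@mderiv_subproof k i phi).

Fact mperm_subproof k (s : 'S_k) (phi : mseries k) : fperm s phi \in @series_inv k.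
Proof. by apply/series_invP => al; rewrite ftotal_fperm /fperm mseriesP. Qed.
Definition mperm k s phi := MSeries (@mperm_subproof k s phi).

Fact mdiag_subproof k (i j : 'I_k) (ij : i != j) (phi : mseries k) :
  fdiag i j phi \in @series_inv k.-1.
Proof.
apply/series_invP => al; rewrite ftotal_fdiag // /fdiag raddf_sum.
by apply: eq_bigr => q _; rewrite mseriesP.
Qed.
Definition mdiag k i j ij phi := MSeries (@mdiag_subproof k i j ij phi).

End CoefficientSeries.

Section Contraction.
Variables (F : fieldType) (R : lieConformal F) (M : lcModule R).
Local Notation d := (lm_d M).

Lemma fsum_trunc (G : nat -> M) N : (forall n, (N <= n)%N -> G n = 0) ->
  \sum_(n \in [set: nat]) G n = \sum_(n < N) G n.
Proof.
move=> G0; rewrite fsbig_ord; apply/esym/fsbig_widen => // n [_ /= /negP].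
by rewrite -leqNgt => /G0.
Qed.

(* The sum is pointwise: at each multi-index only finitely many terms are nonzero in
   the uses below, but in general infinitely many of the series Theta n are nonzero. *)
Definition contract k (j : 'I_k) (Theta : nat -> fps k M) : fps k.-1 M :=
  fun al => \sum_(n \in [set: nat]) feval0 j (Theta n) al.

Lemma contract_inv k (j : 'I_k) (Theta : nat -> nat -> fps k M) :
  (forall n m, fderiv j (Theta n m) = Theta n.+1 m) ->
  (forall n m al, ftotal (Theta n m) al =
     d (Theta n m al) + (if m is m'.+1 then Theta n m' al else 0)) ->
  (forall al, exists N, forall n m, (N <= m)%N -> Theta n m al = 0) ->
  contract j (fun n => Theta n n) \in @series_inv _ _ M k.-1.
Proof.
move=> Hj Htot /boolp.choice[B HB]; apply/series_invP => al.
pose N := (B (insert j 0 al) + \sum_(q < k.-1) B (insert j 0 (raise q al))).+1.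
have c0 : contract j (fun n => Theta n n) al = \sum_(n < N) Theta n n (insert j 0 al).
  apply: fsum_trunc => n Nn; apply: HB; apply: leq_trans Nn.
  by rewrite /N -addSn leqW // leq_addr.
have cq q : contract j (fun n => Theta n n) (raise q al) =
    \sum_(n < N) Theta n n (insert j 0 (raise q al)).
  apply: fsum_trunc => n Nn; apply: HB; apply: leq_trans Nn.
  by rewrite /N leqW // (bigD1 q) //= addnCA leq_addr.
rewrite ftotalE c0 raddf_sum.
transitivity (\sum_(n < N) ftotal (feval0 j (Theta n n)) al).
  under [RHS]eq_bigr do rewrite ftotalE.
  rewrite exchange_big; apply: eq_bigr => q _.
  by rewrite {1}/fderiv cq -sumrMnl.
pose T n := if n is n'.+1 then Theta n n' (insert j 0 al) else 0.
transitivity (\sum_(n < N) (d (Theta n n (insert j 0 al)) - (T n.+1 - T n))).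
  apply: eq_bigr => n _; rewrite ftotal_feval0.
  rewrite [LHS]/(feval0 j (ftotal (Theta n n)) al - feval0 j (fderiv j (Theta n n)) al).
  rewrite /feval0 Htot Hj opprB addrA; by [].
rewrite sumrB -(big_mkord xpredT (fun n => T n.+1 - T n)) telescope_sumr //.
by rewrite /N /= HB ?subrr ?subr0 // leq_addr.
Qed.
End Contraction.

Section Chains.
Variables (F : fieldType) (R : lieConformal F) (M : lcModule R).

(* The tensor product of k copies of R with the space of series is the quotient of the
   free vector space on pairs (a, phi) by the multilinearity relations. *)
Definition pretensor k := @dsum F (('I_k -> R) * mseries M k)%type (fun _ => F^o).
Definition pregen k (a : 'I_k -> R) (phi : mseries M k) : pretensor k :=
  dsinj (V := fun _ : ('I_k -> R) * mseries M k => F^o : lmodType F) (i := (a, phi)) 1.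

Definition multilinear_rel k : set (pretensor k) :=
  [set t | exists (a : 'I_k -> R) (phi : mseries M k) i c u v,
     t = pregen [eta a with i |-> c *: u + v] phi
         - (c *: pregen [eta a with i |-> u] phi + pregen [eta a with i |-> v] phi)] `|`
  [set t | exists (a : 'I_k -> R) (phi psi : mseries M k) c,
     t = pregen a (c *: phi + psi) - (c *: pregen a phi + pregen a psi)].

Definition tensor k := quotmod (@multilinear_rel k).
Definition ptensor k (a : 'I_k -> R) (phi : mseries M k) : tensor k :=
  qpi (@multilinear_rel k) (pregen a phi).

Definition sesquilinear_rel k : set (tensor k) :=
  [set t | exists (a : 'I_k -> R) (phi : mseries M k) i,
     t = ptensor [eta a with i |-> lc_d R (a i)] phi + ptensor a (mderiv i phi)].

Definition skewsymmetric_rel k : set (tensor k) :=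
  [set t | exists (a : 'I_k -> R) (phi : mseries M k) (s : 'S_k),
     t = ptensor (fun i => a ((s^-1)%g i)) (mperm s phi) - (-1) ^+ s *: ptensor a phi].

Definition chains k := quotmod (@sesquilinear_rel k `|` @skewsymmetric_rel k).

Definition chain_space := dsum chains.

Definition chain k (a : 'I_k -> R) (phi : mseries M k) : chain_space :=
  dsinj (V := chains) (i := k) (qpi _ (ptensor a phi)).

Definition chain_degree (k : nat) : set chain_space :=
  [set c | forall m, m != k -> c m = 0].

Definition chain_parity (p : bool) : set chain_space :=
  [set c | forall m, odd m != p -> c m = 0].

End Chains.

Section ChainOperations.
Variables (F : fieldType) (R : lieConformal F) (M : lcModAlgebra R).
Local Notation d := (lm_d M).
Local Notation mul := (@la_mul F R M).
Local Notation inv k := (@series_inv F R M k).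

HB.instance Definition _ m := GRing.isLinear.Build F M M _ (mul m) (la_mul_linr m).

Fact la_mul0r n : mul 0 n = 0.
Proof. by rewrite la_mulC linear0. Qed.

Fact fprod_fderivl h l (i : 'I_h) (phi : fps h M) (psi : fps l M) :
  fderiv (lshift l i) (fprod mul phi psi) = fprod mul (fderiv i phi) psi.
Proof.
apply: funext => al; rewrite /fderiv /fprod ![mul _ (psi _)]la_mulC -linearMn.
congr (mul (psi _) (phi _ *+ _)); apply: funext => p; rewrite /raise.
by rewrite eq_rlshift addn0.
Qed.

Fact fprod_fderivr h l (i : 'I_l) (phi : fps h M) (psi : fps l M) :
  fderiv (rshift h i) (fprod mul phi psi) = fprod mul phi (fderiv i psi).
Proof.
apply: funext => al; rewrite /fderiv /fprod -linearMn.
congr (mul (phi _) (psi _ *+ _)); apply: funext => p; rewrite /raise.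
  by rewrite eq_lrshift addn0.
by rewrite eq_rshift.
Qed.

Fact ftotal_fprod h l (phi : fps h M) (psi : fps l M) al :
  ftotal (fprod mul phi psi) al =
  fprod mul (ftotal phi) psi al + fprod mul phi (ftotal psi) al.
Proof.
rewrite ftotalE big_split_ord /=; congr (_ + _).
  rewrite [RHS]/fprod la_mulC ftotalE linear_sum; apply: eq_bigr => i _.
  by rewrite fprod_fderivl [LHS]la_mulC.
rewrite [RHS]/fprod ftotalE linear_sum; apply: eq_bigr => i _.
by rewrite fprod_fderivr.
Qed.

Fact mprod_subproof h l (phi : mseries M h) (psi : mseries M l) :
  fprod mul phi psi \in inv (h + l).
Proof.
by apply/series_invP => al; rewrite ftotal_fprod /fprod !mseriesP la_d_der.
Qed.
Definition mprod h l phi psi := MSeries (@mprod_subproof h l phi psi).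

(* (a_{d/dy} psi(x_h, ..., x_{h+l-1})) phi(x_1, ..., y, ..., x_{h-1}) at y = 0,
   with y in place i: the coefficient of lambda^n in a_lambda psi multiplies the
   n-th partial derivative of phi *)
Definition fcontractl h l (a : R) (i : 'I_h) (phi : fps h M) (psi : fps l M) :=
  contract (lshift l i) (fun n =>
    fprod mul (iter n (fderiv i) phi) (fun al => lm_act a (psi al) n)).

(* (a_{d/dy} phi(x_1, ..., x_h)) psi(x_{h+1}, ..., y, ..., x_{h+l-1}) at y = 0,
   with y in place i of psi *)
Definition fcontractr h l (a : R) (i : 'I_l) (phi : fps h M) (psi : fps l M) :=
  contract (rshift h i) (fun n =>
    fprod mul (fun al => lm_act a (phi al) n) (iter n (fderiv i) psi)).

Fact iter_fderiv_inv k (i : 'I_k) (phi : mseries M k) n al :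
  ftotal (iter n (fderiv i) phi) al = d (iter n (fderiv i) phi al).
Proof.
apply/series_invP; elim: n => [|n IHn] /=; first exact: mseries_valP.
exact: (mderiv_subproof i (MSeries IHn)).
Qed.

Fact ftotal_act k (a : R) (phi : mseries M k) n al :
  ftotal (fun be => lm_act a (phi be) n) al =
  d (lm_act a (phi al) n) + (if n is m.+1 then lm_act a (phi al) m else 0).
Proof.
case: (lm_actP M) => _ lin_act _; pose f (x : M) : M := lm_act a x n.
have f_lin : linear f by move=> c u v; rewrite /f lin_act.
pose fL : {linear M -> M} := HB.pack f (GRing.isLinear.Build _ _ _ _ f f_lin).
transitivity (fL (ftotal phi al)).
  rewrite !ftotalE linear_sum; apply: eq_bigr => i _.
  by rewrite /fderiv linearMn.
rewrite mseriesP /= /f; case: (lm_sesqui M) => _ ->.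
by case: n {f f_lin fL}.
Qed.

Fact mcontractl_subproof h l a i (phi : mseries M h) (psi : mseries M l) :
  fcontractl a i phi psi \in inv (h + l).-1.
Proof.
apply: (@contract_inv _ _ M _ (lshift l i) (fun n m =>
  fprod mul (iter n (fderiv i) phi) (fun al => lm_act a (psi al) m))).
- by move=> n m; rewrite fprod_fderivl.
- move=> n m al; rewrite ftotal_fprod /fprod iter_fderiv_inv ftotal_act linearD.
  rewrite addrA -la_d_der; congr (_ + _); case: m => //.
  by rewrite linear0.
- move=> al; case: (lm_actP M) => _ _ /(_ a (psi (fun p => al (rshift h p))))[N HN].
  by exists N => n m /HN; rewrite /fprod => ->; rewrite linear0.
Qed.
Definition mcontractl h l a i phi psi := MSeries (@mcontractl_subproof h l a i phi psi).

Fact mcontractr_subproof h l a i (phi : mseries M h) (psi : mseries M l) :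
  fcontractr a i phi psi \in inv (h + l).-1.
Proof.
apply: (@contract_inv _ _ M _ (rshift h i) (fun n m =>
  fprod mul (fun al => lm_act a (phi al) m) (iter n (fderiv i) psi))).
- by move=> n m; rewrite fprod_fderivr.
- move=> n m al; rewrite ftotal_fprod /fprod iter_fderiv_inv ftotal_act.
  rewrite la_mulC linearD addrAC [X in X + _ + _]la_mulC -la_d_der.
  by congr (_ + _); case: m => [|m]; [rewrite linear0|rewrite [LHS]la_mulC].
- move=> al; case: (lm_actP M) => _ _ /(_ a (phi (fun p => al (lshift l p))))[N HN].
  by exists N => n m /HN; rewrite /fprod => ->; rewrite la_mul0r.
Qed.
Definition mcontractr h l a i phi psi := MSeries (@mcontractr_subproof h l a i phi psi).

Fact lrshift_neq h l (i : 'I_h) (j : 'I_l) : lshift l i != rshift h j.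
Proof. by rewrite eq_lrshift. Qed.

Definition catf h l (a : 'I_h -> R) (b : 'I_l -> R) : 'I_(h + l) -> R :=
  fun p => match fintype.split p with inl i => a i | inr j => b j end.

Definition wedge_chain h l (a : 'I_h -> R) (phi : mseries M h)
    (b : 'I_l -> R) (psi : mseries M l) : chain_space M :=
  chain (catf a b) (mprod phi psi).

(* The tensor factors are numbered from 0 to h + l - 1; the 1-based indices of the
   signs are recovered by .+1. *)
Definition bracket_chain h l (a : 'I_h -> R) (phi : mseries M h)
    (b : 'I_l -> R) (psi : mseries M l) : chain_space M :=
  let c := catf a b in
  \sum_(i < h) \sum_(j < l) (-1) ^+ (h + (rshift h j).+1 + 1) *:
    (\sum_(n \in [set: nat])
       chain (fun p => [eta c with lshift l i |-> lc_br (a i) (b j) n]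
                         (lift (rshift h j) p))
         (mdiag (lrshift_neq i j)
            (iter n (mderiv (lshift l i)) (mprod phi psi))))
  + \sum_(i < h) (-1) ^+ (h + (lshift l i).+1) *:
      chain (fun p => c (lift (lshift l i) p)) (mcontractl (a i) i phi psi)
  + \sum_(i < l) (-1) ^+ (h + (rshift h i).+1) *:
      chain (fun p => c (lift (rshift h i) p)) (mcontractr (b i) i phi psi).

Definition bilinear_op (V : lmodType F) (f : V -> V -> V) :=
  (forall y, linear (fun x => f x y)) /\ (forall x, linear (f x)).

Definition is_wedge (w : chain_space M -> chain_space M -> chain_space M) :=
  bilinear_op w /\
  forall h l a phi b psi,
    w (@chain _ _ _ h a phi) (@chain _ _ _ l b psi) = wedge_chain a phi b psi.

Definition is_bracket (w : chain_space M -> chain_space M -> chain_space M) :=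
  bilinear_op w /\
  forall h l a phi b psi,
    w (@chain _ _ _ h a phi) (@chain _ _ _ l b psi) = bracket_chain a phi b psi.

End ChainOperations.

Section Gerstenhaber.
Variables (F : fieldType) (G : lmodType F).

Definition direct_decomposition (I : choiceType) (P : I -> set G) :=
  (forall i, P i 0 /\ forall c x y, P i x -> P i y -> P i (c *: x + y)) /\
  (forall x, exists! f : I -> G,
     [/\ forall i, P i (f i), finite_set [set i | f i != 0]
       & x = \sum_(i \in [set: I]) f i]).

(* the even part is par false, the odd part is par true *)
Definition superspace (par : bool -> set G) := direct_decomposition par.

Definition reverse_parity (par : bool -> set G) : bool -> set G := fun p => par (~~ p).

Definition even_operation (par : bool -> set G) (op : G -> G -> G) :=
  forall p q x y, par p x -> par q y -> par (p (+) q) (op x y).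

Definition com_assoc_superalgebra (par : bool -> set G) (w : G -> G -> G) :=
  [/\ superspace par, bilinear_op w, even_operation par w, associative w
    & forall p q x y, par p x -> par q y -> w x y = (-1) ^+ (p && q) *: w y x].

Definition lie_superalgebra (par : bool -> set G) (br : G -> G -> G) :=
  [/\ superspace par, bilinear_op br, even_operation par br,
      forall p q x y, par p x -> par q y -> br x y = - ((-1) ^+ (p && q) *: br y x)
    & forall p q x y z, par p x -> par q y ->
        br x (br y z) = br (br x y) z + (-1) ^+ (p && q) *: br y (br x z)].

Definition gerstenhaber (par : bool -> set G) (w br : G -> G -> G) :=
  [/\ com_assoc_superalgebra par w,
      lie_superalgebra (reverse_parity par) br
    & forall p q x y z, par p x -> par q y ->
        br x (w y z) = w (br x y) z + (-1) ^+ (~~ p && q) *: w y (br x z)].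

(* in the last clause, the component of degree -1 is zero *)
Definition graded_gerstenhaber (deg : nat -> set G) (w br : G -> G -> G) :=
  [/\ direct_decomposition deg,
      forall m n x y, deg m x -> deg n y -> deg (m + n)%N (w x y)
    & forall m n x y, deg m x -> deg n y ->
        if (m + n)%N is k.+1 then deg k (br x y) else br x y = 0].

End Gerstenhaber.

(* Main.v *)
(* The tensor factors of a chain are named by distinct natural numbers, so that a chain is
   a word w of labels, a vector a(l) for each label, and a series in the variables x_l; it
   is alternating in w. In these terms the bracket of a chain over s with a chain over t is,
   up to the sign (-1)^(|s|+1), a sum over edges from a source label i to a target, which is
   either a label on the other side or the coefficient function of the other side. The edge
   removes i from the word and lets a(i) act on its target through the lambda-bracket or the
   lambda-action, lambda becoming the derivative in x_i.
   Antisymmetry of the bracket is then the invariance of the edge operator under reversing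
   an edge between two labels. The Leibniz rule holds because the edges leaving a product
   of two chains are those leaving its two factors. In the Jacobi identity each double bracket is
   a sum over pairs of edges taken from two of the three pairs of chains. Pairs which do not
   interact cancel because the corresponding edge operators anticommute, and those which do
   interact are grouped into triangles, on each of which the Jacobi identity of R or of M
   gives zero. The operations exist because the formulas, viewed as functionals of the word,
   respect the defining relations of chains in each argument. *)

(* Distinct labels allow one family [a] to serve all chains of an identity and replace shifted
   positions by deletion; the signs of the formulas become [sg], the sign of moving a label to the
   front of the word. The main obstacle is that after one bracket the coefficient function is a
   product whose factors must still be told apart, because an edge of the second bracket acts on one
   factor at a time. Products are therefore kept as functions of a family of operators, one per tag,
   and evaluated only at the end. A second obstacle is convergence: sums over the order n of an
   action are finite only pointwise, and a finitely supported sum is 0 by convention on infinite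
   support; this is the reason for [is_poly], [sfin] and [slot]. A triangle consists of two labels
   from different chains and a target in the third, either a label of it or its coefficient
   function. Since an edge between labels may be reversed, one Jacobi relation settles each
   triangle. The defining relations are verified in the first argument only; the symmetry of the two
   operations carries them to the second. *)
From HB Require Import structures.
Require Import Defs.
From mathcomp Require Import all_boot all_order all_algebra fingroup perm.
From mathcomp Require Import boolp classical_sets functions cardinality fsbigop.

Set Implicit Arguments.
Unset Strict Implicit.
Unset Printing Implicit Defensive.

Import GRing.Theory.
Local Open Scope ring_scope.

(** * Functions and words on labels *)

Section Update.
Variable T : Type.
Implicit Types (f : nat -> T) (i j : nat) (x y : T).

Definition upd f i x : nat -> T := fun l => if l == i then x else f l.

Lemma upd_eq f i x : upd f i x i = x.
Proof. by rewrite /upd eqxx. Qed.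

Lemma upd_neq f i x l : l != i -> upd f i x l = f l.
Proof. by rewrite /upd => /negPf->. Qed.

Lemma upd_comm f i j x y : i != j -> upd (upd f i x) j y = upd (upd f j y) i x.
Proof.
move=> ij; apply: funext => l; rewrite /upd; case: eqVneq => // ->.
by rewrite eq_sym (negPf ij).
Qed.

Lemma upd_upd f i x y : upd (upd f i x) i y = upd f i y.
Proof. by apply: funext => l; rewrite /upd; case: eqP. Qed.

Lemma upd_id f i x : f i = x -> upd f i x = f.
Proof. by move=> <-; apply: funext => l; rewrite /upd; case: eqP => [->|]. Qed.

End Update.

(** * Finitely supported sums over the natural numbers *)

Section FiniteSums.
Variable V : zmodType.
Implicit Types z : nat -> V.

(** The value is 0 when infinitely many terms are nonzero, so the additivity lemmas of this section
    need [is_poly]. *)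
Definition nsum z := (\sum_(n \in [set: nat]) z n)%R.

Lemma nsum_trunc z N : (forall n, (N <= n)%N -> z n = 0) -> nsum z = \sum_(n < N) z n.
Proof.
move=> z0; rewrite /nsum fsbig_ord; apply/esym/fsbig_widen => // n [_ /= /negP].
by rewrite -leqNgt => /z0.
Qed.

Lemma eq_nsum z z' : z =1 z' -> nsum z = nsum z'.
Proof. by move=> zz'; rewrite (funext zz'). Qed.

Lemma nsum0 z : (forall n, z n = 0) -> nsum z = 0.
Proof. by move=> z0; rewrite (@nsum_trunc _ 0) ?big_ord0. Qed.

Lemma nsumD z z' : is_poly z -> is_poly z' -> nsum (fun n => z n + z' n) = nsum z + nsum z'.
Proof.
move=> [N zN] [N' zN'].
rewrite !(@nsum_trunc _ (maxn N N')) ?big_split // => n; rewrite geq_max => /andP[Nn N'n].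
- by rewrite zN'.
- by rewrite zN.
by rewrite zN // zN' // addr0.
Qed.

Lemma nsum_recl z : is_poly z -> nsum z = z 0%N + nsum (fun n => z n.+1).
Proof.
move=> [N zN]; rewrite (@nsum_trunc z N.+1) => [|n /ltnW/zN//].
by rewrite big_ord_recl (@nsum_trunc _ N) // => n Nn; rewrite zN // leqW.
Qed.

Lemma is_poly_sum (I : eqType) (r : seq I) (Z : I -> nat -> V) :
  (forall i, i \in r -> is_poly (Z i)) -> exists N, forall i n, i \in r -> (N <= n)%N -> Z i n = 0.
Proof.
elim: r => [|i r IHr] Zr; first by exists 0%N.
have [N ZN] := IHr (fun j jr => Zr j (mem_behead (s := i :: r) jr)).
have [N' ZN'] := Zr i (mem_head i r).
exists (maxn N N') => j n; rewrite inE geq_max => /predU1P[->|jr] /andP[Nn N'n].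
  exact: ZN'.
exact: ZN.
Qed.

Lemma nsum_exchange_seq (I : eqType) (r : seq I) (Z : I -> nat -> V) :
  (forall i, i \in r -> is_poly (Z i)) ->
  nsum (fun n => \sum_(i <- r) Z i n) = \sum_(i <- r) nsum (Z i).
Proof.
move=> /is_poly_sum[N ZN]; rewrite (@nsum_trunc _ N) => [|n Nn].
  rewrite exchange_big /=; apply: eq_big_seq => i ir.
  by rewrite (@nsum_trunc _ N) // => n; apply: ZN.
by rewrite big_seq big1 // => i ir; apply: ZN.
Qed.

(** Only the first N rows matter, and finitely many polynomial rows have a common bound M; both
    double sums then reduce to the same finite rectangle. *)
Lemma nsum_exchange (Z : nat -> nat -> V) N :
  (forall n m, (N <= n)%N -> Z n m = 0) -> (forall n, is_poly (Z n)) ->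
  nsum (fun n => nsum (Z n)) = nsum (fun m => nsum (Z^~ m)).
Proof.
move=> ZN /(fun H n _ => H n)/(@is_poly_sum _ (iota 0 N))[M ZM].
have ZM' n m : (M <= m)%N -> Z n m = 0.
  move=> Mm; have [nN|/ZN//] := ltnP n N; apply: ZM => //.
  by rewrite mem_iota.
rewrite (@nsum_trunc _ N) => [|n Nn]; last by apply: nsum0 => m; apply: ZN.
rewrite (@nsum_trunc _ M) => [|m Mm]; last by apply: nsum0 => n; apply: ZM'.
rewrite (eq_bigr (fun n : 'I_N => \sum_(m < M) Z n m)) => [|n _]; last first.
  by apply: nsum_trunc => m; apply: ZM'.
by rewrite exchange_big; apply: eq_bigr => m _; apply/esym/nsum_trunc => n; apply: ZN.
Qed.

End FiniteSums.

Lemma nsum_additive (V W : zmodType) (f : V -> W) (z : nat -> V) :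
  {morph f : x y / x + y} -> is_poly z -> f (nsum z) = nsum (fun n => f (z n)).
Proof.
move=> fD [N zN]; have f0 : f 0 = 0 by apply: (addrI (f 0)); rewrite -fD !addr0.
rewrite !(@nsum_trunc _ _ N) ?(big_morph f fD f0) // => n Nn.
by rewrite zN.
Qed.

Lemma nsumZ (F : fieldType) (V : lmodType F) (c : F) (z : nat -> V) :
  is_poly z -> c *: nsum z = nsum (fun n => c *: z n).
Proof. by apply: nsum_additive => x y; rewrite scalerDr. Qed.

Lemma nsumN (V : zmodType) (z : nat -> V) : is_poly z -> nsum (fun n => - z n) = - nsum z.
Proof. by move=> zP; rewrite (@nsum_additive _ _ -%R) //; apply: opprD. Qed.

Lemma nsumMn (V : zmodType) (z : nat -> V) k : is_poly z -> nsum (fun n => z n *+ k) = nsum z *+ k.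
Proof. by move=> zP; rewrite (@nsum_additive _ _ (fun x : V => x *+ k)) // => x y; apply: mulrnDl. Qed.

(** * Deletion of a label and its sign *)

Section Words.

Definition del (i : nat) (w : seq nat) := [seq x <- w | x != i].

(** The sign of moving i to the front of w, that is (-1) to the power of its position (see
    [sg_index]). *)
Fixpoint sg {F : fieldType} (i : nat) (w : seq nat) : F :=
  if w is x :: w' then (if x == i then 1 else - sg i w') else 1.

Lemma mem_del i w x : (x \in del i w) = (x != i) && (x \in w).
Proof. by rewrite mem_filter. Qed.

Lemma del_uniq i w : uniq w -> uniq (del i w).
Proof. exact: filter_uniq. Qed.

Lemma delC i j w : del i (del j w) = del j (del i w).
Proof. by rewrite /del -!filter_predI; apply: eq_filter => x /=; rewrite andbC. Qed.

Lemma del_cat i s t : del i (s ++ t) = del i s ++ del i t.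
Proof. exact: filter_cat. Qed.

Lemma del_notin i w : i \notin w -> del i w = w.
Proof. by move=> iw; apply/all_filterP/allP => x xw; apply: contraNneq iw => <-. Qed.

Variable F : fieldType.

Lemma sg_cat i s t : i \in s -> sg i (s ++ t) = sg i s :> F.
Proof.
elim: s => //= x s IHs; rewrite inE eq_sym; case: eqVneq => //= _ /IHs->; by [].
Qed.

Lemma sg_catr i s t : i \notin s -> sg i (s ++ t) = (-1) ^+ size s * sg i t :> F.
Proof.
elim: s => [|x s IHs] /=; first by rewrite expr0 mul1r.
rewrite inE negb_or eq_sym => /andP[/negPf-> /IHs->].
by rewrite exprS mulN1r mulNr.
Qed.

(** Moving i and then j to the front, or j and then i, gives words that differ by one interchange.
    This is the only source of sign when two edge operators are exchanged. *)
Lemma sg_del i j w : i != j -> i \in w -> j \in w -> uniq w ->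
  sg i w * sg j (del i w) = - (sg j w * sg i (del j w)) :> F.
Proof.
move=> ij; elim: w => //= x w IHw; rewrite !inE.
have [<-{x IHw}|xi] := eqVneq i x.
  rewrite eq_sym (negPf ij) /= => _ jw /andP[iw _].
  by rewrite eqxx ?mulr1 ?mulNr ?opprK ?mul1r ?del_notin.
have [<-{IHw xi}|xj] := eqVneq j x.
  rewrite /= => iw _ /andP[jw _].
  by rewrite eqxx (del_notin jw) mulr1 mul1r.
rewrite /= => iw jw /andP[_ uw].
by rewrite ![x == _]eq_sym (negPf xi) (negPf xj) !mulrNN IHw.
Qed.

End Words.

Section Linear.
Variables (F : fieldType) (M : lmodType F).

Lemma lin_ext (u v : {linear M -> M}) : u =1 v -> u = v.
Proof.
case: u v => [f [[f1] [f2]]] [g [[g1] [g2]]] /= /funext fg; subst g.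
by rewrite (Prop_irrelevance f1 g1) (Prop_irrelevance f2 g2).
Qed.

End Linear.

Ltac upd_ext := apply: funext => ?; rewrite /upd; repeat (case: eqP => ?); congruence.

Section TriangularSums.
Variable V : zmodType.
Implicit Types G : nat -> nat -> V.

(** Both sides run over the pairs (r, q) with r + q at most n; on the left q is the total of the two
    arguments. *)
Lemma triangle_sum G n :
  \sum_(q < n.+1) \sum_(r < q.+1) G r (q - r)%N = \sum_(r < n.+1) \sum_(q < (n - r).+1) G r q.
Proof.
elim: n => [|n IHn]; first by rewrite !big_ord1.
rewrite big_ord_recr IHn [RHS]big_ord_recr /= subnn big_ord1.
rewrite [X in _ + X]big_ord_recr /= subnn addrA; congr (_ + _).
rewrite -big_split; apply: eq_bigr => r _ /=.
by rewrite subSn ?leq_ord // [RHS]big_ord_recr.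
Qed.

Lemma triangle_sumC G n :
  \sum_(q < n.+1) \sum_(r < (n - q).+1) G r q = \sum_(r < n.+1) \sum_(q < (n - r).+1) G r q.
Proof.
rewrite -(triangle_sum (fun q r => G r q)) -triangle_sum; apply: eq_bigr => q _.
rewrite (reindex_inj rev_ord_inj); apply: eq_bigr => r _ /=.
by rewrite subSS subKn // -ltnS.
Qed.

End TriangularSums.

(** * Power series in labelled variables: derivatives and substitutions *)

Section Series.
Variable V : zmodType.
Local Notation lser := ((nat -> nat) -> V).
Implicit Types (f g : lser) (al : nat -> nat).

Definition der i f : lser := fun al => f (upd al i (al i).+1) *+ (al i).+1.

(* The substitution x_i := x_k; the result no longer depends on x_i. *)
Definition sub i k f : lser :=
  fun al => \sum_(q < (al k).+1) f (upd (upd al i q) k (al k - q)%N).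

Lemma derC i j f : der i (der j f) = der j (der i f).
Proof.
apply: funext => al; rewrite /der; have [->//|ij] := eqVneq i j.
by rewrite upd_comm // !upd_neq // 1?eq_sym // -!mulrnA mulnC.
Qed.

Lemma der_sum (I : Type) (r : seq I) i (f : I -> lser) :
  der i (fun al => \sum_(p <- r) f p al) = (fun al => \sum_(p <- r) der i (f p) al).
Proof. by apply: funext => al; rewrite /der sumrMnl. Qed.

Lemma derMn i f n : der i (fun al => f al *+ n) = (fun al => der i f al *+ n).
Proof. by apply: funext => al; rewrite /der -!mulrnA mulnC. Qed.

Lemma iter_derC i j n m f :
  iter n (der i) (iter m (der j) f) = iter m (der j) (iter n (der i) f).
Proof.
elim: n => //= n ->; elim: m => //= m <-; exact: derC.
Qed.

Lemma der_sub_neq l i k f : l != i -> l != k -> der l (sub i k f) = sub i k (der l f).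
Proof.
move=> li lk; apply: funext => al; rewrite /der /sub upd_neq 1?eq_sym //.
rewrite -sumrMnl; apply: eq_bigr => q _; rewrite !upd_neq //.
by rewrite (upd_comm _ _ _ li) (upd_comm _ _ _ lk).
Qed.

Lemma iter_der_sub_neq l i k n f : l != i -> l != k ->
  iter n (der l) (sub i k f) = sub i k (iter n (der l) f).
Proof. by move=> li lk; elim: n => //= n ->; exact: der_sub_neq. Qed.

(** The chain rule: after x_i := x_k the variable x_k stands for both. *)
Lemma der_sub i k f : i != k ->
  der k (sub i k f) = (fun al => sub i k (der k f) al + sub i k (der i f) al).
Proof.
move=> ik; have /eqP ik' := ik; apply: funext => al; rewrite /der /sub upd_eq; set n := al k.
pose P q r := f (upd (upd al i q) k r).
rewrite (eq_bigr (fun q : 'I_n.+2 => P q (n.+1 - q)%N)) => [|q _]; last first.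
  by rewrite /P; congr f; upd_ext.
(* Each of the two sums on the right is completed by a term with coefficient 0, so that all sums run
   over the pairs (q, n.+1 - q); what remains is n.+1 = (n.+1 - q) + q. *)
rewrite [X in _ = X + _](_ : _ = \sum_(q < n.+2) P q (n.+1 - q)%N *+ (n.+1 - q)); last first.
  rewrite [RHS]big_ord_recr /= subnn mulr0n addr0; apply: eq_bigr => q _.
  by rewrite upd_upd upd_eq subSn ?leq_ord.
rewrite [X in _ = _ + X](_ : _ = \sum_(q < n.+2) P q (n.+1 - q)%N *+ q); last first.
  rewrite [RHS]big_ord_recl /= mulr0n add0r; apply: eq_bigr => q _.
  rewrite upd_neq // upd_eq /bump add1n subSS /P; congr (f _ *+ _).
  by upd_ext.
rewrite -big_split -sumrMnl; apply: eq_bigr => q _ /=.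
by rewrite -mulrnDr subnK ?leq_ord.
Qed.

Lemma sub_sum (I : Type) (r : seq I) i k (f : I -> lser) :
  sub i k (fun al => \sum_(p <- r) f p al) = (fun al => \sum_(p <- r) sub i k (f p) al).
Proof. by apply: funext => al; rewrite /sub exchange_big. Qed.

Lemma subMn i k f n : sub i k (fun al => f al *+ n) = (fun al => sub i k f al *+ n).
Proof. by apply: funext => al; rewrite /sub sumrMnl. Qed.

(** The chain rule iterated: the two derivatives commute, so the p-th power expands by the binomial
    theorem. This is the counterpart for series of the powers of lambda + mu in the Jacobi
    identity. *)
Lemma iter_der_sub i k p f : i != k ->
  iter p (der k) (sub i k f) =
  (fun al => \sum_(r < p.+1) sub i k (iter r (der i) (iter (p - r) (der k) f)) al *+ 'C(p, r)).
Proof.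
move=> ik; elim: p => [|p IHp]; first by apply: funext => al; rewrite big_ord1.
rewrite iterS IHp der_sum; apply: funext => al.
pose T r s := sub i k (iter r (der i) (iter s (der k) f)) al.
rewrite (eq_bigr (fun r : 'I_p.+1 => T r (p.+1 - r)%N *+ 'C(p, r) + T r.+1 (p - r)%N *+ 'C(p, r))).
  rewrite big_split /= big_ord_recl [RHS]big_ord_recl /= !bin0 -addrA; congr (_ + _).
  rewrite [RHS](eq_bigr (fun r : 'I_p.+1 => T r.+1 (p - r)%N *+ 'C(p, r.+1) +
    T r.+1 (p - r)%N *+ 'C(p, r))) => [|r _]; last first.
    by rewrite -mulrnDr /bump add1n subSS binS.
  rewrite big_split /= [X in _ = X + _]big_ord_recr /= bin_small // mulr0n addr0.
  by congr (_ + _); apply: eq_bigr => r _; rewrite /bump add1n subSS.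
move=> r _; rewrite derMn der_sub // mulrnDl /T subSn ?leq_ord //.
by rewrite -[der k (iter r _ _)]/(iter 1 (der k) _) iter_derC.
Qed.

Lemma subC i k j l f : uniq [:: i; j; k; l] -> sub i k (sub j l f) = sub j l (sub i k f).
Proof.
rewrite /= !inE !negb_or !andbT => /and3P[/and3P[ij ik il] /andP[jk jl] kl].
apply: funext => al; rewrite /sub.
rewrite (eq_bigr (fun p : 'I_(al k).+1 => \sum_(q < (al l).+1)
   f (upd (upd (upd (upd al i p) k (al k - p)%N) j q) l (al l - q)%N))) => [|p _]; last first.
  have -> // : upd (upd al i p) k (al k - p)%N l = al l.
  by rewrite !upd_neq // eq_sym.
rewrite exchange_big; apply: eq_bigr => q _ /=.
have -> : upd (upd al j q) l (al l - q)%N k = al k by rewrite !upd_neq // eq_sym.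
apply: eq_bigr => p _; congr f.
by move/eqP in ij; move/eqP in ik; move/eqP in il; move/eqP in jk; move/eqP in jl; move/eqP in kl; upd_ext.
Qed.

Lemma sub_subC i j k f : uniq [:: i; j; k] -> sub j k (sub i k f) = sub i k (sub j k f).
Proof.
rewrite /= !inE !negb_or !andbT => /andP[/andP[/eqP ij /eqP ik] /eqP jk].
apply: funext => al; rewrite /sub.
under eq_bigr do rewrite upd_eq.
under [RHS]eq_bigr do rewrite upd_eq.
pose G x y := f (upd (upd (upd al i x) j y) k (al k - x - y)%N).
transitivity (\sum_(q < (al k).+1) \sum_(r < (al k - q).+1) G r q).
  by apply: eq_bigr => q _; apply: eq_bigr => r _; rewrite /G subnAC; congr f; upd_ext.
rewrite triangle_sumC; apply: eq_bigr => q _; apply: eq_bigr => r _.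
by congr f; upd_ext.
Qed.

(** Either way all three variables are merged into x_k. It is needed when i acts on j and the result
    acts on k. *)
Lemma sub_sub i j k f : uniq [:: i; j; k] -> sub j k (sub i j f) = sub j k (sub i k f).
Proof.
rewrite /= !inE !negb_or !andbT => /andP[/andP[/eqP ij /eqP ik] /eqP jk].
apply: funext => al; rewrite /sub.
under [RHS]eq_bigr do rewrite upd_eq.
pose G x y := f (upd (upd (upd al i x) j y) k (al k - x - y)%N).
transitivity (\sum_(q < (al k).+1) \sum_(r < q.+1) G r (q - r)%N).
  apply: eq_bigr => q _.
  have -> : upd (upd al j q) k (al k - q)%N j = q by rewrite upd_neq ?upd_eq //; apply/eqP.
  apply: eq_bigr => r _; rewrite /G -subnDA subnKC ?leq_ord //; congr f; upd_ext.
rewrite triangle_sum -triangle_sumC; apply: eq_bigr => q _; apply: eq_bigr => r _.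
by rewrite /G subnAC; congr f; upd_ext.
Qed.

End Series.

(** * Chains over words *)

Section ChainRelations.
Variables (F : fieldType) (R : lieConformal F) (M : lcModule R).

Lemma in_span_gen (V : lmodType F) (S : set V) y : S y -> y \in in_span S.
Proof. by move=> Sy; apply/asboolP => U _; apply. Qed.

Lemma dsinj_linear (I : eqType) (V : I -> lmodType F) i : linear (@dsinj F I V i).
Proof.
move=> c u v; apply: dsumP => j /=; case: dfwithP => [|k ik].
  by rewrite !dfwith_in.
by rewrite !dfwith_out // scaler0 addr0.
Qed.

Lemma chain_linear k (a : 'I_k -> R) : linear (@chain F R M k a).
Proof.
move=> c phi psi; rewrite /chain -dsinj_linear -linearP; congr (dsinj _); congr (qpi _ _).
rewrite /ptensor -linearP; apply/qpiP; apply: in_span_gen.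
by right; exists a, phi, psi, c.
Qed.

Lemma chain_multilinear k (a : 'I_k -> R) (phi : mseries M k) i c u v :
  chain [eta a with i |-> c *: u + v] phi =
  c *: chain [eta a with i |-> u] phi + chain [eta a with i |-> v] phi.
Proof.
rewrite /chain -dsinj_linear -linearP; congr (dsinj _); congr (qpi _ _).
rewrite /ptensor -linearP; apply/qpiP; apply: in_span_gen.
by left; exists a, phi, i, c, u, v.
Qed.

Lemma dsinjN (I : eqType) (V : I -> lmodType F) i (u : V i) :
  dsinj (- u) = - dsinj u.
Proof.
apply: dsumP => j /=; case: dfwithP => [|k ik]; first by rewrite dfwith_in.
by rewrite dfwith_out // oppr0.
Qed.

Lemma dsinjZ (I : eqType) (V : I -> lmodType F) i c (u : V i) :
  dsinj (c *: u) = c *: dsinj u.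
Proof.
apply: dsumP => j /=; case: dfwithP => [|k ik]; first by rewrite dfwith_in.
by rewrite dfwith_out // scaler0.
Qed.

Lemma chain_sesquilinear k (a : 'I_k -> R) (phi : mseries M k) i :
  chain [eta a with i |-> lc_d R (a i)] phi = - chain a (mderiv i phi).
Proof.
rewrite /chain -dsinjN -linearN; congr dsinj; apply/qpiP; apply: in_span_gen.
by left; exists a, phi, i; rewrite opprK.
Qed.

Lemma chain_skew k (a : 'I_k -> R) (phi : mseries M k) (s : 'S_k) :
  chain (fun i => a ((s^-1)%g i)) (mperm s phi) = (-1) ^+ s *: chain a phi.
Proof.
rewrite /chain -dsinjZ -linearZ; congr dsinj; apply/qpiP; apply: in_span_gen.
by right; exists a, phi, s.
Qed.

(** The equivalence is needed because [wchain] is 0 on series outside of M_k: permuting variables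
    must not change which series are admissible. *)
Lemma mperm_inv k (s : 'S_k) (phi : fps k M) :
  (fperm s phi \in @series_inv F R M k) = (phi \in @series_inv F R M k).
Proof.
apply/idP/idP => phiP; last exact: (@mperm_subproof F R M k s (MSeries phiP)).
have := @mperm_subproof F R M k (s^-1)%g (MSeries phiP).
rewrite (_ : fperm _ _ = phi) //.
by apply: funext => al; rewrite /fperm /=; congr phi; apply: funext => p; rewrite permK.
Qed.

End ChainRelations.

Section WordChains.
Variables (F : fieldType) (R : lieConformal F) (M : lcModule R).
Local Notation lser := ((nat -> nat) -> M).
Implicit Types (w t u v : seq nat) (a b : nat -> R) (f g : lser) (l : nat).

(** Exponents indexed by positions are carried to the labels of t. Labels outside of t get exponent
    0, which amounts to setting their variables to 0. *)
Definition exps t k (al : 'I_k -> nat) : nat -> nat :=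
  fun l => oapp al 0%N (insub (index l t)).

(** The length k is a separate argument, so that words whose sizes are only provably equal can be
    compared without casts. Making the function total through [insub] removes membership proofs from
    its arguments. *)
Definition wchain k t a f : chain_space M :=
  if insub (fun al : 'I_k -> nat => f (exps t al)) is Some phi
  then @chain F R M k (fun i => a (nth 0%N t i)) phi else 0.

(* The chain with factors a(l), l in w, and series f; it is 0 if f is not a series of M_k
   in the variables of w. *)
Definition chw w a f := wchain (size w) w a f.

(** Invariance is asked only at exponents supported in w, since [chw] sees no others. *)
Definition winv w f :=
  forall al, (forall l, l \notin w -> al l = 0%N) -> \sum_(l <- w) der l f al = lm_d M (f al).

Lemma exps_nth t k (al : 'I_k -> nat) (i : 'I_k) : uniq t -> size t = k ->
  exps t al (nth 0%N t i) = al i.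
Proof. by move=> ut st; rewrite /exps index_uniq ?st // valK. Qed.

Lemma exps_notin t k (al : 'I_k -> nat) l : size t = k -> l \notin t -> exps t al l = 0%N.
Proof. by move=> st lt; rewrite /exps memNindex // insubF //= st ltnn. Qed.

Lemma exps_eq t k (al : 'I_k -> nat) (be : nat -> nat) : uniq t -> size t = k ->
  (forall i : 'I_k, be (nth 0%N t i) = al i) -> (forall l, l \notin t -> be l = 0%N) ->
  exps t al = be.
Proof.
move=> ut st bei be0; apply: funext => l.
have [lt|lt] := boolP (l \in t); last by rewrite exps_notin // be0.
have lk : (index l t < k)%N by rewrite -st index_mem.
by rewrite -(nth_index 0%N lt) -[index l t]/(nat_of_ord (Ordinal lk)) exps_nth // bei.
Qed.

Lemma wchain_eq k t a b f g : size t = k -> {in t, a =1 b} ->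
  (forall al, (forall l, l \notin t -> al l = 0%N) -> f al = g al) ->
  wchain k t a f = wchain k t b g.
Proof.
move=> st ab fg; rewrite /wchain.
have -> : (fun al : 'I_k -> nat => f (exps t al)) = (fun al => g (exps t al)).
  by apply: funext => al; apply: fg => l /exps_notin->.
case: insub => // phi; congr (chain _ phi); apply: funext => i.
by apply: ab; rewrite mem_nth // st.
Qed.

Lemma chw_eq w a b f g : {in w, a =1 b} ->
  (forall al, (forall l, l \notin w -> al l = 0%N) -> f al = g al) ->
  chw w a f = chw w b g.
Proof. exact: wchain_eq. Qed.

Lemma exps_raise t k (al : 'I_k -> nat) (i : 'I_k) : uniq t -> size t = k ->
  exps t (raise i al) = upd (exps t al) (nth 0%N t i) (al i).+1.
Proof.
move=> ut st; apply: exps_eq => // [j|l lt].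
  rewrite /upd nth_uniq ?st // /raise exps_nth //.
  by rewrite (inj_eq val_inj); case: eqP => [->|]; rewrite ?addn1 ?addn0.
rewrite upd_neq ?exps_notin //; apply: contraNneq lt => ->.
by rewrite mem_nth // st.
Qed.

Lemma fderiv_exps t k f (i : 'I_k) : uniq t -> size t = k ->
  fderiv i (fun al : 'I_k -> nat => f (exps t al)) =
  (fun al => der (nth 0%N t i) f (exps t al)).
Proof.
by move=> ut st; apply: funext => al; rewrite /fderiv /der exps_raise // exps_nth.
Qed.

Lemma winv_series w k f : uniq w -> size w = k -> winv w f ->
  (fun al : 'I_k -> nat => f (exps w al)) \in @series_inv F R M k.
Proof.
move=> uw sw fP; apply/series_invP => al; rewrite -fP; last by move=> l /exps_notin->.
rewrite ftotalE (big_nth 0%N) sw big_mkord; apply: eq_bigr => i _.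
by rewrite fderiv_exps.
Qed.

Lemma wchainT k t a f (fS : (fun al : 'I_k -> nat => f (exps t al)) \in @series_inv F R M k) :
  wchain k t a f = chain (fun i : 'I_k => a (nth 0%N t i)) (MSeries fS).
Proof.
rewrite /wchain; case: insubP => [phi _ phiE|/negP//].
by congr (chain _ _); apply: val_inj; rewrite phiE.
Qed.

Lemma wchainF k t a f : (fun al : 'I_k -> nat => f (exps t al)) \notin @series_inv F R M k ->
  wchain k t a f = 0.
Proof. by rewrite /wchain; case: insubP => // phi ->. Qed.

Lemma chwE w a f : uniq w -> winv w f ->
  exists phi : mseries M (size w), (forall al, phi al = f (exps w al)) /\
    chw w a f = chain (fun i => a (nth 0%N w i)) phi.
Proof.
move=> uw fP; have fS := winv_series uw (erefl _) fP.
by exists (MSeries fS); split=> //; rewrite /chw wchainT.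
Qed.

(** Any injective labelling of the positions represents the given chain; through this freedom the
    chains of the definition enter the calculus of words. *)
Lemma chain_chw k (b : 'I_k -> R) (phi : mseries M k) (lab : 'I_k -> nat) a f :
  injective lab -> (forall i, a (lab i) = b i) ->
  (forall al, (forall l, l \notin codom lab -> al l = 0%N) ->
     f al = phi (fun i => al (lab i))) ->
  chain b phi = chw [seq lab i | i <- enum 'I_k] a f.
Proof.
move=> lab_inj ab fphi; set w := map _ _.
have sw : size w = k by rewrite size_map size_enum_ord.
have uw : uniq w by rewrite map_inj_uniq ?enum_uniq.
have nw (i : 'I_k) : nth 0%N w i = lab i.
  by rewrite (nth_map i) ?size_enum_ord // nth_ord_enum.
rewrite /chw sw /wchain.
have -> : (fun al : 'I_k -> nat => f (exps w al)) = phi.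
  apply: funext => al; rewrite fphi => [|l lw]; last by rewrite exps_notin.
  by congr (mseries_val phi _); apply: funext => i; rewrite -nw exps_nth.
rewrite valK; congr (chain _ phi); apply: funext => i.
by rewrite nw ab.
Qed.

Lemma chw_linear w a f g c : uniq w -> winv w f -> winv w g ->
  chw w a (fun al => c *: f al + g al) = c *: chw w a f + chw w a g.
Proof.
move=> uw fP gP; have fS := winv_series uw (erefl _) fP; have gS := winv_series uw (erefl _) gP.
have hS := mseries_valP (c *: (MSeries fS : mseries M _) + MSeries gS).
rewrite /chw (@wchainT _ w a f fS) (@wchainT _ w a g gS) -chain_linear.
rewrite (@wchainT _ w a (fun al => c *: f al + g al) hS).
by congr (chain _ _); apply: val_inj.
Qed.

Lemma chw_multilinear w a f l c x y : uniq w -> l \in w ->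
  chw w (upd a l (c *: x + y)) f = c *: chw w (upd a l x) f + chw w (upd a l y) f.
Proof.
move=> uw lw; rewrite /chw /wchain; case: insubP => [phi _ _|_]; last by rewrite scaler0 addr0.
have lk : (index l w < size w)%N by rewrite index_mem.
pose i := Ordinal lk.
have E z : (fun j : 'I_(size w) => upd a l z (nth 0%N w j)) =
    [eta (fun j : 'I_(size w) => a (nth 0%N w j)) with i |-> z].
  apply: funext => j /=; rewrite /upd -{1}(nth_index 0%N lw) nth_uniq //.
by rewrite !E chain_multilinear.
Qed.

Lemma chw_sesquilinear w a f l : uniq w -> l \in w -> winv w f ->
  chw w (upd a l (lc_d R (a l))) f = - chw w a (der l f).
Proof.
move=> uw lw fP; have fS := winv_series uw (erefl _) fP.
have lk : (index l w < size w)%N by rewrite index_mem.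
pose i := Ordinal lk; have iE : nth 0%N w i = l by rewrite /= nth_index.
have gS := mderiv_subproof i (MSeries fS); rewrite /= fderiv_exps // iE in gS.
rewrite /chw (@wchainT _ w _ f fS) (@wchainT _ w a (der l f) gS).
transitivity (chain [eta fun j : 'I_(size w) => a (nth 0%N w j) with i |-> lc_d R (a l)] (MSeries fS)).
  congr (chain _ _); apply: funext => j /=; rewrite /upd -{1}iE nth_uniq //.
have := chain_sesquilinear (fun j => a (nth 0%N w j)) (MSeries fS) i.
rewrite iE => ->; congr (- chain _ _); apply: val_inj.
by rewrite /= fderiv_exps // iE.
Qed.

(** Only interchanges of neighbours are required, as they generate all rearrangements; words with a
    repeated label are left out. *)
Definition alt (V : zmodType) (K : seq nat -> V) :=
  forall u x y v, uniq (u ++ x :: y :: v) -> K (u ++ x :: y :: v) = - K (u ++ y :: x :: v).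

Lemma chw_alt a f : alt (fun w => chw w a f).
Proof.
move=> u x y v; set t := u ++ x :: y :: v; set t' := u ++ y :: x :: v => ut.
have ptt' : perm_eq t t'.
  by rewrite perm_cat2l; exact: permEl (perm_catCA [:: x] [:: y] v).
have ut' : uniq t' by rewrite -(perm_uniq ptt').
pose k := size t; have st : size t = k by [].
have st' : size t' = k by rewrite -(perm_size ptt').
rewrite /chw st' -/k.
have k1 : (size u < k)%N by rewrite -st size_cat /= !addnS ltnS leqW // leq_addr.
have k2 : ((size u).+1 < k)%N by rewrite -st size_cat /= !addnS !ltnS leq_addr.
(* Exchanging neighbouring labels of the word is the action of this transposition of positions. *)
pose s := tperm (Ordinal k1) (Ordinal k2).
have tE (i : 'I_k) : nth 0%N t' i = nth 0%N t ((s^-1)%g i).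
  rewrite tpermV /s; case: tpermP => [->|->|/eqP i1 /eqP i2] /=.
  - by rewrite !nth_cat ltnn subnn ltnNge leqnSn /= subSnn.
  - by rewrite !nth_cat ltnn subnn ltnNge leqnSn /= subSnn.
  rewrite !nth_cat; case: ltnP => // ui.
  have : (i - size u)%N != 0%N by apply: contra i1 => /eqP E; apply/eqP/val_inj; rewrite /= -(subnKC ui) E addn0.
  have : (i - size u)%N != 1%N by apply: contra i2 => /eqP E; apply/eqP/val_inj; rewrite /= -(subnKC ui) E addn1.
  by case: (i - size u)%N => [|[|]].
have eE (al : 'I_k -> nat) : exps t' al = exps t (fun i => al (s i)).
  apply/esym/exps_eq => // [i|l lt].
    by rewrite -[i in LHS](permK s) -tE exps_nth.
  by rewrite exps_notin // -(perm_mem ptt').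
have fE : (fun al : 'I_k -> nat => f (exps t' al)) = fperm s (fun al => f (exps t al)).
  by apply: funext => al; rewrite eE.
(* For a series outside of M_k both sides are 0 by the default value of [wchain]. *)
have [fS|fS] := boolP ((fun al : 'I_k -> nat => f (exps t al)) \in @series_inv F R M k); last first.
  by rewrite !wchainF ?oppr0 // fE mperm_inv.
have fS' := fS; rewrite -(mperm_inv s) -fE in fS'.
rewrite (@wchainT _ t a f fS) (@wchainT _ t' a f fS') (_ : MSeries fS' = mperm s (MSeries fS)); last exact: val_inj.
have -> : (fun i : 'I_k => a (nth 0%N t' i)) = (fun i => a (nth 0%N t ((s^-1)%g i))).
  by apply: funext => i; rewrite tE.
rewrite (chain_skew (fun i : 'I_k => a (nth 0%N t i))) odd_tperm (_ : (_ != _) = true).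
  by rewrite expr1 scaleN1r opprK.
by rewrite -val_eqE /= neq_ltn ltnSn.
Qed.

End WordChains.

(** * Alternating functions of words *)

Section Alternating.
Variables (F : fieldType) (V : lmodType F).
Implicit Types (K : seq nat -> V) (u w : seq nat).

Lemma alt_front K u w i : alt K -> uniq (u ++ w) -> i \in w ->
  K (u ++ w) = (sg i w : F) *: K (u ++ i :: del i w).
Proof.
move=> Ka; elim: w u => //= x w IHw u uw; rewrite inE eq_sym.
have [xi _|xi /= iw] := eqVneq x i.
  rewrite {x IHw}xi in uw *.
  by rewrite scale1r del_notin //; move: uw; rewrite cat_uniq /= => /and4P[].
have wx : x \notin w by move: uw; rewrite cat_uniq /= => /and4P[].
have p : perm_eq (u ++ x :: w) (u ++ x :: i :: del i w).
  rewrite perm_cat2l perm_cons -[del i w]rem_filter ?perm_to_rem //.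
  by move: uw; rewrite cat_uniq /= => /and4P[].
rewrite -cat1s catA IHw -?catA //= Ka ?scaleNr ?scalerN //.
by rewrite -(perm_uniq p).
Qed.

Lemma alt_swap1 K r s x v : alt K -> uniq (r ++ s ++ x :: v) ->
  K (r ++ s ++ x :: v) = (-1 : F) ^+ size s *: K (r ++ x :: s ++ v).
Proof.
move=> Ka; elim: s r => [|y s IHs] r ru; first by rewrite expr0 scale1r.
have := IHs (r ++ [:: y]); rewrite -!catA /= => IH.
rewrite IH // exprS mulN1r scaleNr -scalerN.
congr (_ *: _); apply: Ka; move: ru; apply: etrans; apply/esym/perm_uniq.
by rewrite perm_cat2l /= perm_cons; exact: permEl (perm_catCA s [:: x] v).
Qed.

Lemma alt_swap K r s t v : alt K -> uniq (r ++ s ++ t ++ v) ->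
  K (r ++ s ++ t ++ v) = (-1 : F) ^+ (size s * size t) *: K (r ++ t ++ s ++ v).
Proof.
move=> Ka; elim: t r => [|x t IHt] r ru; first by rewrite muln0 expr0 scale1r.
have := IHt (r ++ [:: x]); rewrite -!catA /= => IH.
rewrite alt_swap1 // IH ?scalerA -?exprD ?mulnS //.
move: ru; apply: etrans; apply/esym/perm_uniq.
by rewrite perm_cat2l; exact: permEl (perm_catCA s [:: x] (t ++ v)).
Qed.

(** If i is one of the two interchanged letters, both words agree after deletion and the signs [sg]
    are opposite; otherwise [sg] is unchanged and K itself gives the sign. Consequently edge
    operators preserve alternation. *)
Lemma alt_op K i : alt K -> alt (fun w => (sg i w : F) *: K (del i w)).
Proof.
move=> Ka u x y v uw; rewrite !del_cat /=.
have [uu [xu yu] xy] : [/\ uniq u, x \notin u /\ y \notin u & x != y].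
  move: uw; rewrite cat_uniq /= !inE !negb_or => /and4P[-> /and3P[-> -> _] /andP[-> _] _].
  by [].
have [iu|iu] := boolP (i \in u).
  have ix : x != i by apply: contraNneq xu => ->.
  have iy : y != i by apply: contraNneq yu => ->.
  rewrite !sg_cat // -scalerN ix iy; congr (_ *: _); apply: Ka.
  by have := del_uniq i uw; rewrite del_cat /= ix iy.
rewrite !sg_catr // -!scalerA -scalerN; congr (_ *: _); rewrite /=.
have [xi|xi] := eqVneq x i.
  by rewrite -xi [y == x]eq_sym (negPf xy) /= scaleNr opprK.
have [yi|yi] := eqVneq y i; first by rewrite /= scaleNr.
rewrite /= opprK -scalerN; congr (_ *: _); apply: Ka.
by have := del_uniq i uw; rewrite del_cat /= xi yi.
Qed.

End Alternating.

Section Rename.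
Variables (F : fieldType) (R : lieConformal F) (M : lcModule R).
Local Notation lser := ((nat -> nat) -> M).
Implicit Types (w : seq nat) (a b : nat -> R) (f g : lser).

(** The name of a label has no meaning. The exponent 0 at j is needed because g may formally depend
    on the variable x_j, which is not in its word. *)
Lemma chw_rename i j w a b f g : uniq (i :: w) -> uniq (j :: w) -> a j = b i ->
  {in w, a =1 b} -> (forall al, f al = g (upd (upd al j 0%N) i (al j))) ->
  chw (j :: w) a f = chw (i :: w) b g.
Proof.
move=> ui uj abj abw fg; rewrite /chw /wchain /=.
have -> : (fun al : 'I_(size w).+1 -> nat => f (exps (j :: w) al)) =
          (fun al => g (exps (i :: w) al)).
  apply: funext => al; rewrite fg; congr g; apply/esym.
  have e0 : exps (j :: w) al j = al ord0 by exact: (exps_nth al ord0 uj).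
  apply: exps_eq => //= [p|l].
    case: (unliftP ord0 p) => [q|] ->; last by rewrite /= upd_eq e0.
    have qw : nth 0%N w q \in w by rewrite mem_nth.
    rewrite lift0 /= upd_neq; last by apply: contraTneq ui => <-; rewrite /= qw.
    rewrite upd_neq; last by apply: contraTneq uj => <-; rewrite /= qw.
    exact: (exps_nth al (lift ord0 q) uj).
  rewrite inE negb_or => /andP[li lw]; rewrite upd_neq // /upd.
  by case: eqP => // /eqP lj; rewrite exps_notin //= inE negb_or lj.
case: insub => // phi; congr (chain _ phi); apply: funext => p.
case: (unliftP ord0 p) => [q|] ->; last exact: abj.
by rewrite lift0 /= abw // mem_nth.
Qed.

Lemma sub_rename i j f al : i != j ->
  sub j i f (upd (upd al j 0%N) i (al j)) = sub i j f al.
Proof.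
move=> /eqP ij; rewrite /sub upd_eq (reindex_inj rev_ord_inj); apply: eq_bigr => q _ /=.
rewrite subSS subKn ?leq_ord //; congr f; upd_ext.
Qed.

(** Identifying x_i and x_j leaves one merged slot, and calling it i or j is only a choice of name.
    Moving it to the front in both words yields the opposite signs of [sg_del]. *)
Lemma chw_sub_swap i j w a f x : uniq w -> i != j -> i \in w -> j \in w ->
  (sg i w : F) *: chw (del i w) (upd a j x) (sub i j f) =
  - ((sg j w : F) *: chw (del j w) (upd a i x) (sub j i f)).
Proof.
move=> uw ij iw jw.
have jw' : j \in del i w by rewrite mem_del jw eq_sym ij.
have iw' : i \in del j w by rewrite mem_del iw ij.
rewrite (@alt_front _ _ _ [::] _ j (@chw_alt _ _ _ _ _)) ?del_uniq //=.
rewrite [in RHS](@alt_front _ _ _ [::] _ i (@chw_alt _ _ _ _ _)) ?del_uniq //=.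
rewrite !scalerA sg_del // scaleNr; congr (- (_ *: _)).
rewrite delC; apply: chw_rename; rewrite ?upd_eq //=.
- by rewrite mem_del eqxx /= !del_uniq.
- by rewrite delC mem_del eqxx /= !del_uniq.
- by move=> l; rewrite !mem_del => /and3P[li lj _]; rewrite !upd_neq.
- by move=> al; rewrite sub_rename.
Qed.

End Rename.

(** * Coefficient functions with operator slots *)

Section Tagged.
Variables (F : fieldType) (R : lieConformal F) (M : lcModAlgebra R).
Local Notation LM := {linear M -> M}.
Local Notation mul := (@la_mul F R M).
Local Notation ser := ((nat -> LM) -> (nat -> nat) -> M).
Implicit Types (x y : R) (m : M) (U : nat -> LM) (G H : ser) (al be : nat -> nat).

Definition actf x n : M -> M := fun m => lm_act x m n.

Fact actf_linear x n : linear (actf x n).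
Proof. by case: (lm_actP M) => _ lin_act _ c u v; rewrite /actf lin_act. Qed.
HB.instance Definition _ x n := GRing.isLinear.Build F M M _ (actf x n) (actf_linear x n).

Definition actL x n : LM := actf x n.
Definition compL (u v : LM) : LM := u \o v.
Definition idL : LM := idfun.

Lemma actL_linear c x y n m : actL (c *: x + y) n m = c *: actL x n m + actL y n m.
Proof. by case: (lm_actP M) => lin_act _ _; rewrite /= /actf lin_act. Qed.

Lemma actL_poly x m : is_poly (fun n => actL x n m).
Proof. by case: (lm_actP M) => _ _; apply. Qed.

Lemma actL_d x n m : actL (lc_d R x) n m = - (if n is p.+1 then actL x p m else 0).
Proof. by rewrite /= /actf; case: (lm_sesqui M) => -> _; case: n. Qed.

Lemma actL_dM x n m :
  actL x n (lm_d M m) = lm_d M (actL x n m) + (if n is p.+1 then actL x p m else 0).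
Proof. by rewrite /= /actf; case: (lm_sesqui M) => _ ->; case: n. Qed.

Definition derivation (D : LM) := forall m n, D (mul m n) = mul (D m) n + mul m (D n).

Lemma actL_der x n : derivation (actL x n).
Proof. by move=> m m'; rewrite /= /actf la_act_der. Qed.

Lemma compLid u : compL u idL = u.
Proof. exact: lin_ext. Qed.

Lemma compLA u v z : compL u (compL v z) = compL (compL u v) z.
Proof. exact: lin_ext. Qed.

Lemma compidL u : compL idL u = u.
Proof. exact: lin_ext. Qed.

Lemma mulDl m n p : mul (m + n) p = mul m p + mul n p.
Proof. by have := la_mul_linl p 1 m n; rewrite !scale1r. Qed.
Lemma mulDr m n p : mul p (m + n) = mul p m + mul p n.
Proof. by have := la_mul_linr p 1 m n; rewrite !scale1r. Qed.
Lemma mul0m m : mul 0 m = 0.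
Proof. by apply: (addrI (mul 0 m)); rewrite -mulDl !addr0. Qed.
Lemma mulm0 m : mul m 0 = 0.
Proof. by rewrite la_mulC mul0m. Qed.
Lemma mul_suml (I : Type) (r : seq I) (f : I -> M) m :
  mul (\sum_(i <- r) f i) m = \sum_(i <- r) mul (f i) m.
Proof. by apply: (big_morph (mul^~ m)) => [u v|]; rewrite ?mulDl ?mul0m. Qed.
Lemma mul_sumr (I : Type) (r : seq I) (f : I -> M) m :
  mul m (\sum_(i <- r) f i) = \sum_(i <- r) mul m (f i).
Proof. by rewrite la_mulC mul_suml; apply: eq_bigr => i _; rewrite la_mulC. Qed.
Lemma mulMnl m n k : mul (m *+ k) n = mul m n *+ k.
Proof. by elim: k => [|k IHk]; rewrite ?mulr0n ?mul0m // !mulrS mulDl IHk. Qed.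
Lemma mulMnr m n k : mul n (m *+ k) = mul n m *+ k.
Proof. by rewrite la_mulC mulMnl la_mulC. Qed.

(* A product of coefficient functions is kept as a function G of a family of operators U:
   U t is applied to the factor with tag t, and U = id gives the actual product [mu G]. An
   element of R can thus act on one chosen factor after the factors have been multiplied. *)
Definition mu G : (nat -> nat) -> M := G (fun _ => idL).
Definition derS i G : ser := fun U => der i (G U).
Definition subS i k G : ser := fun U => sub i k (G U).
(* The factor n! compensates the 1/n! contained in the coefficients of the lambda-action,
   as the coefficient of x_i^n is the n-th derivative at 0 divided by n!. *)
Definition actS x i t G : ser := fun U al =>
  nsum (fun n => G (upd U t (compL (U t) (actL x n))) (upd al i n) *+ n`!).
Definition mulS G H : ser := fun U al => mul (G U al) (H U al).

(* G behaves as a product of series in the variables of w, one for each tag in A. *)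
Record good (w A : seq nat) G : Prop := Good {
  good_loc : forall U al be, {in w, al =1 be} -> G U al = G U be;
  good_tag : forall U V al, {in A, U =1 V} -> G U al = G V al;
  good_lin : forall t U c (u v z : LM) al, t \in A -> (forall m, z m = c *: u m + v m) ->
    G (upd U t z) al = c *: G (upd U t u) al + G (upd U t v) al;
  good_der : forall (D : LM) U al, derivation D ->
    D (G U al) = \sum_(t <- A) G (upd U t (compL D (U t))) al;
  good_inv : forall U al,
    \sum_(l <- w) der l (G U) al = \sum_(t <- A) G (upd U t (compL (U t) (lm_d M))) al;
  good_fin : forall t x (v : LM) al, t \in A -> exists N, forall n U, (N <= n)%N ->
    G (upd U t (compL (compL (U t) (actL x n)) v)) al = 0 }.

Definition off (S : seq nat) al be := forall l, l \notin S -> be l = al l.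

(* The factor with tag t does not involve the variables of S. *)
Definition slot G (S : seq nat) t := forall al, exists m, forall be, off S al be ->
  forall U, exists2 T : M -> M, {morph T : p q / p + q} & forall u : LM, G (upd U t u) be = T (u m).

(** Uniformity in the exponents of S is essential: in [actS] the order n of the action is also the
    exponent of x_i, so a bound valid at one exponent would not truncate the sum. *)
Definition sfin G (S : seq nat) t := forall x al, exists N, forall n be U, (N <= n)%N ->
  off S al be -> G (upd U t (compL (U t) (actL x n))) be = 0.

(** For all exponents in question the factor is the same element m, and the lambda-action on m is
    polynomial. *)
Lemma slot_sfin G S t : slot G S t -> sfin G S t.
Proof.
move=> Gs x al; have [m Gm] := Gs al; have [N xN] := actL_poly x m.
exists N => n be U Nn /Gm/(_ U)[T TD ->].
have T0 : T 0 = 0 by apply: (addrI (T 0)); rewrite -TD !addr0.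
by rewrite /= [X in U t X]xN // linear0.
Qed.

(** At U = id, [good_inv] composes the operator of M on one side and [good_der] on the other; with
    the identity both give the same sum. *)
Lemma good_winv w A G : good w A G -> winv w (mu G).
Proof.
move=> gG al _; rewrite /mu (good_inv gG) (good_der gG); last exact: la_d_der.
by apply: eq_bigr => t _; rewrite compLid compidL.
Qed.

Lemma good_derS i w A G : i \in w -> good w A G -> good w A (derS i G).
Proof.
move=> iw [Gloc Gtag Glin Gder Ginv Gfin]; split.
- move=> U al be ab; rewrite /derS /der (ab i iw); congr (_ *+ _); apply: Gloc.
  by move=> l lw; rewrite /upd; case: eqP => // _; apply: ab.
- by move=> U V al UV; rewrite /derS /der (Gtag U V).
- move=> t U c u v z al tA zE; rewrite /derS /der (Glin _ _ _ _ _ _ _ tA zE).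
  by rewrite mulrnDl scalerMnr.
- by move=> D U al Dd; rewrite /derS /der linearMn /= Gder // -sumrMnl.
- move=> U al; rewrite /derS.
  rewrite [LHS](_ : _ = der i (fun al => \sum_(l <- w) der l (G U) al) al); last first.
    by rewrite der_sum; apply: eq_bigr => l _; rewrite derC.
  by rewrite (funext (Ginv U)) der_sum.
- move=> t x v al tA; have [N GN] := Gfin t x v (upd al i (al i).+1) tA.
  by exists N => n U Nn; rewrite /derS /der GN // mul0rn.
Qed.

Lemma good_iter_derS i w A G n : i \in w -> good w A G -> good w A (fun U => iter n (der i) (G U)).
Proof. by move=> iw gG; elim: n => //= n IHn; apply: (good_derS iw IHn). Qed.

Lemma sum_del (V : nmodType) w (f : nat -> V) i : uniq w -> i \in w ->
  \sum_(l <- w) f l = f i + \sum_(l <- del i w) f l.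
Proof. by move=> uw iw; rewrite (bigD1_seq i) //= big_filter. Qed.

(** Invariance survives the substitution because the derivative in x_k of the result accounts for
    both variables k and i of w. *)
Lemma good_subS i k w A G : uniq w -> i != k -> i \in w -> k \in w ->
  good w A G -> good (del i w) A (subS i k G).
Proof.
move=> uw ik iw kw [Gloc Gtag Glin Gder Ginv Gfin].
have kw' : k \in del i w by rewrite mem_del eq_sym ik.
split.
- move=> U al be ab; rewrite /subS /sub (ab k kw'); apply: eq_bigr => q _; apply: Gloc.
  move=> l lw; rewrite /upd; case: eqP => // _; case: eqP => // /eqP li.
  by apply: ab; rewrite mem_del li.
- by move=> U V al UV; rewrite /subS /sub (funext (fun be => Gtag U V be UV)).
- move=> t U c u v z al tA zE; rewrite /subS /sub scaler_sumr -big_split.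
  by apply: eq_bigr => q _; apply: Glin.
- move=> D U al Dd; rewrite /subS /sub linear_sum exchange_big /=.
  by apply: eq_bigr => q _; apply: Gder.
- move=> U al; rewrite (@sum_del _ _ _ k) ?del_uniq //.
  rewrite /subS der_sub // (eq_big_seq (fun l => sub i k (der l (G U)) al)) => [|l]; last first.
    by rewrite !mem_del => /and3P[lk li _]; rewrite der_sub_neq.
  rewrite [X in X + _]addrC -addrA -sum_del ?del_uniq //.
  rewrite -(sum_del (fun l => sub i k (der l (G U)) al)) //.
  rewrite -[LHS](congr1 (fun f => f al) (sub_sum w i k (fun l => der l (G U)))).
  by rewrite (funext (Ginv U)) sub_sum.
- move=> t x v al tA.
  have /boolp.choice[N GN] q := Gfin t x v (upd (upd al i q) k (al k - q)%N) tA.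
  exists (\sum_(q < (al k).+1) N q)%N => n U Nn; rewrite /subS /sub big1 // => q _.
  by apply: GN; apply: leq_trans Nn; rewrite (bigD1 q) //= leq_addr.
Qed.

(** The essential point is invariance. Two defects arise: the derivative in the contracted variable
    x_i is missing, and the action of order n commutes with the operator of M only up to the action
    of order n - 1. Both are the same sequence T, up to a shift of the index, and cancel in the
    sum. *)
Lemma good_actS x i t w A G : uniq w -> uniq A -> i \in w -> t \in A -> sfin G [:: i] t ->
  good w A G -> good (del i w) A (actS x i t G).
Proof.
move=> uw uA iw tA Gs [Gloc Gtag Glin Gder Ginv Gfin].
have offi al n : off [:: i] al (upd al i n).
  by move=> l; rewrite inE => li; rewrite upd_neq.
have Gp U al : is_poly (fun n => G (upd U t (compL (U t) (actL x n))) (upd al i n) *+ n`!).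
  have [N GN] := Gs x al; exists N => n Nn; rewrite GN ?mul0rn //.
have UC U t' u n : t' != t -> upd (upd U t' u) t (compL (upd U t' u t) (actL x n)) =
    upd (upd U t (compL (U t) (actL x n))) t' u.
  by move=> t't; rewrite upd_comm // upd_neq // eq_sym.
split.
- move=> U al be ab; apply: eq_nsum => n; congr (_ *+ _); apply: Gloc => l lw.
  by rewrite /upd; case: eqP => // /eqP li; apply: ab; rewrite mem_del li.
- move=> U V al UV; apply: eq_nsum => n; congr (_ *+ _); apply: Gtag => t' t'A.
  by rewrite /upd; case: eqP => _; [rewrite (UV t tA)|apply: UV].
- move=> t' U c u v z al t'A zE.
  rewrite /actS nsumZ // -nsumD //; last first.
    by have [N GN] := Gp (upd U t' u) al; exists N => n /GN->; rewrite scaler0.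
  apply: eq_nsum => n; rewrite -scalerMnr -mulrnDl; congr (_ *+ _).
  have [->|t't] := eqVneq t' t.
    by rewrite !upd_upd !upd_eq; apply: Glin => // m /=; rewrite zE.
  by rewrite !UC //; apply: Glin.
- move=> D U al Dd; rewrite /actS nsum_additive //; last exact: linearD.
  rewrite -nsum_exchange_seq => [|t' _]; last exact: Gp.
  apply: eq_nsum => n; rewrite linearMn /= Gder // -sumrMnl; apply: eq_bigr => t' _.
  congr (G _ _ *+ _); have [->|t't] := eqVneq t' t.
    by rewrite !upd_upd !upd_eq compLA.
  by rewrite UC // upd_neq.
- move=> U al.
  pose Z V n := G V (upd al i n).
  pose U' n := upd U t (compL (U t) (actL x n)).
  (* The term with the action of order n - 1 at the exponent n of x_i. Its shift is the missing
     derivative in x_i, as (n.+1)! = n.+1 * n!. *)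
  pose T n := if n is p.+1 then Z (U' p) n *+ n`! else 0.
  have TP : is_poly T.
    have [N GN] := Gs x al; exists N.+1 => -[//|n] Nn.
    by rewrite /T /Z GN ?mul0rn.
  have dE l : l \in del i w -> der l (actS x i t G U) al =
      nsum (fun n => der l (G (U' n)) (upd al i n) *+ n`!).
    rewrite mem_del => /andP[li _]; rewrite /der /actS -nsumMn //.
    by apply: eq_nsum => n; rewrite upd_neq // upd_comm // -!mulrnA mulnC.
  have dP l : l \in del i w -> is_poly (fun n => der l (G (U' n)) (upd al i n) *+ n`!).
    rewrite mem_del => /andP[li _].
    have [N GN] := Gs x (upd al l (al l).+1); exists N => n Nn.
    by rewrite /der upd_neq // upd_comm 1?eq_sym // GN // !mul0rn.
  rewrite (eq_big_seq _ dE) -nsum_exchange_seq // -nsum_exchange_seq => [|t' _]; last exact: Gp.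
  pose S n := \sum_(t' <- A) Z (upd (U' n) t' (compL (U' n t') (lm_d M))) n *+ n`!.
  have SE n : \sum_(l <- del i w) der l (G (U' n)) (upd al i n) *+ n`! + T n.+1 = S n.
    rewrite /S [RHS]sumrMnl /Z -(Ginv (U' n)) -[RHS]sumrMnl.
    rewrite (sum_del _ uw iw) addrC; congr (_ + _).
    by rewrite /der upd_eq upd_upd /T /Z -mulrnA factS.
  have TP' : is_poly (fun n => T n.+1) by have [N TN] := TP; exists N => n /leqW/TN.
  have SP : is_poly S.
    have [N dN] := is_poly_sum dP; have [N' TN'] := TP'; exists (maxn N N') => n.
    rewrite geq_max => /andP[Nn N'n]; rewrite -SE TN' // addr0 big1_seq // => l /dN; exact.
  transitivity (nsum (fun n => S n - T n.+1)); first by apply: eq_nsum => n; rewrite -SE addrK.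
  (* The shift costs nothing since T 0 = 0. *)
  have -> : nsum (fun n => S n - T n.+1) = nsum (fun n => S n - T n).
    have NP (z : nat -> M) : is_poly z -> is_poly (fun n => - z n).
      by move=> [N zN]; exists N => n /zN->; rewrite oppr0.
    rewrite !nsumD ?nsumN //; try exact: NP.
    by rewrite (nsum_recl TP) /= add0r.
  apply: eq_nsum => n; rewrite /S (bigD1_seq t) //= [RHS](bigD1_seq t) //= addrAC.
  congr (_ + _); last first.
    apply: eq_bigr => t' t't; congr (G _ _ *+ _).
    by rewrite UC // /U' upd_neq.
  rewrite /U' /Z !upd_upd !upd_eq.
  case: n => [|n].
    rewrite /T subr0; congr (G (upd U t _) _ *+ _); apply: lin_ext => m /=.
    by rewrite [in LHS]actL_dM addr0.
  rewrite /T /Z (@Glin t U 1 (compL (compL (U t) (lm_d M)) (actL x n.+1))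
    (compL (U t) (actL x n))) //.
    by rewrite scale1r mulrnDl addrK.
  by move=> m /=; rewrite scale1r [in LHS]actL_dM linearD.
- move=> t' x' v al t'A; have [N0 GN0] := Gs x al.
  have CH (n : nat) : exists N, forall (m : nat) U, (N <= m)%N ->
      G (upd (upd U t' (compL (compL (U t') (actL x' m)) v)) t
        (compL (upd U t' (compL (compL (U t') (actL x' m)) v) t) (actL x n))) (upd al i n) = 0.
    (* On the same tag the order-n action of x stands behind the operators of x' and v; it is
       absorbed in the trailing operator that [good_fin] allows. *)
    have [->|t't] := eqVneq t' t.
      have [N GN] := Gfin t x' (compL v (actL x n)) (upd al i n) tA.
      by exists N => m U /(GN m U) <-; rewrite upd_upd upd_eq compLA.
    have [N GN] := Gfin t' x' v (upd al i n) t'A.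
    exists N => m U Nm; rewrite UC //.
    have := GN m (upd U t (compL (U t) (actL x n))) Nm.
    by rewrite upd_neq.
  have [N GN] := boolp.choice CH.
  exists (\sum_(n < N0) N n)%N => m U Nm; apply: nsum0 => n.
  have [nN|Nn] := ltnP n N0; last by rewrite GN0 ?mul0rn.
  rewrite GN ?mul0rn //; apply: leq_trans Nm.
  by rewrite (bigD1 (Ordinal nN)) //= leq_addr.
Qed.

Lemma good_updT w A G U t u al : good w A G -> t \notin A -> G (upd U t u) al = G U al.
Proof.
move=> gG tA; apply: (good_tag gG) => t' t'A; rewrite upd_neq //.
by apply: contraNneq tA => <-.
Qed.

Lemma good_updL w A G U l n al : good w A G -> l \notin w -> G U (upd al l n) = G U al.
Proof.
move=> gG lw; apply: (good_loc gG) => l' l'w; rewrite upd_neq //.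
by apply: contraNneq lw => <-.
Qed.

(** Variables and tags of the two factors are disjoint, so each derivative and each operator meets
    exactly one factor; [good_der] is then the product rule for D. *)
Lemma good_mulS s A G t B H : (forall l, l \in s -> l \notin t) ->
  (forall p, p \in A -> p \notin B) -> good s A G -> good t B H ->
  good (s ++ t) (A ++ B) (mulS G H).
Proof.
move=> st AB gG gH.
have ts l : l \in t -> l \notin s by apply: contraTN; apply: st.
have BA p : p \in B -> p \notin A by apply: contraTN; apply: AB.
have derl l U al : l \in s -> der l (mulS G H U) al = mul (der l (G U) al) (H U al).
  by move=> ls; rewrite /der /mulS (good_updL _ _ _ gH) ?st // -mulMnl.
have derr l U al : l \in t -> der l (mulS G H U) al = mul (G U al) (der l (H U) al).
  by move=> lt; rewrite /der /mulS (good_updL _ _ _ gG) ?ts // -mulMnr.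
split.
- move=> U al be ab; rewrite /mulS; congr (mul _ _).
    by apply: (good_loc gG) => l ls; apply: ab; rewrite mem_cat ls.
  by apply: (good_loc gH) => l lt; apply: ab; rewrite mem_cat lt orbT.
- move=> U V al UV; rewrite /mulS; congr (mul _ _).
    by apply: (good_tag gG) => l ls; apply: UV; rewrite mem_cat ls.
  by apply: (good_tag gH) => l lt; apply: UV; rewrite mem_cat lt orbT.
- move=> p U c u v z al; rewrite mem_cat /mulS => /orP[pA|pB] zE.
    rewrite !(good_updT _ _ _ gH) ?AB // (good_lin gG _ _ pA zE).
    by rewrite la_mul_linl.
  rewrite !(good_updT _ _ _ gG) ?BA // (good_lin gH _ _ pB zE).
  by rewrite la_mul_linr.
- move=> D U al Dd; rewrite /mulS Dd (good_der gG) // (good_der gH) // mul_suml mul_sumr big_cat.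
  congr (_ + _); apply: eq_big_seq => p pP; first by rewrite (good_updT _ _ _ gH) ?AB.
  by rewrite (good_updT _ _ _ gG) ?BA.
- move=> U al; rewrite !big_cat /=; congr (_ + _).
    rewrite (eq_big_seq (fun l => mul (der l (G U) al) (H U al))) => [|l /derl//].
    rewrite -mul_suml (good_inv gG) mul_suml; apply: eq_big_seq => p pA.
    by rewrite /mulS (good_updT _ _ _ gH) ?AB.
  rewrite (eq_big_seq (fun l => mul (G U al) (der l (H U) al))) => [|l /derr//].
  rewrite -mul_sumr (good_inv gH) mul_sumr; apply: eq_big_seq => p pB.
  by rewrite /mulS (good_updT _ _ _ gG) ?BA.
- move=> p x v al; rewrite mem_cat => /orP[pA|pB].
    have [N GN] := good_fin gG x v al pA.
    by exists N => n U Nn; rewrite /mulS GN // mul0m.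
  have [N HN] := good_fin gH x v al pB.
  by exists N => n U Nn; rewrite /mulS HN // mulm0.
Qed.

(** A single coefficient function; all other tagged functions arise from these by products and edge
    operators. *)
Definition primS t (f : (nat -> nat) -> M) : ser := fun U al => U t (f al).

Definition wloc (w : seq nat) (f : (nat -> nat) -> M) :=
  forall al be, {in w, al =1 be} -> f al = f be.

Lemma good_primS w t f : wloc w f ->
  (forall al, \sum_(l <- w) der l f al = lm_d M (f al)) -> good w [:: t] (primS t f).
Proof.
move=> floc finv; split.
- by move=> U al be /floc fab; rewrite /primS fab.
- by move=> U V al UV; rewrite /primS UV ?mem_head.
- by move=> t' U c u v z al; rewrite inE /primS => /eqP-> zE; rewrite !upd_eq zE.
- by move=> D U al _; rewrite big_seq1 /primS upd_eq.
- move=> U al; rewrite big_seq1 /primS upd_eq /= -finv linear_sum.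
  by apply: eq_bigr => l _; rewrite /der linearMn.
- move=> t' x v al; rewrite inE => /eqP->.
  have [N xN] := actL_poly x (v (f al)); exists N => n U Nn.
  by rewrite /primS upd_eq /= [X in U t X]xN // linear0.
Qed.

Lemma slot_primS w t f S : wloc w f -> (forall l, l \in S -> l \notin w) ->
  slot (primS t f) S t.
Proof.
move=> floc Sw al; exists (f al) => be albe U; exists id => // u.
rewrite /primS upd_eq; congr (u _); apply: floc => l lw; apply: albe.
by apply: contraTN lw; apply: Sw.
Qed.

Lemma slot_mulSr w A G H S t : good w A G -> t \notin A -> slot H S t -> slot (mulS G H) S t.
Proof.
move=> gG tA Hs al; have [m Hm] := Hs al; exists m => be /Hm Hbe U.
have [T TD HT] := Hbe U; exists (fun p => mul (G U be) (T p)).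
  by move=> p q; rewrite TD mulDr.
by move=> u; rewrite /mulS HT (good_updT _ _ _ gG).
Qed.

Lemma mulSC G H : mulS G H = mulS H G.
Proof. by apply: funext => U; apply: funext => al; rewrite /mulS la_mulC. Qed.

Lemma mulSA G H K : mulS G (mulS H K) = mulS (mulS G H) K.
Proof. by apply: funext => U; apply: funext => al; rewrite /mulS la_mulA. Qed.

Lemma slot_mulSl w A G H S t : good w A G -> t \notin A -> slot H S t -> slot (mulS H G) S t.
Proof. by rewrite mulSC; apply: slot_mulSr. Qed.

Lemma good_sfin w A G S t : good w A G -> t \in A -> (forall l, l \in S -> l \notin w) ->
  sfin G S t.
Proof.
move=> gG tA Sw x al; have [N GN] := good_fin gG x idL al tA.
exists N => n be U Nn albe; rewrite -(GN n U Nn) compLid; apply: (good_loc gG) => l lw.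
by apply: albe; apply: contraTN lw; apply: Sw.
Qed.

Lemma sfin_mulSr w A G H S t : good w A G -> t \notin A -> sfin H S t -> sfin (mulS G H) S t.
Proof.
move=> gG tA Hs x al; have [N HN] := Hs x al; exists N => n be U Nn albe.
by rewrite /mulS HN // mulm0.
Qed.

Lemma sfin_mulSl w A G H S t : good w A G -> t \notin A -> sfin H S t -> sfin (mulS H G) S t.
Proof. by rewrite mulSC; apply: sfin_mulSr. Qed.

Lemma sfin_sub G S S' t : {subset S <= S'} -> sfin G S' t -> sfin G S t.
Proof.
move=> SS' Gs x al; have [N GN] := Gs x al; exists N => n be U Nn albe.
by apply: GN => // l lS'; apply: albe; apply: contra lS'; apply: SS'.
Qed.

(* The operators attached to an edge (i, tau): the slot i acts on the slot tau = inl k, or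
   on the coefficient function with tag tau = inr t. *)
Definition edge := (nat * (nat + nat))%type.

Definition edgeop (e : edge) (K : seq nat -> (nat -> R) -> ser -> chain_space M) w a G :=
  (sg e.1 w : F) *: match e.2 with
  | inl k => nsum (fun n => K (del e.1 w) (upd a k (lc_br (a e.1) (a k) n))
      (subS e.1 k (fun U => iter n (der e.1) (G U))))
  | inr t => K (del e.1 w) a (actS (a e.1) e.1 t G)
  end.

Definition cw w a G : chain_space M := chw w a (mu G).

End Tagged.

(** * Relations between edge operators *)

Section TwoVariablePairing.
Variables (V W : zmodType) (T : V -> nat -> nat -> W).
Hypothesis TD : forall p q, {morph T^~ p ^~ q : x y / x + y}.
Implicit Types (g : nat -> nat -> V) (v : V).

Let T0 p q : T 0 p q = 0.
Proof. by apply: (addrI (T 0 p q)); rewrite -TD !addr0. Qed.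

Definition box g N := forall p q, (N <= p)%N || (N <= q)%N -> g p q = 0.
Definition fin2 g := exists N, box g N.

(* Pairs a polynomial g in lambda and mu with the values T of lambda^p mu^q, so that the
   Jacobi and skew-symmetry axioms can be transported to any functional T. *)
Definition pair2 a b g := nsum (fun p => nsum (fun q => T (g p q) (p + a)%N (q + b)%N)).

Lemma box_leq g N N' : (N <= N')%N -> box g N -> box g N'.
Proof.
move=> NN' gN p q /orP[]/(leq_trans NN') Np; apply: gN; rewrite Np ?orbT //.
Qed.

Lemma fin2D g h : fin2 g -> fin2 h -> fin2 (g + h).
Proof.
move=> [N gN] [N' hN']; exists (maxn N N') => p q pq.
rewrite -[LHS]/(g p q + h p q).
rewrite (box_leq (leq_maxl N N') gN) // (box_leq (leq_maxr N N') hN') ?addr0 //.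
Qed.

Lemma fin2L g : fin2 g -> fin2 (mulL2 g).
Proof.
move=> [N gN]; exists N.+1 => -[|p] q //; rewrite ltnS => /orP[Np|Nq]; apply: gN.
  by rewrite Np.
by rewrite (ltnW Nq) orbT.
Qed.

Lemma fin2M g : fin2 g -> fin2 (mulM2 g).
Proof.
move=> [N gN]; exists N.+1 => p [|q] //; rewrite ltnS => /orP[Np|Nq]; apply: gN.
  by rewrite (ltnW Np).
by rewrite Nq orbT.
Qed.

Lemma fin2c v : fin2 (polyc2 v).
Proof. by exists 1%N => -[|p] [|q]. Qed.

Lemma fin2_sum (I : Type) (r : seq I) (f : I -> nat -> nat -> V) :
  (forall i, fin2 (f i)) -> fin2 (\sum_(i <- r) f i).
Proof.
move=> fP; elim: r => [|i r IHr]; last by rewrite big_cons; apply: fin2D.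
by rewrite big_nil; exists 0%N.
Qed.

Lemma fin2_iter op n g : (forall h, fin2 h -> fin2 (op h)) -> fin2 g -> fin2 (iter n op g).
Proof. by move=> opP gP; elim: n => //= n; apply: opP. Qed.

Let polyq g a b N : box g N -> forall p, is_poly (fun q => T (g p q) a (q + b)%N).
Proof. by move=> gN p; exists N => q Nq; rewrite gN ?T0 // Nq orbT. Qed.

Let polyp g a b N : box g N -> is_poly (fun p => nsum (fun q => T (g p q) (p + a)%N (q + b)%N)).
Proof. by move=> gN; exists N => p Np; apply: nsum0 => q; rewrite gN ?T0 // Np. Qed.

Lemma pair2D a b g h : fin2 g -> fin2 h -> pair2 a b (g + h) = pair2 a b g + pair2 a b h.
Proof.
move=> [N gN] [N' hN']; rewrite /pair2 -nsumD; [|exact: polyp gN|exact: polyp hN'].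
apply: eq_nsum => p; rewrite -nsumD; [|exact: polyq gN _|exact: polyq hN' _].
by apply: eq_nsum => q; rewrite -TD.
Qed.

Lemma pair2_sum (I : Type) (r : seq I) a b (f : I -> nat -> nat -> V) :
  (forall i, fin2 (f i)) -> pair2 a b (\sum_(i <- r) f i) = \sum_(i <- r) pair2 a b (f i).
Proof.
move=> fP; elim: r => [|i r IHr].
  by rewrite !big_nil /pair2 nsum0 // => p; apply: nsum0 => q; apply: T0.
by rewrite !big_cons pair2D ?IHr //; apply: fin2_sum.
Qed.

Lemma pair2L a b g : fin2 g -> pair2 a b (mulL2 g) = pair2 a.+1 b g.
Proof.
move=> gP; have [N LN] := fin2L gP; rewrite /pair2 nsum_recl; last exact: polyp LN.
rewrite nsum0 ?add0r => [|q]; last exact: T0.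
by apply: eq_nsum => p; apply: eq_nsum => q; rewrite addSnnS.
Qed.

Lemma pair2M a b g : fin2 g -> pair2 a b (mulM2 g) = pair2 a b.+1 g.
Proof.
move=> gP; have [N LN] := fin2M gP; apply: eq_nsum => p.
rewrite nsum_recl; last exact: polyq LN _.
by rewrite T0 add0r; apply: eq_nsum => q; rewrite addSnnS.
Qed.

Lemma pair2c a b v : pair2 a b (polyc2 v) = T v a b.
Proof.
have vP : box (polyc2 v) 1 by move=> [|p] [|q].
rewrite /pair2 nsum_recl; last exact: polyp vP.
rewrite [X in _ + X]nsum0 => [|p]; last by apply: nsum0 => q; apply: T0.
rewrite addr0 nsum_recl; last exact: polyq vP _.
by rewrite [X in _ + X]nsum0 ?addr0 // => q; apply: T0.
Qed.

Lemma pair2_iterL a b j g : fin2 g -> pair2 a b (iter j (@mulL2 V) g) = pair2 (a + j) b g.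
Proof.
move=> gP; elim: j a => [|j IHj] a /=; first by rewrite addn0.
by rewrite pair2L ?IHj ?addSnnS //; apply: fin2_iter => // h; apply: fin2L.
Qed.

(** Multiplication by lambda or mu becomes a shift of the first or second exponent, so a power of
    their sum is a binomial sum of shifts. *)
Lemma pair2_iterLM a b n v :
  pair2 a b (iter n (fun f => mulL2 f + mulM2 f) (polyc2 v)) =
  \sum_(r < n.+1) T v (a + r) (b + (n - r)) *+ 'C(n, r).
Proof.
have opP h : fin2 h -> fin2 (mulL2 h + mulM2 h).
  by move=> hP; apply: fin2D; [apply: fin2L|apply: fin2M].
have itP m : fin2 (iter m (fun f => mulL2 f + mulM2 f) (polyc2 v)).
  by apply: fin2_iter; [apply: opP|apply: fin2c].
elim: n a b => [|n IHn] a b; first by rewrite big_ord1 /= !addn0 pair2c.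
rewrite iterS pair2D ?pair2L ?pair2M //; try by [apply: fin2L|apply: fin2M].
rewrite !IHn [X in _ + X]big_ord_recl [RHS]big_ord_recl /= !bin0.
rewrite addrCA !subn0 addnS addSn addn0; congr (_ + _).
rewrite [RHS](eq_bigr (fun r : 'I_n.+1 => T v (a.+1 + r) (b + (n - r)) *+ 'C(n, r.+1) +
    T v (a.+1 + r) (b + (n - r)) *+ 'C(n, r))) => [|r _]; last first.
  by rewrite -mulrnDr /bump add1n subSS binS addSnnS.
rewrite big_split /= addrC; congr (_ + _).
rewrite [RHS]big_ord_recr /= bin_small // mulr0n addr0; apply: eq_bigr => r _.
by rewrite /bump add1n addSnnS -subSn //= addSnnS subSS.
Qed.

(** The pairing of the right-hand side of [lambda_jacobi], where c j n is the coefficient of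
    lambda^j (lambda + mu)^n. *)
Lemma pair2_psubst (c : nat -> nat -> V) : fin2 c ->
  pair2 0 0 (psubst (@mulL2 V) (fun j =>
      psubst (fun f => mulL2 f + mulM2 f) (fun n => polyc2 (c j n)))) =
  nsum (fun j => nsum (fun n => \sum_(r < n.+1) T (c j n) (j + r)%N (n - r)%N *+ 'C(n, r))).
Proof.
move=> [N cN].
have opP h : fin2 h -> fin2 (mulL2 h + mulM2 h).
  by move=> hP; apply: fin2D; [apply: fin2L|apply: fin2M].
have p0 : polyc2 (0 : V) = 0 by apply: funext => -[|p]; apply: funext => -[|q].
(* That the iterated operators vanish at 0 allows the sums hidden in [psubst] to be cut at N. *)
have LM0 n : iter n (fun f : nat -> nat -> V => mulL2 f + mulM2 f) 0 = 0.
  elim: n => //= n ->; apply: funext => p; apply: funext => q.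
  by case: p q => [|p] [|q]; rewrite -[LHS]/(_ + _ : V) /= ?addr0.
have L0 n : iter n (@mulL2 V) 0 = 0.
  by elim: n => //= n ->; apply: funext => -[|p].
have innE j : psubst (fun f => mulL2 f + mulM2 f) (fun n => polyc2 (c j n)) =
    \sum_(n < N) iter n (fun f => mulL2 f + mulM2 f) (polyc2 (c j n)).
  by apply: nsum_trunc => n Nn; rewrite cN ?Nn ?orbT // p0 LM0.
have itP j n : fin2 (iter n (fun f => mulL2 f + mulM2 f) (polyc2 (c j n))).
  by apply: fin2_iter; [apply: opP|apply: fin2c].
have innP j : fin2 (psubst (fun f => mulL2 f + mulM2 f) (fun n => polyc2 (c j n))).
  by rewrite innE; apply: fin2_sum.
have -> : psubst (@mulL2 V) (fun j =>
      psubst (fun f => mulL2 f + mulM2 f) (fun n => polyc2 (c j n))) =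
   \sum_(j < N) iter j (@mulL2 V) (psubst (fun f => mulL2 f + mulM2 f) (fun n => polyc2 (c j n))).
  apply: nsum_trunc => j Nj; rewrite innE big1 ?L0 // => n _.
  by rewrite cN ?Nj // p0 LM0.
rewrite pair2_sum => [|j]; last by apply: fin2_iter => // h; apply: fin2L.
rewrite (@nsum_trunc _ _ N) => [|j Nj]; last first.
  apply: nsum0 => n; rewrite big1 // => r _; rewrite cN ?Nj // T0 mul0rn //.
apply: eq_bigr => j _; rewrite pair2_iterL // innE pair2_sum //.
rewrite (@nsum_trunc _ _ N) => [|n Nn]; last first.
  by rewrite big1 // => r _; rewrite cN ?Nn ?orbT // T0 mul0rn.
by apply: eq_bigr => n _; rewrite pair2_iterLM.
Qed.

End TwoVariablePairing.

(** * Jacobi identity and skew-symmetry evaluated on a functional *)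

Section BracketPairing.
Variables (F : fieldType) (R : lieConformal F).

Lemma br_linearl c x y z n : @lc_br F R (c *: x + y) z n = c *: lc_br x z n + lc_br y z n.
Proof. by case: (@lc_brP F R) => lin_br _ _; rewrite lin_br. Qed.

Lemma br_linearr c x y z n : @lc_br F R z (c *: x + y) n = c *: lc_br z x n + lc_br z y n.
Proof. by case: (@lc_brP F R) => _ lin_br _; rewrite lin_br. Qed.

Lemma br0l y n : @lc_br F R 0 y n = 0.
Proof.
apply: (addrI (lc_br 0 y n)); rewrite addr0.
by have := br_linearl 1 0 0 y n; rewrite !scale1r addr0.
Qed.

Lemma br0r y n : @lc_br F R y 0 n = 0.
Proof.
apply: (addrI (lc_br y 0 n)); rewrite addr0.
by have := br_linearr 1 0 0 y n; rewrite !scale1r addr0.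
Qed.

Lemma br_poly x y : is_poly (@lc_br F R x y).
Proof. by case: (@lc_brP F R). Qed.

Lemma br_d x y n : @lc_br F R (lc_d R x) y n = - (if n is p.+1 then lc_br x y p else 0).
Proof. by case: (@lc_sesqui F R) => -> _; case: n. Qed.

Lemma fin2_colpoly (V : zmodType) (g : nat -> nat -> V) N : (forall p q, (N <= q)%N -> g p q = 0) ->
  (forall q, is_poly (g^~ q)) -> fin2 g.
Proof.
move=> gN gp; have [N' gN'] := @is_poly_sum _ _ (iota 0 N) (fun q => g^~ q) (fun q _ => gp q).
exists (maxn N N') => p q; rewrite !geq_max => /orP[/andP[_ N'p]|/andP[Nq _]]; last exact: gN.
have [Nq|qN] := leqP N q; first exact: gN.
by apply: gN' => //; rewrite mem_iota.
Qed.

Lemma fin2_rowpoly (V : zmodType) (g : nat -> nat -> V) N : (forall p q, (N <= p)%N -> g p q = 0) ->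
  (forall p, is_poly (g p)) -> fin2 g.
Proof.
move=> gN gp; have [N' gN'] := @fin2_colpoly _ (fun p q => g q p) N (fun p q => gN q p) gp.
by exists N' => p q; rewrite orbC => /gN'.
Qed.

(** Stated for a general lambda-map B, so that it serves both for the bracket of R and for the
    action on M. *)
Lemma jacobi_pair2 (M : lmodType F) (B : R -> M -> nat -> M) (W : zmodType)
    (T : M -> nat -> nat -> W) (a b : R) (m : M) :
  is_lambda_map B -> lambda_jacobi (@lc_br F R) B ->
  (forall p q, {morph T^~ p ^~ q : x y / x + y}) ->
  pair2 T 0 0 (fun p q => B a (B b m q) p) = pair2 T 0 0 (fun p q => B b (B a m p) q) +
  nsum (fun j => nsum (fun n => \sum_(r < n.+1) T (B (lc_br a b j) m n) (j + r)%N (n - r)%N *+ 'C(n, r))).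
Proof.
move=> [Blinl Blinr Bpoly] Bjac TD.
have B0l y n : B 0 y n = 0.
  by have := Blinl y 0 0 0; rewrite scaler0 addr0 scale0r add0r => /(congr1 (fun f => f n)) ->; 
     have := Blinl y (-1) 0 0; rewrite scaler0 addr0 scaleN1r addNr => ->.
have B0r x n : B x 0 n = 0.
  by have := Blinr x (-1) 0 0; rewrite scaler0 addr0 scaleN1r addNr => ->.
rewrite -pair2_psubst //; last first.
  have [N bN] := br_poly a b; apply: (@fin2_rowpoly _ _ N) => [p q Np|p]; last exact: Bpoly.
  by rewrite bN.
rewrite -Bjac -pair2D //.
- by congr pair2; apply: funext => p; apply: funext => q; rewrite [RHS]addrC [RHS]subrK.
- have [N bN] := Bpoly a m; apply: (@fin2_rowpoly _ _ N) => [p q Np|p]; last exact: Bpoly.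
  by rewrite bN.
have fin2N (g : nat -> nat -> M) : fin2 g -> fin2 (- g).
  by move=> [N gN]; exists N => p q /gN pq; rewrite -[LHS]/(- g p q) pq oppr0.
apply: fin2D; last apply: fin2N.
  have [N bN] := Bpoly b m; apply: (@fin2_colpoly _ _ N) => [p q Np|q]; last exact: Bpoly.
  by rewrite bN.
have [N bN] := Bpoly a m; apply: (@fin2_rowpoly _ _ N) => [p q Np|p]; last exact: Bpoly.
by rewrite bN.
Qed.

(** Under the pairing lambda shifts the first index of T, and by hypothesis the derivation of R acts
    as minus the sum of both shifts. Hence - lambda - d acts as the shift of the second index, and
    the skew-symmetry axiom exchanges the roles of the two indices. *)
Lemma skew_pair (W : zmodType) (T : R -> nat -> nat -> W) (a b : R) :
  (forall p q, {morph T^~ p ^~ q : x y / x + y}) ->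
  (forall x p q, T (lc_d R x) p q = - (T x p.+1 q + T x p q.+1)) ->
  nsum (fun n => T (lc_br a b n) n 0) = - nsum (fun n => T (lc_br b a n) 0 n).
Proof.
move=> TD Td.
have T0 p q : T 0 p q = 0 by apply: (addrI (T 0 p q)); rewrite -TD !addr0.
have TN p q x : T (- x) p q = - T x p q.
  by apply: (addrI (T x p q)); rewrite -TD !subrr T0.
pose P a' b' (g : nat -> R) := nsum (fun p => T (g p) (p + a')%N b').
pose op (g : nat -> R) := - (mulL g + (fun n => lc_d R (g n))).
have Tpoly g a' b' : is_poly g -> is_poly (fun p => T (g p) (p + a')%N b').
  by move=> [N gN]; exists N => p /gN->; apply: T0.
have opP g : is_poly g -> is_poly (op g).
  move=> [N gN]; exists N.+1 => -[//|n] Nn.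
  by rewrite -[LHS]/(- (g n + lc_d R (g n.+1))) !gN ?raddf0 ?addr0 ?oppr0 // ltnW.
have Pop a' b' g : is_poly g -> P a' b' (op g) = P a' b'.+1 g.
  move=> gP; have [N gN] := gP.
  have LP : is_poly (fun p => T (mulL g p) (p + a')%N b').
    by apply: Tpoly; exists N.+1 => -[//|p] Np; apply: gN.
  have dP : is_poly (fun p => T (lc_d R (g p)) (p + a')%N b').
    by apply: Tpoly; exists N => p /gN->; rewrite raddf0.
  transitivity (- (P a' b' (mulL g) + nsum (fun p => T (lc_d R (g p)) (p + a')%N b'))).
    rewrite -nsumD // -nsumN; last first.
      have [N1 LN1] := LP; have [N2 dN2] := dP; exists (maxn N1 N2) => p.
      by rewrite geq_max => /andP[/LN1-> /dN2->]; rewrite addr0.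
    by apply: eq_nsum => p; rewrite -TD -TN.
  rewrite [P a' b' (mulL g)]nsum_recl // T0 add0r.
  have -> : nsum (fun p => T (lc_d R (g p)) (p + a')%N b') = - (P a'.+1 b' g + P a' b'.+1 g).
    transitivity (nsum (fun p => - (T (g p) (p + a'.+1)%N b' + T (g p) (p + a')%N b'.+1))).
      by apply: eq_nsum => p; rewrite Td addnS.
    rewrite nsumN ?nsumD //; try exact: Tpoly.
    by exists N => p /gN->; rewrite !T0 addr0.
  have -> : nsum (fun n => T (mulL g n.+1) (n.+1 + a')%N b') = P a'.+1 b' g.
    by rewrite /P; apply: eq_nsum => p; rewrite addSnnS.
  by rewrite opprD opprK addKr.
have Pc v a' b' : P a' b' (polyc v) = T v a' b'.
  rewrite /P nsum_recl ?[X in _ + X]nsum0 ?addr0 //; last first.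
    by apply: Tpoly; exists 1%N => -[].
have cP v : is_poly (polyc v : nat -> R) by exists 1%N => -[].
have itP n v : is_poly (iter n op (polyc v)) by elim: n => //= n; apply: opP.
have Pit n v a' b' : P a' b' (iter n op (polyc v)) = T v a' (b' + n)%N.
  elim: n b' => [|n IHn] b' /=; first by rewrite Pc addn0.
  by rewrite Pop // IHn addSnnS.
have [N bN] := br_poly b a.
have op0 n : iter n op (polyc 0) = 0.
  elim: n => [|n IHn]; first by apply: funext => -[].
  rewrite iterS IHn; apply: funext => -[|p]; rewrite -[LHS]/(- (_ + lc_d R 0)) raddf0.
    by rewrite addr0 oppr0.
  by rewrite addr0 oppr0.
have -> : nsum (fun n => T (lc_br a b n) n 0) = - P 0%N 0%N (\sum_(n < N) iter n op (polyc (lc_br b a n))).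
  rewrite -nsumN; last first.
    apply: Tpoly; elim/big_rec: _ => [|n g _ [N1 gN1]]; first by exists 0%N.
    have [N2 hN2] := itP n (lc_br b a n); exists (maxn N1 N2) => p.
    by rewrite geq_max => /andP[/gN1 E1 /hN2 E2]; rewrite -[LHS]/(_ p + g p) E1 E2 addr0.
  apply: eq_nsum => n; rewrite addn0 -TN; congr (T _ n 0%N).
  rewrite lc_skew -[LHS]/(- _ n); congr (- _ n); apply: nsum_trunc => m Nm.
  by rewrite bN // op0.
congr (- _); transitivity (\sum_(n < N) P 0%N 0%N (iter n op (polyc (lc_br b a n)))).
  rewrite /P -nsum_exchange_seq => [|n _]; last exact: Tpoly.
  apply: eq_nsum => p; rewrite fct_sumE; apply: (big_morph (fun x => T x (p + 0)%N 0%N)) => //.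
rewrite (@nsum_trunc _ _ N) => [|n Nn]; last by rewrite bN.
by apply: eq_bigr => n _; rewrite Pit.
Qed.

End BracketPairing.

Section WordLinearity.
Variables (F : fieldType) (R : lieConformal F) (M : lcModule R).
Local Notation lser := ((nat -> nat) -> M).
Implicit Types (w : seq nat) (a : nat -> R) (f g : lser).

Lemma chwD_slot w a f l x y : uniq w -> l \in w ->
  chw w (upd a l (x + y)) f = chw w (upd a l x) f + chw w (upd a l y) f.
Proof. by move=> uw lw; have := chw_multilinear a f 1 x y uw lw; rewrite !scale1r. Qed.

Lemma chw0_slot w a f l : uniq w -> l \in w -> chw w (upd a l 0) f = 0.
Proof.
by move=> uw lw; apply: (addrI (chw w (upd a l 0) f)); rewrite -chwD_slot // !addr0.
Qed.

Lemma chw_br_poly w a l x y (f : nat -> lser) : uniq w -> l \in w ->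
  is_poly (fun n => chw w (upd a l (lc_br x y n)) (f n)).
Proof.
by move=> uw lw; have [N bN] := br_poly x y; exists N => n Nn; rewrite bN // chw0_slot.
Qed.

Lemma winvP w c f g : winv w f -> winv w g -> winv w (fun al => c *: f al + g al).
Proof.
move=> fP gP al al0; rewrite linearP -fP // -gP // scaler_sumr -big_split.
by apply: eq_bigr => l _; rewrite /der mulrnDl scalerMnr.
Qed.

Lemma winv0 w : winv w (fun _ => 0 : M).
Proof. by move=> al _; rewrite linear0 big1 // => l _; rewrite /der mul0rn. Qed.

Lemma winvD w f g : winv w f -> winv w g -> winv w (fun al => f al + g al).
Proof.
move=> fP gP; rewrite (_ : (fun al => _) = (fun al => 1 *: f al + g al)); first exact: winvP.
by apply: funext => al; rewrite scale1r.
Qed.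

Lemma chwD w a f g : uniq w -> winv w f -> winv w g ->
  chw w a (fun al => f al + g al) = chw w a f + chw w a g.
Proof.
move=> uw fP gP; rewrite -[chw w a f]scale1r -chw_linear //; congr chw.
by apply: funext => al; rewrite scale1r.
Qed.

Lemma chw0 w a : uniq w -> chw w a (fun _ => 0 : M) = 0.
Proof.
move=> uw; have := chwD a uw (@winv0 w) (@winv0 w).
rewrite (_ : (fun al => _) = fun _ => 0); last by apply: funext => al; rewrite addr0.
by move=> E; apply: (addrI (chw w a (fun _ => 0))); rewrite addr0 -E.
Qed.

Lemma winv_sum (I : eqType) (r : seq I) w (f : I -> lser) :
  (forall p, p \in r -> winv w (f p)) -> winv w (fun al => \sum_(p <- r) f p al).
Proof.
elim: r => [|p r IHr] fP.
  by rewrite (_ : (fun al => _) = (fun _ => 0)); [exact: winv0|apply: funext => al; rewrite big_nil].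
rewrite (_ : (fun al => _) = (fun al => f p al + \sum_(p <- r) f p al)).
  apply: winvD; first by apply: fP; rewrite mem_head.
  by apply: IHr => q qr; apply: fP; rewrite inE qr orbT.
by apply: funext => al; rewrite big_cons.
Qed.

Lemma chw_sum (I : eqType) (r : seq I) w a (f : I -> lser) : uniq w ->
  (forall p, p \in r -> winv w (f p)) ->
  chw w a (fun al => \sum_(p <- r) f p al) = \sum_(p <- r) chw w a (f p).
Proof.
move=> uw; elim: r => [|p r IHr] fP.
  by rewrite big_nil -[RHS](chw0 a uw); congr (chw _ _ _); apply: funext => al; exact: big_nil.
have fr q : q \in r -> winv w (f q) by move=> qr; apply: fP; rewrite inE qr orbT.
rewrite big_cons -IHr // -chwD //; [|by apply: fP; rewrite mem_head|exact: winv_sum].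
by congr (chw _ _ _); apply: funext => al; rewrite big_cons.
Qed.

Lemma winvMn w f n : winv w f -> winv w (fun al => f al *+ n).
Proof.
move=> fP al al0; rewrite linearMn /= -fP // -sumrMnl; apply: eq_bigr => l _.
by rewrite derMn.
Qed.

Lemma chwMn w a f n : uniq w -> winv w f -> chw w a (fun al => f al *+ n) = chw w a f *+ n.
Proof.
move=> uw fP; elim: n => [|n IHn]; first by rewrite mulr0n -(chw0 a uw).
rewrite mulrS -IHn -chwD //; last exact: winvMn.
by congr (chw _ _ _); apply: funext => al; rewrite mulrS.
Qed.

End WordLinearity.

Section Edges.
Variables (F : fieldType) (R : lieConformal F) (M : lcModAlgebra R).
Local Notation LM := {linear M -> M}.
Local Notation ser := ((nat -> LM) -> (nat -> nat) -> M).
Local Notation edgeop := (@edgeop F R M).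
Local Notation cw := (@cw F R M).
Implicit Types (w A : seq nat) (a : nat -> R) (G : ser) (x : R).

Definition derSn i n G : ser := fun U => iter n (der i) (G U).

Lemma good_derSn i w A G n : i \in w -> good w A G -> good w A (derSn i n G).
Proof. exact: good_iter_derS. Qed.

Lemma edgeop_poly i k w a G : uniq w -> i != k -> k \in w ->
  is_poly (fun n => cw (del i w) (upd a k (lc_br (a i) (a k) n)) (subS i k (derSn i n G))).
Proof. by move=> uw ik kw; apply: chw_br_poly; rewrite ?del_uniq // mem_del eq_sym ik. Qed.

(** With p and q counting the derivatives in x_i and x_j before these variables are merged,
    sesquilinearity of chains is the hypothesis of [skew_pair]. Its sign cancels the one of
    [chw_sub_swap]. *)
Lemma edge_flip i j w A a G : uniq w -> i != j -> i \in w -> j \in w -> good w A G ->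
  edgeop (i, inl j) cw w a G = edgeop (j, inl i) cw w a G.
Proof.
move=> uw ij iw jw gG; have ji : j != i by rewrite eq_sym.
have iw' : i \in del j w by rewrite mem_del ij.
rewrite /edgeop /= nsumZ; last exact: edgeop_poly.
pose T x p q := chw (del j w) (upd a i x) (sub j i (iter p (der i) (iter q (der j) (mu G)))).
have gT p q : good (del j w) A (subS j i (derSn i p (derSn j q G))).
  by apply: good_subS => //; do 2!apply: good_derSn => //.
transitivity (- ((sg j w : F) *: nsum (fun n => T (lc_br (a i) (a j) n) n 0))).
  rewrite nsumZ; last by apply: chw_br_poly; rewrite ?del_uniq.
  rewrite -nsumN; last first.
    have [N bN] := br_poly (a i) (a j); exists N => n /bN ->.
    by rewrite /T chw0_slot ?del_uniq ?scaler0.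
  by apply: eq_nsum => n; rewrite /cw /T -chw_sub_swap.
rewrite (@skew_pair _ _ _ T) ?scalerN ?opprK //.
  by move=> p q x y; rewrite /T chwD_slot ?del_uniq.
move=> x p q; rewrite /T.
have := chw_sesquilinear (upd a i x) (del_uniq j uw) iw' (good_winv (gT p q)).
rewrite upd_upd upd_eq => ->; congr (- _).
(* The derivative in the merged variable is the sum of the derivatives in x_i and x_j, which yields
   the two shifts of T. *)
rewrite /mu /subS der_sub // chwD ?del_uniq //.
- by congr (_ + _); rewrite -[der j (iter p _ _)]/(iter 1 (der j) _) iter_derC.
- exact: (good_winv (gT p.+1 q)).
rewrite (_ : der j _ = mu (derSn i p (derSn j q.+1 G))); first exact: (good_winv (gT p q.+1)).
by rewrite /derSn /mu /= -[der j (iter p _ _)]/(iter 1 (der j) _) iter_derC.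
Qed.

Lemma sfin_derS i l t G : i != l -> sfin G [:: l] t -> sfin (derS i G) [:: l] t.
Proof.
move=> il Gs x al; have [N GN] := Gs x (upd al i (al i).+1); exists N => n be U Nn albe.
have bei : be i = al i by apply: albe; rewrite inE.
rewrite /derS /der GN ?mul0rn // => l' l'l; rewrite /upd; case: eqP => [_|_]; first by rewrite bei.
exact: albe.
Qed.

Lemma sfin_derSn i l t G n : i != l -> sfin G [:: l] t -> sfin (derSn i n G) [:: l] t.
Proof. by move=> il Gs; elim: n => //= n IHn; apply: (sfin_derS il IHn). Qed.

Lemma off_upd l al n : off [:: l] al (upd al l n).
Proof. by move=> l'; rewrite inE => l'l; rewrite upd_neq. Qed.

Lemma sfin_poly l t G x U al : sfin G [:: l] t ->
  is_poly (fun n => G (upd U t (compL (U t) (actL M x n))) (upd al l n) *+ n`!).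
Proof.
move=> Gs; have [N GN] := Gs x al; exists N => n Nn; rewrite GN ?mul0rn //.
exact: off_upd.
Qed.

Lemma derS_actS i l t G x : i != l -> sfin G [:: l] t ->
  derS i (actS x l t G) = actS x l t (derS i G).
Proof.
move=> il Gs; apply: funext => U; apply: funext => al; rewrite /derS /actS /der -nsumMn.
  apply: eq_nsum => n; rewrite upd_neq // -!mulrnA mulnC; congr (G _ _ *+ _).
  by rewrite upd_comm.
exact: sfin_poly.
Qed.

Lemma derSn_actS i l t G x n : i != l -> sfin G [:: l] t ->
  derSn i n (actS x l t G) = actS x l t (derSn i n G).
Proof.
move=> il Gs; elim: n => // n IHn.
rewrite -[LHS]/(derS i (derSn i n (actS x l t G))) IHn derS_actS //.
exact: sfin_derSn.
Qed.

Lemma subS_actS i k l t G x : l != i -> l != k -> sfin G [:: l] t ->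
  subS i k (actS x l t G) = actS x l t (subS i k G).
Proof.
move=> li lk Gs; apply: funext => U; apply: funext => al; rewrite /subS /actS /sub.
rewrite -nsum_exchange_seq => [|q _]; last exact: sfin_poly.
apply: eq_nsum => n; rewrite upd_neq 1?eq_sym // -sumrMnl; apply: eq_bigr => q _.
by rewrite (upd_comm _ _ _ li) (upd_comm _ _ _ lk).
Qed.

(** The exchange of the two sums needs the bound on the order n at t to be uniform in the order m at
    t', hence in the exponents of both variables, while the bound on m may depend on n. This
    explains the asymmetric hypotheses. *)
Lemma actSC i l t t' G x y : i != l -> t != t' ->
  sfin G [:: i; l] t -> sfin G [:: l] t' ->
  actS y l t' (actS x i t G) = actS x i t (actS y l t' G).
Proof.
move=> il tt' Gs Gs'; apply: funext => U; apply: funext => al; rewrite /actS.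
have li : l != i by rewrite eq_sym.
have t't : t' != t by rewrite eq_sym.
pose Y n m := G (upd (upd U t (compL (U t) (actL M x n))) t' (compL (U t') (actL M y m)))
  (upd (upd al i n) l m).
have [N GN] := Gs x al.
have YN n m : (N <= n)%N -> Y n m = 0.
  move=> Nn; rewrite /Y upd_comm //.
  have -> : compL (U t) (actL M x n) = compL (upd U t' (compL (U t') (actL M y m)) t) (actL M x n).
    by rewrite upd_neq.
  rewrite GN // => l'; rewrite !inE negb_or => /andP[l'i l'l].
  by rewrite !upd_neq.
have Yp n : is_poly (Y n).
  have [N' GN'] := Gs' y (upd al i n); exists N' => m Nm; rewrite /Y.
  have -> : compL (U t') (actL M y m) = compL (upd U t (compL (U t) (actL M x n)) t') (actL M y m).
    by rewrite upd_neq.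
  by rewrite GN' //; apply: off_upd.
transitivity (nsum (fun m => nsum (fun n => Y n m *+ (n`! * m`!)))).
  apply: eq_nsum => m.
  have E n : G (upd (upd U t' (compL (U t') (actL M y m))) t
      (compL (upd U t' (compL (U t') (actL M y m)) t) (actL M x n))) (upd (upd al l m) i n) = Y n m.
    by rewrite /Y upd_neq // upd_comm // [X in _ = G _ X]upd_comm.
  rewrite -nsumMn; last by exists N => n Nn; rewrite E YN ?mul0rn.
  by apply: eq_nsum => n; rewrite E mulrnA.
rewrite -(@nsum_exchange _ (fun n m => Y n m *+ (n`! * m`!)) N) => [|n m Nn|n]; last first.
- by have [N' YN'] := Yp n; exists N' => m /YN'->; rewrite mul0rn.
- by rewrite YN ?mul0rn.
apply: eq_nsum => n.
have E m : G (upd (upd U t (compL (U t) (actL M x n))) t'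
    (compL (upd U t (compL (U t) (actL M x n)) t') (actL M y m))) (upd (upd al i n) l m) = Y n m.
  by rewrite /Y upd_neq.
rewrite -nsumMn; first by apply: eq_nsum => m; rewrite E mulnC mulrnA.
by have [N' YN'] := Yp n; exists N' => m Nm; rewrite E YN' ?mul0rn.
Qed.

End Edges.

Section EdgeRelations.
Variables (F : fieldType) (R : lieConformal F) (M : lcModAlgebra R).
Local Notation LM := {linear M -> M}.
Local Notation ser := ((nat -> LM) -> (nat -> nat) -> M).
Local Notation edgeop := (@edgeop F R M).
Local Notation cw := (@cw F R M).
Implicit Types (w A : seq nat) (a : nat -> R) (G : ser) (x : R).

Lemma nsumZ2 (V : lmodType F) (c d : F) (Z : nat -> nat -> V) : fin2 Z ->
  c *: nsum (fun n => d *: nsum (Z n)) = (c * d) *: nsum (fun n => nsum (Z n)).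
Proof.
move=> [N ZN]; rewrite -scalerA; congr (_ *: _); rewrite nsumZ //.
by exists N => n Nn; apply: nsum0 => m; rewrite ZN // Nn.
Qed.

Lemma fin2_exchange (V : zmodType) (Z : nat -> nat -> V) : fin2 Z ->
  nsum (fun n => nsum (Z n)) = nsum (fun m => nsum (Z^~ m)).
Proof.
move=> [N ZN]; apply: (@nsum_exchange _ _ N) => [n m Nn|n]; first by rewrite ZN // Nn.
by exists N => m Nm; rewrite ZN // Nm orbT.
Qed.

(** With four different ends the two brackets and the two substitutions do not interact, and only
    the sign of [sg_del] remains. *)
Lemma edge_comm_LL i k l k' w a G : uniq w -> uniq [:: i; l; k; k'] ->
  i \in w -> l \in w -> k \in w -> k' \in w ->
  edgeop (i, inl k) (edgeop (l, inl k') cw) w a G =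
  - edgeop (l, inl k') (edgeop (i, inl k) cw) w a G.
Proof.
move=> uw u4 iw lw kw k'w; move: (u4); rewrite /= !inE !negb_or !andbT.
move=> /and3P[/and3P[il ik ik'] /andP[lk lk'] kk'].
have ki : k != i by rewrite eq_sym.
have k'l : k' != l by rewrite eq_sym.
have kl : k != l by rewrite eq_sym.
have k'i : k' != i by rewrite eq_sym.
have k'k : k' != k by rewrite eq_sym.
set w' := del l (del i w).
have uw' : uniq w' by rewrite !del_uniq.
have kw' : k \in w' by rewrite !mem_del ki kl.
have k'w' : k' \in w' by rewrite !mem_del k'i k'l.
pose Z n m := cw w' (upd (upd a k (lc_br (a i) (a k) n)) k' (lc_br (a l) (a k') m))
  (subS l k' (subS i k (derSn l m (derSn i n G)))).
have ZP : fin2 Z.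
  have [N bN] := br_poly (a i) (a k); apply: (@fin2_rowpoly _ _ N) => [n m Nn|n].
    by rewrite /Z bN // upd_comm //; apply: chw0_slot.
  by apply: chw_br_poly.
have -> : edgeop (i, inl k) (edgeop (l, inl k') cw) w a G =
    (sg i w * sg l (del i w) : F) *: nsum (fun n => nsum (Z n)).
  rewrite -nsumZ2 // /edgeop /=; congr (_ *: _); apply: eq_nsum => n; congr (_ *: _).
  apply: eq_nsum => m; rewrite upd_neq // [upd a k _ k']upd_neq //.
  congr (cw _ _ _); apply: funext => U; rewrite /subS /derSn; congr (sub _ _ _).
  by rewrite iter_der_sub_neq // eq_sym.
have -> : edgeop (l, inl k') (edgeop (i, inl k) cw) w a G =
    (sg l w * sg i (del l w) : F) *: nsum (fun m => nsum (Z^~ m)).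
  rewrite -nsumZ2; last by have [N ZN] := ZP; exists N => m n; rewrite orbC => /ZN.
  rewrite /edgeop /=; congr (_ *: _); apply: eq_nsum => m; congr (_ *: _).
  apply: eq_nsum => n; rewrite upd_neq // [upd a k' _ k]upd_neq //.
  rewrite -/w' [del i (del l w)]delC upd_comm //; congr (cw _ _ _); apply: funext => U.
  rewrite /subS /derSn (@subC _ l k' i k) //; last first.
    by rewrite /= !inE !negb_or !andbT [l == i]eq_sym il lk' lk ik' ik k'k.
  by congr (sub _ _ _); rewrite iter_der_sub_neq // iter_derC.
by rewrite sg_del // scaleNr fin2_exchange.
Qed.

Lemma edge_comm_LT i k l t w a G : uniq w -> uniq [:: i; l; k] ->
  i \in w -> l \in w -> k \in w -> sfin G [:: l] t ->
  edgeop (i, inl k) (edgeop (l, inr t) cw) w a G =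
  - edgeop (l, inr t) (edgeop (i, inl k) cw) w a G.
Proof.
move=> uw u3 iw lw kw Gs; move: u3; rewrite /= !inE !negb_or !andbT.
move=> /andP[/andP[il ik] lk].
have ki : k != i by rewrite eq_sym.
have kl : k != l by rewrite eq_sym.
have li : l != i by rewrite eq_sym.
set w' := del l (del i w).
have uw' : uniq w' by rewrite !del_uniq.
have kw' : k \in w' by rewrite !mem_del ki kl.
rewrite /edgeop /=.
pose Z n := cw w' (upd a k (lc_br (a i) (a k) n)) (actS (a l) l t (subS i k (derSn i n G))).
have ZP : is_poly Z by apply: chw_br_poly.
transitivity ((sg i w * sg l (del i w) : F) *: nsum Z).
  rewrite -scalerA [sg l _ *: nsum Z]nsumZ //; congr (_ *: _); apply: eq_nsum => n.
  by rewrite upd_neq.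
rewrite sg_del // scaleNr scalerA; congr (- (_ *: _)); apply: eq_nsum => n.
rewrite /Z /w' delC; congr (cw _ _ _).
by rewrite -[X in _ = subS i k X]/(derSn i n _) derSn_actS // subS_actS //; apply: sfin_derSn.
Qed.

(** The alternative says at which of the two tags the finiteness bound is uniform in both source
    variables; either one suffices for the exchange of sums. *)
Lemma edge_comm_TT i l t t' w a G : uniq w -> i != l -> t != t' ->
  i \in w -> l \in w ->
  (sfin G [:: i; l] t /\ sfin G [:: l] t') \/ (sfin G [:: i; l] t' /\ sfin G [:: i] t) ->
  edgeop (i, inr t) (edgeop (l, inr t') cw) w a G =
  - edgeop (l, inr t') (edgeop (i, inr t) cw) w a G.
Proof.
move=> uw il tt' iw lw Gs; rewrite /edgeop /= !scalerA sg_del // scaleNr delC.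
congr (- (_ *: cw _ _ _)); case: Gs => [[Gs Gs']|[Gs Gs']]; first exact: actSC.
apply/esym/actSC; rewrite 1?eq_sym //.
by apply: sfin_sub Gs => z; rewrite !inE orbC.
Qed.

(* The Jacobi identity of R, for i and j both acting on the label k. *)
Lemma edge_jacobi_slot i j k w A a G : uniq w -> uniq [:: i; j; k] ->
  i \in w -> j \in w -> k \in w -> good w A G ->
  edgeop (i, inl k) (edgeop (j, inl k) cw) w a G +
  edgeop (j, inl k) (edgeop (i, inl k) cw) w a G +
  edgeop (i, inl j) (edgeop (j, inl k) cw) w a G = 0.
Proof.
move=> uw u3 iw jw kw gG; move: (u3); rewrite /= !inE !negb_or !andbT.
move=> /andP[/andP[ij ik] jk].
have ki : k != i by rewrite eq_sym.
have kj : k != j by rewrite eq_sym.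
have ji : j != i by rewrite eq_sym.
set w' := del j (del i w).
have uw' : uniq w' by rewrite !del_uniq.
have kw' : k \in w' by rewrite !mem_del ki kj.
have jw' : j \notin w' by rewrite mem_del eqxx.
(* All three double edges are expressed by this functional: p and q are the numbers of derivatives
   in x_i and x_j, that is, the exponents of lambda and mu. *)
pose T x p q := cw w' (upd a k x) (subS j k (subS i k (derSn i p (derSn j q G)))).
have gT p q : good w' A (subS j k (subS i k (derSn i p (derSn j q G)))).
  apply: good_subS; rewrite ?del_uniq ?mem_del ?ki ?ji //.
  by apply: good_subS => //; do 2!apply: good_derSn => //.
have TD p q : {morph T^~ p ^~ q : x y / x + y} by move=> x y; apply: chwD_slot.
have T0 p q : T 0 p q = 0 by apply: chw0_slot.
set s : F := sg i w * sg j (del i w).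
have fin1 : fin2 (fun p q => T (lc_br (a j) (lc_br (a i) (a k) p) q) p q).
  have [N bN] := br_poly (a i) (a k); apply: (@fin2_rowpoly _ _ N) => [n m Nn|n].
    by rewrite bN // br0r T0.
  by have [N' bN'] := br_poly (a j) (lc_br (a i) (a k) n); exists N' => m Nm; rewrite bN' ?T0.
have fin2 : fin2 (fun q p => T (lc_br (a i) (lc_br (a j) (a k) q) p) p q).
  have [N bN] := br_poly (a j) (a k); apply: (@fin2_rowpoly _ _ N) => [n m Nn|n].
    by rewrite bN // br0r T0.
  by have [N' bN'] := br_poly (a i) (lc_br (a j) (a k) n); exists N' => m Nm; rewrite bN' ?T0.
have -> : edgeop (i, inl k) (edgeop (j, inl k) cw) w a G =
    s *: pair2 T 0 0 (fun p q => lc_br (a j) (lc_br (a i) (a k) p) q).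
  rewrite -nsumZ2 //; first last.
    by case: fin1 => N fN; exists N => p q /fN; rewrite !addn0.
  rewrite /edgeop /=; congr (_ *: _); apply: eq_nsum => n; congr (_ *: _); apply: eq_nsum => m.
  rewrite upd_eq upd_neq // upd_upd !addn0; congr (cw _ _ _); apply: funext => U.
  rewrite /subS /derSn; congr (sub _ _ _).
  by rewrite iter_der_sub_neq // iter_derC.
have -> : edgeop (j, inl k) (edgeop (i, inl k) cw) w a G =
    - s *: pair2 T 0 0 (fun p q => lc_br (a i) (lc_br (a j) (a k) q) p).
  rewrite /s sg_del // opprK /pair2 -fin2_exchange; last first.
    by case: fin2 => N fN; exists N => p q /fN; rewrite !addn0.
  rewrite -nsumZ2; last by case: fin2 => N fN; exists N => p q /fN; rewrite !addn0.
  rewrite /edgeop /=; congr (_ *: _); apply: eq_nsum => n; congr (_ *: _); apply: eq_nsum => m.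
  rewrite upd_eq upd_neq // upd_upd !addn0 delC; congr (cw _ _ _); apply: funext => U.
  by rewrite /subS /derSn iter_der_sub_neq // (@sub_subC _ i j k).
have -> : edgeop (i, inl j) (edgeop (j, inl k) cw) w a G =
    s *: nsum (fun n => nsum (fun p =>
      \sum_(r < p.+1) T (lc_br (lc_br (a i) (a j) n) (a k) p) (n + r)%N (p - r)%N *+ 'C(p, r))).
  rewrite -nsumZ2; last first.
    have [N bN] := br_poly (a i) (a j); apply: (@fin2_rowpoly _ _ N) => [n m Nn|n].
      by rewrite big1 // => r _; rewrite bN // br0l T0 mul0rn.
    have [N' bN'] := br_poly (lc_br (a i) (a j) n) (a k); exists N' => m Nm.
    by rewrite big1 // => r _; rewrite bN' // T0 mul0rn.
  rewrite /edgeop /=; congr (_ *: _); apply: eq_nsum => n; congr (_ *: _); apply: eq_nsum => p.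
  rewrite upd_eq [upd a j _ k]upd_neq //.
  have E r : winv w' (mu (subS j k (subS i k (derSn i (n + r) (derSn j (p - r) G))))).
    exact: good_winv (gT _ _).
  (* Here x_i is merged into x_j first, so the p derivatives in x_j spread over x_i and x_j as a
     power of lambda + mu. The vector at j is irrelevant since j has left the word. *)
  transitivity (chw w' (upd a k (lc_br (lc_br (a i) (a j) n) (a k) p)) (fun al =>
     \sum_(r < p.+1) mu (subS j k (subS i k (derSn i (n + r) (derSn j (p - r) G)))) al *+ 'C(p, r))).
    apply: chw_eq => [z zw'|al _]; first by rewrite /upd; case: eqP => // _; case: eqP => // zj; rewrite zj (negPf jw') in zw'.
    rewrite /mu /subS /derSn iter_der_sub // sub_sum; apply: eq_bigr => r _.
    rewrite subMn sub_sub //; congr (sub _ _ (sub _ _ _) _ *+ _).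
    by rewrite iter_derC -iterD addnC iter_derC.
  rewrite chw_sum // => [|r _]; last exact/winvMn.
  by apply: eq_bigr => r _; rewrite chwMn.
rewrite (jacobi_pair2 (a i) (a j) (a k) (@lc_brP F R) (@lc_jacobi F R) TD).
by rewrite scalerDr !scaleNr addrA subrr add0r addNr.
Qed.

End EdgeRelations.

Section EdgeJacobiTag.
Variables (F : fieldType) (R : lieConformal F) (M : lcModAlgebra R).
Local Notation LM := {linear M -> M}.
Local Notation ser := ((nat -> LM) -> (nat -> nat) -> M).
Local Notation edgeop := (@edgeop F R M).
Local Notation cw := (@cw F R M).
Implicit Types (w A : seq nat) (a : nat -> R) (G : ser) (x : R).

Lemma off_upd2 i j al be n : off [:: j] al be -> off [:: i; j] al (upd be i n).
Proof.
by move=> albe l; rewrite !inE negb_or => /andP[li lj]; rewrite upd_neq // albe // inE.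
Qed.

(** Only finitely many elements arise from m0 by the first action, and a common bound makes the
    second action vanish on all of them. *)
Lemma slot_actS_sfin i j t x G : slot G [:: i; j] t -> sfin (actS x i t G) [:: j] t.
Proof.
move=> Gs y al; have [m0 Gm] := Gs al.
have [N xN] := actL_poly x m0.
have [N' yN'] := @is_poly_sum _ _ (iota 0 N) (fun n m => actL M y m (actL M x n m0))
   (fun n _ => actL_poly y _).
exists N' => m be U Nm albe; apply: nsum0 => n.
have [T TD ->] := Gm _ (@off_upd2 i j al be n albe) (upd U t (compL (U t) (actL M y m))).
rewrite upd_eq -[compL _ _ _]/(U t (actL M y m (actL M x n m0))).
rewrite (_ : actL M y m _ = 0) ?linear0; last first.
  have [Nn|nN] := leqP N n; first by rewrite xN // linear0.
  by apply: yN' => //; rewrite mem_iota.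
have T0 : T 0 = 0 by apply: (addrI (T 0)); rewrite -TD !addr0.
by rewrite T0 mul0rn.
Qed.

Lemma iter_derE (V : zmodType) i n (f : (nat -> nat) -> V) al :
  iter n (der i) f al *+ (al i)`! = f (upd al i (al i + n)%N) *+ (al i + n)`!.
Proof.
elim: n al => [|n IHn] al; first by rewrite addn0 upd_id.
rewrite iterS /der -mulrnA -factS.
have := IHn (upd al i (al i).+1); rewrite upd_eq upd_upd addSnnS => ->; by [].
Qed.

(** Up to evaluation at zero, both sides are the p-th derivative in x_j after the substitution; its
    binomial coefficients match those of (lambda + mu)^p. The arithmetic behind it is p! = r! *
    'C(p, r) * (p - r)!. *)
Lemma sub_iter_der_fact (V : zmodType) i j n p (f : (nat -> nat) -> V) al : i != j ->
  sub i j (iter n (der i) f) (upd al j p) *+ p`! =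
  \sum_(r < p.+1) f (upd (upd al i (n + r)%N) j (p - r)%N) *+ ('C(p, r) * ((n + r)`! * (p - r)`!))%N.
Proof.
move=> ij; rewrite /sub upd_eq -sumrMnl; apply: eq_bigr => r _.
have /eqP ij' := ij.
have -> : (p`! = r`! * ('C(p, r) * (p - r)`!))%N.
  by rewrite -(bin_fact (leq_ord r)) mulnCA.
have := iter_derE i n f (upd (upd al i r) j (p - r)%N).
rewrite upd_neq // upd_eq [(r + n)%N]addnC => E.
rewrite (_ : upd (upd (upd al j p) i r) j _ = upd (upd al i r) j (p - r)%N); last by upd_ext.
rewrite mulrnA E -mulrnA mulnCA; congr (f _ *+ _); upd_ext.
Qed.

Lemma iter_der_ffact (V : zmodType) i n (f : (nat -> nat) -> V) al :
  iter n (der i) f al = f (upd al i (al i + n)%N) *+ (al i + n) ^_ n.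
Proof.
elim: n al => [|n IHn] al; first by rewrite addn0 upd_id.
rewrite iterS /der IHn upd_eq upd_upd addSnnS -mulrnA ffactnSr addnS -addSn addnK.
by [].
Qed.

(** The substitution distributes the exponent of x_j over x_i and x_j, so uniformity in x_j
    afterwards requires uniformity in both before. *)
Lemma sfin_sub_der i j t n G : i != j -> sfin G [:: i; j] t ->
  sfin (subS i j (derSn i n G)) [:: j] t.
Proof.
move=> ij Gs x al; have [N GN] := Gs x al; exists N => m be U Nm albe.
rewrite /subS /derSn /sub big1 // => q _; rewrite iter_der_ffact GN ?mul0rn // => l.
by rewrite !inE negb_or => /andP[li lj]; rewrite !upd_neq // albe // inE.
Qed.

Lemma good_zero w A G t U (z : LM) al : good w A G -> t \in A -> (forall m, z m = 0) ->
  G (upd U t z) al = 0.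
Proof.
move=> gG tA z0; rewrite (@good_lin _ _ _ _ _ _ gG t U (-1) z z z) //.
  by rewrite scaleN1r addNr.
by move=> m; rewrite z0 scaler0 addr0.
Qed.

Lemma actL0l n m : actL M (0 : R) n m = 0.
Proof.
by have := actL_linear (-1) (0 : R) 0 n m; rewrite scaler0 addr0 scaleN1r addNr.
Qed.

(* The Jacobi identity of M, for i and j both acting on the factor with tag t. *)
Lemma edge_jacobi_tag i j t w A a G : uniq w -> uniq A -> i != j ->
  i \in w -> j \in w -> t \in A -> good w A G -> slot G [:: i; j] t ->
  edgeop (i, inr t) (edgeop (j, inr t) cw) w a G +
  edgeop (j, inr t) (edgeop (i, inr t) cw) w a G +
  edgeop (i, inl j) (edgeop (j, inr t) cw) w a G = 0.
Proof.
move=> uw uA ij iw jw tA gG Gs.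
have ji : j != i by rewrite eq_sym.
have Gs' : slot G [:: j; i] t.
  move=> al; have [m Gm] := Gs al; exists m => be albe; apply: Gm => l.
  by move=> lij; apply: albe; move: lij; rewrite !inE orbC.
set w' := del j (del i w).
have uw' : uniq w' by rewrite !del_uniq.
have jw' : j \notin w' by rewrite mem_del eqxx.
have jwi : j \in del i w by rewrite mem_del ji.
have iwj : i \in del j w by rewrite mem_del ij.
set s : F := sg i w * sg j (del i w).
have sfini : sfin G [:: i] t by apply: sfin_sub (slot_sfin Gs) => z; rewrite !inE => ->.
have sfinj : sfin G [:: j] t by apply: sfin_sub (slot_sfin Gs) => z; rewrite !inE orbC => ->.
set f1 := mu (actS (a j) j t (actS (a i) i t G)).
set f2 := mu (actS (a i) i t (actS (a j) j t G)).
pose f3 n := mu (actS (lc_br (a i) (a j) n) j t (subS i j (derSn i n G))).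
have f1P : winv w' f1.
  apply: (@good_winv _ _ _ _ A); apply: good_actS; rewrite ?del_uniq //.
    exact: slot_actS_sfin.
  exact: good_actS.
have f3P n : winv w' (f3 n).
  apply: (@good_winv _ _ _ _ A); apply: good_actS; rewrite ?del_uniq //.
    by apply: sfin_sub_der => //; apply: slot_sfin.
  by apply: good_subS => //; apply: good_derSn.
have -> : edgeop (i, inr t) (edgeop (j, inr t) cw) w a G = s *: chw w' a f1.
  by rewrite /edgeop /= scalerA.
have -> : edgeop (j, inr t) (edgeop (i, inr t) cw) w a G = - s *: chw w' a f2.
  by rewrite /edgeop /= scalerA [X in X *: _]sg_del // /w' [del j (del i w)]delC.
have [N bN] := br_poly (a i) (a j).
have f30 n : (N <= n)%N -> f3 n = fun _ => 0.
  move=> Nn; apply: funext => al; rewrite /f3 bN // /mu /actS; apply: nsum0 => p.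
  rewrite (@good_zero (del i w) A) ?mul0rn //.
    by apply: good_subS => //; apply: good_derSn.
  by move=> m; exact: actL0l.
have -> : edgeop (i, inl j) (edgeop (j, inr t) cw) w a G = s *: \sum_(n < N) chw w' a (f3 n).
  rewrite /edgeop /= -scalerA; congr (_ *: _); rewrite scaler_sumr.
  have E n : chw w' (upd a j (lc_br (a i) (a j) n)) (f3 n) = chw w' a (f3 n).
    apply: chw_eq => // z zw'; rewrite upd_neq //; by apply: contraNneq jw' => <-.
  rewrite (@nsum_trunc _ _ N) => [|n Nn]; last first.
    by rewrite upd_eq [cw _ _ _]E f30 // chw0 // scaler0.
  by apply: eq_bigr => n _; rewrite upd_eq [cw _ _ _]E.
rewrite -addrA addrC -addrA -scalerDr -chw_sum // [X in _ + _ *: X]addrC -chwD //; last exact: winv_sum.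
rewrite scaleNr addrC; apply/eqP; rewrite subr_eq0; apply/eqP; congr (_ *: _).
congr (chw _ _ _); apply: funext => al.
(* The factor with tag t is one element m0 for all exponents of x_i and x_j; thus G depends on the
   operator u in this slot only through u m0, and additively. This provides the functional to which
   the Jacobi identity of M is applied. *)
have [m0 Gm] := Gs al.
have CH (pq : nat * nat) : exists T : M -> M, {morph T : p q / p + q} /\
    forall u : LM, G (upd (fun _ => idL M) t u) (upd (upd al i pq.1) j pq.2) = T (u m0).
  have O : off [:: i; j] al (upd (upd al i pq.1) j pq.2).
    by move=> l; rewrite !inE negb_or => /andP[li lj]; rewrite !upd_neq.
  by have [T TD HT] := Gm _ O (fun _ => idL M); exists T.
have {CH}[T0 T0P] := boolp.choice CH.
pose T y p q := T0 (p, q) y *+ (p`! * q`!).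
have TD p q : {morph T^~ p ^~ q : x y / x + y}.
  by move=> x y; rewrite /T (T0P (p, q)).1 mulrnDl.
have T0P2 p q (u : LM) : G (upd (fun _ => idL M) t u) (upd (upd al i p) j q) = T0 (p, q) (u m0).
  exact: (T0P (p, q)).2.
have fin_act (x y : R) : fin2 (fun n m => T (lm_act y (lm_act x m0 n) m) n m).
  have TZ p q : T 0 p q = 0 by apply: (addrI (T 0 p q)); rewrite -TD !addr0.
  have [K xK] := actL_poly x m0; apply: (@fin2_rowpoly _ _ K) => [n m Kn|n].
    rewrite -[lm_act x m0 n]/(actL M x n m0) xK //.
    by rewrite -[lm_act _ _ _]/(actL M y m 0) linear0.
  have [K' yK'] := actL_poly y (lm_act x m0 n); exists K' => m Km.
  by rewrite -[lm_act y _ _]/(actL M y m (lm_act x m0 n)) yK'.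
have f1E : f1 al = pair2 T 0 0 (fun p q => lm_act (a j) (lm_act (a i) m0 p) q).
  rewrite /pair2; under eq_nsum do under eq_nsum do rewrite !addn0.
  rewrite fin2_exchange //; apply: eq_nsum => m; rewrite -nsumMn.
    apply: eq_nsum => n; rewrite !upd_upd upd_eq upd_comm // T0P2 /T -mulrnA.
    by [].
  by apply: sfin_poly.
have f2E : f2 al = pair2 T 0 0 (fun p q => lm_act (a i) (lm_act (a j) m0 q) p).
  rewrite /pair2; under eq_nsum do under eq_nsum do rewrite !addn0.
  apply: eq_nsum => m; rewrite -nsumMn.
    apply: eq_nsum => n; rewrite !upd_upd upd_eq T0P2 /T -mulrnA mulnC.
    by [].
  by apply: sfin_poly.
rewrite f2E f1E (jacobi_pair2 (a i) (a j) m0 (lm_actP M) (@lm_jacobi F R M) TD); congr (_ + _).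
have f3E n : f3 n al = nsum (fun p => \sum_(r < p.+1)
    T (lm_act (lc_br (a i) (a j) n) m0 p) (n + r)%N (p - r)%N *+ 'C(p, r)).
  apply: eq_nsum => p; rewrite sub_iter_der_fact //; apply: eq_bigr => r _.
  by rewrite T0P2 /T -mulrnA mulnC.
rewrite (@nsum_trunc _ _ N) => [|n Nn]; first by apply: eq_bigr => n _; rewrite f3E.
by rewrite -f3E f30.
Qed.

End EdgeJacobiTag.

(** * The bracket as a sum over edges *)

Section Enumerations.

Lemma enum_ord_add h l :
  enum 'I_(h + l) = [seq lshift l i | i <- enum 'I_h] ++ [seq rshift h j | j <- enum 'I_l].
Proof.
apply: (inj_map val_inj); rewrite val_enum_ord map_cat -[X in X ++ _]map_comp -[X in _ ++ X]map_comp iotaD.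
congr (_ ++ _); first by rewrite -val_enum_ord; apply: eq_map.
by rewrite add0n -[h in LHS]addn0 iotaDl -val_enum_ord -map_comp; apply: eq_map.
Qed.

(** Both lists are strictly increasing and have the same members. *)
Lemma enum_lift n (j : 'I_n) : [seq lift j i | i <- enum 'I_n.-1] = [seq p <- enum 'I_n | p != j].
Proof.
pose lt := relpre (@nat_of_ord n) ltn.
apply: (@irr_sorted_eq _ lt).
- by move=> x y z; apply: ltn_trans.
- by move=> x; rewrite /lt /= ltnn.
- have := iota_ltn_sorted 0 n.-1; rewrite -val_enum_ord sorted_map.
  by apply: homo_sorted => x y /= xy; rewrite ltnNge leq_bump2 -ltnNge.
- apply: sorted_filter; first by move=> x y z; apply: ltn_trans.
  by have := iota_ltn_sorted 0 n; rewrite -val_enum_ord sorted_map.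
move=> p; rewrite mem_filter mem_enum andbT; apply/mapP/idP => [[q _ ->]|pj].
  by rewrite eq_sym neq_lift.
by case: (unliftP j p) pj => [q ->|->]; [exists q; rewrite ?mem_enum|rewrite eqxx].
Qed.

Lemma del_map_lift n (lab : 'I_n -> nat) (j : 'I_n) : injective lab ->
  [seq lab (lift j i) | i <- enum 'I_n.-1] = del (lab j) [seq lab i | i <- enum 'I_n].
Proof.
move=> lab_inj; rewrite (map_comp lab (lift j)) enum_lift /del [RHS]filter_map; congr (map lab _).
by apply: eq_filter => p /=; rewrite inj_eq.
Qed.

Lemma sg_index (F : fieldType) i w : i \in w -> sg i w = (-1) ^+ index i w :> F.
Proof.
elim: w => //= x w IHw; rewrite inE eq_sym; case: eqVneq => //= _ /IHw->.
by rewrite exprS mulN1r.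
Qed.

Lemma sg_lab (F : fieldType) n (lab : 'I_n -> nat) (j : 'I_n) : injective lab ->
  sg (lab j) [seq lab i | i <- enum 'I_n] = (-1) ^+ j :> F.
Proof.
move=> lab_inj; rewrite sg_index ?map_f ?mem_enum // index_map //.
by rewrite index_enum_ord.
Qed.

End Enumerations.

Section BracketWords.
Variables (F : fieldType) (R : lieConformal F) (M : lcModAlgebra R).
Local Notation mul := (@la_mul F R M).
Local Notation lser := ((nat -> nat) -> M).

Lemma der_lab k (lab : 'I_k -> nat) (i : 'I_k) (f : lser) (phi : fps k M) : injective lab ->
  (forall al, f al = phi (fun p => al (lab p))) ->
  forall al, der (lab i) f al = fderiv i phi (fun p => al (lab p)).
Proof.
move=> lab_inj fphi al; rewrite /der fphi /fderiv; congr (phi _ *+ _).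
apply: funext => p; rewrite /upd (inj_eq lab_inj) /raise.
by case: eqP => [->|_]; rewrite ?addn1 ?addn0.
Qed.

Lemma iter_der_lab k (lab : 'I_k -> nat) (i : 'I_k) (f : lser) (phi : fps k M) n : injective lab ->
  (forall al, f al = phi (fun p => al (lab p))) ->
  forall al, iter n (der (lab i)) f al = iter n (fderiv i) phi (fun p => al (lab p)).
Proof. by move=> lab_inj fphi; elim: n => //= n IHn; apply: der_lab. Qed.

Lemma insert_lab k (lab : 'I_k -> nat) (j : 'I_k) n al p : injective lab ->
  insert j n (fun q => al (lab (lift j q))) p = upd al (lab j) n (lab p).
Proof.
move=> lab_inj; rewrite /upd (inj_eq lab_inj); case: (unliftP j p) => [q|] ->.
  by rewrite insertE eq_sym (negPf (neq_lift j q)).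
by rewrite insert_id eqxx.
Qed.

Lemma sub_lab k (lab : 'I_k -> nat) (i j : 'I_k) (f : lser) (phi : fps k M) : injective lab ->
  i != j -> (forall al, f al = phi (fun p => al (lab p))) ->
  forall al, sub (lab j) (lab i) f al = fdiag i j phi (fun p => al (lab (lift j p))).
Proof.
move=> lab_inj ij fphi al; rewrite /sub /fdiag (insert_lab j 0 al i lab_inj) upd_neq ?(inj_eq lab_inj) //.
apply: eq_bigr => q _; rewrite fphi; congr (phi _); apply: funext => p.
rewrite (insert_lab j _ al p lab_inj) /upd !(inj_eq lab_inj); case: (eqVneq p i) => [->|_].
  by rewrite (negPf ij) muln1.
by rewrite muln0 subn0.
Qed.

Variables (h l : nat) (a : 'I_h -> R) (phi : mseries M h) (b : 'I_l -> R) (psi : mseries M l).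
Variables (lab : 'I_(h + l) -> nat) (a' : nat -> R) (f g : lser).
Hypotheses (lab_inj : injective lab) (a'E : forall p, a' (lab p) = catf a b p).
Hypothesis fE : forall al, f al = phi (fun i => al (lab (lshift l i))).
Hypothesis gE : forall al, g al = psi (fun j => al (lab (rshift h j))).

Let s := [seq lab (lshift l i) | i <- enum 'I_h].
Let t := [seq lab (rshift h j) | j <- enum 'I_l].
Let w := s ++ t.

Let wE : w = [seq lab p | p <- enum 'I_(h + l)].
Proof. by rewrite enum_ord_add map_cat -[X in _ = X ++ _]map_comp -[X in _ = _ ++ X]map_comp. Qed.

Let uw : uniq w.
Proof. by rewrite wE map_inj_uniq ?enum_uniq. Qed.

Let a'l i : a' (lab (lshift l i)) = a i.
Proof. by rewrite a'E /catf -[lshift l i]/(unsplit (inl i)) unsplitK. Qed.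

Let a'r j : a' (lab (rshift h j)) = b j.
Proof. by rewrite a'E /catf -[rshift h j]/(unsplit (inr j)) unsplitK. Qed.

Lemma wedge_chain_word : wedge_chain a phi b psi = chw w a' (fun al => mul (f al) (g al)).
Proof.
rewrite /wedge_chain wE; apply: chain_chw => // al _.
by rewrite fE gE.
Qed.

(** The coefficient of x_i^n times n! is the n-th derivative at x_i = 0, so this is the contraction
    in the second sum of the bracket formula. *)
Definition contractL (x : R) i : lser :=
  fun al => nsum (fun n => mul (f (upd al i n) *+ n`!) (lm_act x (g al) n)).
Definition contractR (x : R) j : lser :=
  fun al => nsum (fun n => mul (lm_act x (f al) n) (g (upd al j n) *+ n`!)).

Lemma bracket_chain_word : bracket_chain a phi b psi = (-1) ^+ h.+1 *: (
  \sum_(i <- s) \sum_(j <- t) (sg i w : F) *: nsum (fun n =>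
     chw (del i w) (upd a' j (lc_br (a' i) (a' j) n))
       (sub i j (iter n (der i) (fun al => mul (f al) (g al)))))
  + \sum_(i <- s) (sg i w : F) *: chw (del i w) a' (contractL (a' i) i)
  + \sum_(j <- t) (sg j w : F) *: chw (del j w) a' (contractR (a' j) j)).
Proof.
have fgE al : mul (f al) (g al) = mprod phi psi (fun p => al (lab p)) by rewrite fE gE.
rewrite !scalerDr !scaler_sumr; congr (_ + _ + _).
- rewrite big_map big_enum /=; apply: eq_bigr => i _; rewrite scaler_sumr big_map big_enum /=.
  apply: eq_bigr => j _; set I := lab _; set J := lab _.
  have IJ : I != J by rewrite (inj_eq lab_inj) lrshift_neq.
  have Iw : I \in w by rewrite wE map_f ?mem_enum.
  have Jw : J \in w by rewrite wE map_f ?mem_enum.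
  pose Y n := chw (del J w) (upd a' I (lc_br (a' I) (a' J) n))
       (sub J I (iter n (der I) (fun al => mul (f al) (g al)))).
  have YP : is_poly Y by apply: chw_br_poly; rewrite ?del_uniq // mem_del IJ.
  (* The formula of the theorem keeps position i and omits position j, whereas an edge deletes its
     source i. The merged slot is renamed, which costs one sign. *)
  rewrite (_ : sg I w *: _ = - ((sg J w : F) *: nsum Y)); last first.
    rewrite nsumZ; last by apply: chw_br_poly; rewrite ?del_uniq // mem_del eq_sym IJ.
    rewrite nsumZ // -nsumN; last by have [N YN] := YP; exists N => n /YN->; rewrite scaler0.
    by apply: eq_nsum => n; apply: chw_sub_swap.
  rewrite wE sg_lab // -scaleNr scalerA; congr (_ *: _).
    by rewrite /= addn1 addnS !exprS !mulN1r opprK mulrNN -exprD.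
  apply: eq_nsum => n; rewrite /Y wE -del_map_lift //; apply: chain_chw.
  + by move=> p q /lab_inj /lift_inj.
  + move=> p; rewrite /upd (inj_eq lab_inj) /=; case: eqP => _; last exact: a'E.
    by rewrite a'l a'r.
  have E be : iter n (der I) (fun al => mul (f al) (g al)) be =
      iter n (mderiv (lshift l i)) (mprod phi psi) (fun p => be (lab p)).
    rewrite (iter_der_lab (lshift l i) n lab_inj fgE).
    by congr (_ (fun p => be (lab p))); elim: n {be} => //= n ->.
  by move=> al _; exact: (sub_lab lab_inj (lrshift_neq i j) E).
- rewrite big_map big_enum /=; apply: eq_bigr => i _; set I := lab _.
  rewrite scalerA wE sg_lab // -exprD; congr (_ *: _).
    by congr (_ ^+ _); rewrite /= addnS addSn.
  rewrite -del_map_lift //; apply: chain_chw.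
  + by move=> p q /lab_inj /lift_inj.
  + by move=> p; rewrite a'E.
  move=> al _; rewrite a'l; apply: eq_nsum => n; rewrite /feval0 /fprod.
  congr (mul _ (lm_act _ _ _)).
    have := iter_derE I n f (upd al I 0%N); rewrite upd_eq fact0 mulr1n add0n upd_upd => <-.
    rewrite (@iter_der_lab _ (fun i => lab (lshift l i)) i f phi n) //.
      by congr (iter _ _ _ _); apply: funext => p; exact: (esym (insert_lab _ _ al _ lab_inj)).
    by move=> p q /lab_inj /lshift_inj.
  rewrite gE; congr (mseries_val psi _); apply: funext => p.
  by rewrite (insert_lab _ _ al _ lab_inj) upd_neq // (inj_eq lab_inj) eq_sym lrshift_neq.
rewrite big_map big_enum /=; apply: eq_bigr => j _; set J := lab _.
rewrite scalerA wE sg_lab // -exprD; congr (_ *: _).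
  by congr (_ ^+ _); rewrite /= addnS addSn.
rewrite -del_map_lift //; apply: chain_chw.
- by move=> p q /lab_inj /lift_inj.
- by move=> p; rewrite a'E.
move=> al _; rewrite a'r; apply: eq_nsum => n; rewrite /feval0 /fprod.
congr (mul (lm_act _ _ _) _).
  rewrite fE; congr (mseries_val phi _); apply: funext => p.
  by rewrite (insert_lab _ _ al _ lab_inj) upd_neq // (inj_eq lab_inj) lrshift_neq.
have := iter_derE J n g (upd al J 0%N); rewrite upd_eq fact0 mulr1n add0n upd_upd => <-.
rewrite (@iter_der_lab _ (fun j => lab (rshift h j)) j g psi n) //.
  by congr (iter _ _ _ _); apply: funext => p; exact: (esym (insert_lab _ _ al _ lab_inj)).
by move=> p q /lab_inj /rshift_inj.
Qed.

End BracketWords.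

Section GoodBrackets.
Variables (F : fieldType) (R : lieConformal F) (M : lcModAlgebra R).
Local Notation LM := {linear M -> M}.
Local Notation ser := ((nat -> LM) -> (nat -> nat) -> M).
Local Notation mul := (@la_mul F R M).
Local Notation edgeop := (@edgeop F R M).
Local Notation cw := (@cw F R M).
Implicit Types (s t w A B : seq nat) (a : nat -> R) (G H : ser) (x : R).

Definition targets t B : seq (nat + nat) := map inl t ++ map inr B.

(** A pair of labels occurs once, directed from s to t, whereas edges to coefficient functions go
    both ways; these are the three sums of the bracket formula. *)
Definition edges s A t B : seq edge :=
  [seq (i, tau) | i <- s, tau <- targets t B] ++ [seq (j, inr al) | j <- t, al <- A].

(** The action on a product of several factors is a derivation, so a contraction with the whole
    coefficient function splits into one edge for each tag. *)
Lemma mu_contractL s A t B G H x i al : (forall l, l \in s -> l \notin t) ->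
  (forall p, p \in A -> p \notin B) -> good s A G -> good t B H -> i \in s ->
  contractL (mu G) (mu H) x i al = \sum_(be <- B) mu (actS x i be (mulS G H)) al.
Proof.
move=> st AB gG gH is'.
have BA p : p \in B -> p \notin A by apply: contraTN; apply: AB.
rewrite /mu /actS -nsum_exchange_seq => [|be beB]; last first.
  apply: sfin_poly; apply: sfin_mulSr gG (BA _ beB) _; apply: good_sfin gH beB _ => l.
  by rewrite inE => /eqP->; apply: st.
apply: eq_nsum => n; rewrite -[lm_act _ _ _]/(actL M x n (H _ al)).
rewrite (good_der gH) ?mul_sumr; last exact: actL_der.
apply: eq_big_seq => be beB; rewrite /mulS mulMnl; congr (mul _ _ *+ _).
  by rewrite (good_updT _ _ _ gG) // BA.
by rewrite (good_updL _ _ _ gH) ?st // compLid compidL.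
Qed.

Lemma contractLR (f g : (nat -> nat) -> M) x j : contractR f g x j = contractL g f x j.
Proof. by apply: funext => al; apply: eq_nsum => n; rewrite la_mulC. Qed.

Lemma good_bracket_sum s A t B G H a : uniq (s ++ t) -> uniq (A ++ B) ->
  good s A G -> good t B H ->
  \sum_(i <- s) \sum_(j <- t) (sg i (s ++ t) : F) *: nsum (fun n =>
     chw (del i (s ++ t)) (upd a j (lc_br (a i) (a j) n))
       (sub i j (iter n (der i) (fun al => mul (mu G al) (mu H al)))))
  + \sum_(i <- s) (sg i (s ++ t) : F) *: chw (del i (s ++ t)) a (contractL (mu G) (mu H) (a i) i)
  + \sum_(j <- t) (sg j (s ++ t) : F) *: chw (del j (s ++ t)) a (contractR (mu G) (mu H) (a j) j) =
  \sum_(e <- edges s A t B) edgeop e cw (s ++ t) a (mulS G H).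
Proof.
move=> ust uAB gG gH.
have st l : l \in s -> l \notin t.
  move=> ls; move: ust; rewrite cat_uniq => /and3P[_ /hasPn H' _].
  by apply: contraL ls => /H'.
have ts l : l \in t -> l \notin s by apply: contraTN; apply: st.
have AB l : l \in A -> l \notin B.
  move=> ls; move: uAB; rewrite cat_uniq => /and3P[_ /hasPn H' _].
  by apply: contraL ls => /H'.
have BA l : l \in B -> l \notin A by apply: contraTN; apply: AB.
have gGH := good_mulS st AB gG gH.
rewrite /edges big_cat !big_allpairs_dep /=; congr (_ + _); last first.
  apply: eq_big_seq => j jt; rewrite contractLR.
  transitivity ((sg j (s ++ t) : F) *: chw (del j (s ++ t)) a (fun al =>
     \sum_(be <- A) mu (actS (a j) j be (mulS G H)) al)).
    congr (_ *: chw _ _ _); apply: funext => al; rewrite mulSC.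
    exact: (mu_contractL _ _ ts BA gH gG jt).
  rewrite chw_sum ?del_uniq ?scaler_sumr //.
  move=> be beA; apply: (@good_winv _ _ _ _ (A ++ B)); apply: good_actS => //.
  - by rewrite mem_cat jt orbT.
  - by rewrite mem_cat beA.
  apply: sfin_mulSl gH (AB _ beA) _; apply: good_sfin gG beA _ => l.
  by rewrite inE => /eqP->; apply: ts.
rewrite -big_split /=; apply: eq_big_seq => i is'.
rewrite /targets big_cat !big_map /=; congr (_ + _).
transitivity ((sg i (s ++ t) : F) *: chw (del i (s ++ t)) a (fun al =>
   \sum_(be <- B) mu (actS (a i) i be (mulS G H)) al)).
  congr (_ *: chw _ _ _); apply: funext => al.
  exact: (mu_contractL _ _ st AB gG gH is').
rewrite chw_sum ?del_uniq ?scaler_sumr //.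
move=> be beB; apply: (@good_winv _ _ _ _ (A ++ B)); apply: good_actS => //.
- by rewrite mem_cat is'.
- by rewrite mem_cat beB orbT.
apply: sfin_mulSr gG (BA _ beB) _; apply: good_sfin gH beB _ => l.
by rewrite inE => /eqP->; apply: st.
Qed.

Lemma cw_chain s A G a : uniq s -> good s A G ->
  exists phi : mseries M (size s), (forall al, mu G al = phi (fun i => al (nth 0%N s i))) /\
    cw s a G = chain (fun i => a (nth 0%N s i)) phi.
Proof.
move=> us gG; have [phi [phiE cE]] := chwE a us (good_winv gG).
exists phi; split=> // al; rewrite phiE; apply: (good_loc gG) => l ls.
rewrite -{1 2}(nth_index 0%N ls).
have ks : (index l s < size s)%N by rewrite index_mem.
by rewrite (exps_nth _ (Ordinal ks)).
Qed.

Lemma nth_enum_map s : [seq nth 0%N s (nat_of_ord i) | i : 'I_(size s) <- enum 'I_(size s)] = s.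
Proof.
apply: (@eq_from_nth _ 0%N) => [|i]; rewrite size_map size_enum_ord // => ks.
by rewrite (nth_map (Ordinal ks)) ?size_enum_ord // nth_enum_ord.
Qed.

Section Operations.
Variables (w br : chain_space M -> chain_space M -> chain_space M).
Hypotheses (wP : is_wedge w) (brP : is_bracket br).

Lemma wedge_good s A t B G H a : uniq (s ++ t) -> good s A G -> good t B H ->
  w (cw s a G) (cw t a H) = cw (s ++ t) a (mulS G H).
Proof.
move=> ust gG gH; have [us ut] : uniq s /\ uniq t by move: ust; rewrite cat_uniq => /and3P[].
have [phi [phiE ->]] := cw_chain a us gG; have [psi [psiE ->]] := cw_chain a ut gH.
pose lab (p : 'I_(size s + size t)) := nth 0%N (s ++ t) p.
have labl i : lab (lshift _ i) = nth 0%N s i by rewrite /lab nth_cat /= ltn_ord.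
have labr j : lab (rshift _ j) = nth 0%N t j.
  by rewrite /lab nth_cat /= ltnNge leq_addr addKn.
have lab_inj : injective lab.
  by move=> p q /eqP; rewrite /lab nth_uniq ?size_cat // => /eqP/val_inj.
rewrite (wP.2) (@wedge_chain_word _ _ _ _ _ _ _ _ _ lab a (mu G) (mu H)) //.
- congr (chw _ _ _); rewrite -[in RHS](nth_enum_map s) -[in RHS](nth_enum_map t).
  by congr (_ ++ _); apply: eq_map.
- move=> p; rewrite /catf; case: (split_ordP p) => j -> /=.
    by rewrite labl.
  by rewrite labr.
- by move=> al; rewrite phiE; congr (mseries_val phi _); apply: funext => i; rewrite labl.
- by move=> al; rewrite psiE; congr (mseries_val psi _); apply: funext => i; rewrite labr.
Qed.

Lemma bracket_good s A t B G H a : uniq (s ++ t) -> uniq (A ++ B) -> good s A G -> good t B H ->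
  br (cw s a G) (cw t a H) = (-1) ^+ (size s).+1 *:
    \sum_(e <- edges s A t B) edgeop e cw (s ++ t) a (mulS G H).
Proof.
move=> ust uAB gG gH; have [us ut] : uniq s /\ uniq t by move: ust; rewrite cat_uniq => /and3P[].
rewrite -good_bracket_sum //.
have [phi [phiE ->]] := cw_chain a us gG; have [psi [psiE ->]] := cw_chain a ut gH.
pose lab (p : 'I_(size s + size t)) := nth 0%N (s ++ t) p.
have labl i : lab (lshift _ i) = nth 0%N s i by rewrite /lab nth_cat /= ltn_ord.
have labr j : lab (rshift _ j) = nth 0%N t j.
  by rewrite /lab nth_cat /= ltnNge leq_addr addKn.
have lab_inj : injective lab.
  by move=> p q /eqP; rewrite /lab nth_uniq ?size_cat // => /eqP/val_inj.
have sE : [seq lab (lshift (size t) i) | i <- enum 'I_(size s)] = s.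
  by rewrite -[in RHS](nth_enum_map s); apply: eq_map.
have tE : [seq lab (rshift (size s) i) | i <- enum 'I_(size t)] = t.
  by rewrite -[in RHS](nth_enum_map t); apply: eq_map.
rewrite (brP.2) (@bracket_chain_word _ _ _ _ _ _ _ _ _ lab a (mu G) (mu H)) ?sE ?tE //.
- move=> p; rewrite /catf; case: (split_ordP p) => j -> /=.
    by rewrite labl.
  by rewrite labr.
- by move=> al; rewrite phiE; congr (mseries_val phi _); apply: funext => i; rewrite labl.
- by move=> al; rewrite psiE; congr (mseries_val psi _); apply: funext => i; rewrite labr.
Qed.

End Operations.

End GoodBrackets.

(** * Edge operators inside products and brackets *)

Section EdgeLinearity.
Variables (F : fieldType) (R : lieConformal F) (M : lcModAlgebra R).
Local Notation LM := {linear M -> M}.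
Local Notation ser := ((nat -> LM) -> (nat -> nat) -> M).
Local Notation edgeop := (@edgeop F R M).
Local Notation cw := (@cw F R M).
Implicit Types (w A B : seq nat) (a : nat -> R) (G H : ser) (e : edge).

Definition valid w A G e : Prop := e.1 \in w /\
  match e.2 with
  | inl k => k \in w /\ k != e.1
  | inr t => t \in A /\ sfin G [:: e.1] t
  end.

Lemma nsum_linear (V : lmodType F) c (z z1 z2 : nat -> V) : is_poly z1 -> is_poly z2 ->
  (forall n, z n = c *: z1 n + z2 n) -> nsum z = c *: nsum z1 + nsum z2.
Proof.
move=> z1P z2P zE; rewrite nsumZ // -nsumD; first exact: eq_nsum.
  by have [N zN] := z1P; exists N => n /zN->; rewrite scaler0.
exact: z2P.
Qed.

Lemma good_opS i k n w A G : uniq w -> i \in w -> k \in w -> k != i -> good w A G ->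
  good (del i w) A (subS i k (derSn i n G)).
Proof. by move=> uw iw kw ki gG; apply: good_subS; rewrite 1?eq_sym //; apply: good_derSn. Qed.

Lemma scale_linear (V : lmodType F) (d c : F) (z z1 z2 : V) :
  z = c *: z1 + z2 -> d *: z = c *: (d *: z1) + d *: z2.
Proof. by move=> ->; rewrite scalerDr !scalerA mulrC. Qed.

Lemma mu_actS_linear w A G (c : F) (x y : R) i t al : uniq w -> i \in w -> t \in A -> sfin G [:: i] t ->
  good w A G ->
  mu (actS (c *: x + y) i t G) al = c *: mu (actS x i t G) al + mu (actS y i t G) al.
Proof.
move=> uw iw tA Gs gG; apply: nsum_linear; try exact: sfin_poly.
move=> n; rewrite -scalerMnr -mulrnDl; congr (_ *+ _).
by apply: (good_lin gG) => // m; rewrite !compidL actL_linear.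
Qed.

(** For l the source or the target label of the edge, linearity comes from the bracket or the
    action; any other slot is untouched by the edge. *)
Lemma cw_edge_linear w A a G e l c (x y : R) : uniq w -> uniq A -> good w A G -> valid w A G e -> l \in w ->
  edgeop e cw w (upd a l (c *: x + y)) G =
  c *: edgeop e cw w (upd a l x) G + edgeop e cw w (upd a l y) G.
Proof.
move=> uw uA gG; case: e => i [k|t] [/= iw]; rewrite /edgeop /=.
  move=> [kw ki] lw; apply: scale_linear.
  have ik : i != k by rewrite eq_sym.
  have kw' : k \in del i w by rewrite mem_del ki.
  have uw' := del_uniq i uw.
  apply: nsum_linear; try exact: edgeop_poly.
  move=> n; rewrite /cw; have [il|il] := eqVneq i l.
    rewrite -{l lw}il !upd_eq !upd_neq //.
    have E z v : chw (del i w) (upd (upd a i z) k v) (mu (subS i k (derSn i n G))) =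
                 chw (del i w) (upd a k v) (mu (subS i k (derSn i n G))).
      apply: chw_eq => // p; rewrite mem_del => /andP[pi _].
      by rewrite upd_comm // upd_neq.
    by rewrite !E br_linearl chw_multilinear.
  rewrite ![upd a l _ i]upd_neq //.
  have [kl|kl] := eqVneq k l.
    by rewrite -kl !upd_upd !upd_eq br_linearr chw_multilinear.
  rewrite ![upd a l _ k]upd_neq // ![upd (upd a l _) k _]upd_comm 1?eq_sym //.
  by rewrite chw_multilinear // mem_del lw eq_sym il.
move=> [tA Gs] lw; apply: scale_linear; have uw' := del_uniq i uw.
have act_winv z : winv (del i w) (mu (actS z i t G)).
  by apply: (@good_winv _ _ _ _ A); apply: good_actS.
have [il|il] := eqVneq i l.
  rewrite -{l lw}il !upd_eq.
  have E z v : cw (del i w) (upd a i z) v = cw (del i w) a v.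
    by apply: chw_eq => // p; rewrite mem_del => /andP[pi _]; rewrite upd_neq.
  rewrite !E /cw -chw_linear //; congr (chw _ _ _); apply: funext => al.
  exact: mu_actS_linear iw tA Gs gG.
rewrite !upd_neq //.
by rewrite /cw chw_multilinear // mem_del lw eq_sym il.
Qed.

Lemma cw_edge0 w A a G e l : uniq w -> uniq A -> good w A G -> valid w A G e -> l \in w ->
  edgeop e cw w (upd a l 0) G = 0.
Proof.
move=> uw uA gG eP lw; have := cw_edge_linear a (-1) 0 0 uw uA gG eP lw.
by rewrite scaler0 addr0 scaleN1r addNr.
Qed.

Lemma edgeop_sum (E : seq edge) e w A a G : uniq w -> uniq A -> good w A G ->
  valid w A G e ->
  (forall e' n k, e' \in E -> e.2 = inl k -> valid (del e.1 w) A (subS e.1 k (derSn e.1 n G)) e') ->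
  edgeop e (fun w' a' G' => \sum_(e' <- E) edgeop e' cw w' a' G') w a G =
  \sum_(e' <- E) edgeop e (edgeop e' cw) w a G.
Proof.
move=> uw uA gG [iw eP] EP; rewrite -scaler_sumr; congr (_ *: _); case: e iw eP EP => i [k|t] //= iw.
move=> [kw ki] EP; rewrite nsum_exchange_seq // => e' e'E.
have [N bN] := br_poly (a i) (a k); exists N => n Nn; rewrite bN //.
apply: (@cw_edge0 _ A); rewrite ?del_uniq // ?mem_del ?ki //; first exact: good_opS.
exact: EP.
Qed.

Lemma mulS_subl i k n w B G H : good w B H -> i \notin w -> k \notin w ->
  mulS (subS i k (derSn i n G)) H = subS i k (derSn i n (mulS G H)).
Proof.
move=> gH iw kw; apply: funext => U; apply: funext => al.
have iterE be : iter n (der i) (mulS G H U) be = la_mul (iter n (der i) (G U) be) (H U be).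
  elim: n be => //= n IHn be; rewrite /der IHn (good_updL _ _ _ gH) //.
  by rewrite mulMnl.
rewrite /mulS /subS /derSn /sub mul_suml; apply: eq_bigr => q _.
by rewrite iterE !(good_updL _ _ _ gH).
Qed.

Lemma mulS_subr i k n w B G H : good w B H -> i \notin w -> k \notin w ->
  mulS H (subS i k (derSn i n G)) = subS i k (derSn i n (mulS H G)).
Proof. by move=> gH iw kw; rewrite mulSC (mulS_subl _ _ gH) // mulSC. Qed.

Lemma mulS_actl (x : R) i t w B G H : good w B H -> i \notin w -> t \notin B -> sfin G [:: i] t ->
  mulS (actS x i t G) H = actS x i t (mulS G H).
Proof.
move=> gH iw tB Gs; apply: funext => U; apply: funext => al; rewrite /mulS /actS.
rewrite (@nsum_additive _ _ (fun m => la_mul m (H U al))); first last.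
- exact: sfin_poly.
- by move=> p q; apply: mulDl.
apply: eq_nsum => n; rewrite mulMnl; congr (la_mul _ _ *+ _).
by rewrite (good_updT _ _ _ gH) // (good_updL _ _ _ gH).
Qed.

Lemma mulS_actr (x : R) i t w B G H : good w B H -> i \notin w -> t \notin B -> sfin G [:: i] t ->
  mulS H (actS x i t G) = actS x i t (mulS H G).
Proof. by move=> gH iw tB Gs; rewrite mulSC (mulS_actl _ gH) // mulSC. Qed.

Lemma cw_eq w a b G : {in w, a =1 b} -> cw w a G = cw w b G.
Proof. by move=> ab; apply: chw_eq. Qed.

Section Bilinear.
Variables (V : lmodType F) (op : V -> V -> V).
Hypothesis opP : bilinear_op op.

Lemma bilDl x y z : op (x + y) z = op x z + op y z.
Proof. by have := opP.1 z 1 x y; rewrite !scale1r. Qed.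

Lemma bilDr x y z : op z (x + y) = op z x + op z y.
Proof. by have := opP.2 z 1 x y; rewrite !scale1r. Qed.

Lemma bil0l y : op 0 y = 0.
Proof. by apply: (addrI (op 0 y)); rewrite -bilDl !addr0. Qed.

Lemma bil0r y : op y 0 = 0.
Proof. by apply: (addrI (op y 0)); rewrite -bilDr !addr0. Qed.

Lemma bilZl c x y : op (c *: x) y = c *: op x y.
Proof. by have := opP.1 y c x 0; rewrite !addr0 bil0l addr0. Qed.

Lemma bilZr c x y : op x (c *: y) = c *: op x y.
Proof. by have := opP.2 x c y 0; rewrite !addr0 bil0r addr0. Qed.

Lemma bil_nsuml y (z : nat -> V) : is_poly z -> op (nsum z) y = nsum (fun n => op (z n) y).
Proof. by move=> zP; apply: (@nsum_additive _ _ (op^~ y)) => // p q; apply: bilDl. Qed.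

Lemma bil_nsumr y (z : nat -> V) : is_poly z -> op y (nsum z) = nsum (fun n => op y (z n)).
Proof. by move=> zP; apply: (@nsum_additive _ _ (op y)) => // p q; apply: bilDr. Qed.

Lemma bil_suml (I : Type) (r : seq I) (f : I -> V) y :
  op (\sum_(i <- r) f i) y = \sum_(i <- r) op (f i) y.
Proof. by apply: (big_morph (op^~ y)) => [p q|]; rewrite ?bilDl ?bil0l. Qed.

Lemma bil_sumr (I : Type) (r : seq I) (f : I -> V) y :
  op y (\sum_(i <- r) f i) = \sum_(i <- r) op y (f i).
Proof. by apply: (big_morph (op y)) => [p q|]; rewrite ?bilDr ?bil0r. Qed.

End Bilinear.

Section Bracket.
Variable br : chain_space M -> chain_space M -> chain_space M.
Hypothesis brP : is_bracket br.

Lemma size_del i w : uniq w -> i \in w -> (size (del i w)).+1 = size w.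
Proof.
move=> uw iw; rewrite -[del i w]rem_filter // size_rem // prednK //.
by case: w iw {uw}.
Qed.

(** The edge involves no variable and no tag of u, so it passes through the product. The bracket is
    taken over a word that is shorter by one label, which turns the exponent (size v).+1 of the sign
    into size v. *)
Lemma br_edgeopl v A G u B H a e : uniq (v ++ u) -> uniq (A ++ B) -> good v A G -> good u B H ->
  valid v A G e ->
  br (edgeop e cw v a G) (cw u a H) = (-1) ^+ size v *:
    edgeop e (fun w' a' G' => \sum_(e' <- edges (del e.1 v) A u B) edgeop e' cw w' a' G')
      (v ++ u) a (mulS G H).
Proof.
move=> uvu uAB gG gH [iv eP].
have [uv uu vu] : [/\ uniq v, uniq u & forall l, l \in v -> l \notin u].
  move: uvu; rewrite cat_uniq => /and3P[-> /hasPn H' ->]; split=> // l lv.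
  by apply: contraL lv => /H'.
have [uA AB] : uniq A /\ forall l, l \in A -> l \notin B.
  move: uAB; rewrite cat_uniq => /and3P[-> /hasPn H' _]; split=> // l lv.
  by apply: contraL lv => /H'.
have udu : uniq (del e.1 v ++ u).
  by have := del_uniq e.1 uvu; rewrite del_cat (del_notin (vu _ iv)).
rewrite /edgeop (bilZl brP.1) scalerA mulrC -scalerA sg_cat //; congr (_ *: _).
rewrite del_cat (del_notin (vu _ iv)).
case: e iv eP udu => i [k|t] /= iv.
  move=> [kv ki] udu; have ik : i != k by rewrite eq_sym.
  have gk n : good (del i v) A (subS i k (derSn i n G)) by apply: good_opS.
  rewrite (bil_nsuml brP.1); last exact: edgeop_poly.
  have E n : br (cw (del i v) (upd a k (lc_br (a i) (a k) n)) (subS i k (derSn i n G))) (cw u a H) =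
     (-1) ^+ size v *: \sum_(e' <- edges (del i v) A u B)
       edgeop e' cw (del i v ++ u) (upd a k (lc_br (a i) (a k) n)) (subS i k (derSn i n (mulS G H))).
    have -> : cw u a H = cw u (upd a k (lc_br (a i) (a k) n)) H.
      by apply: cw_eq => l lu; rewrite upd_neq //; apply: contraTneq lu => ->; apply: vu.
    rewrite (bracket_good brP _ udu uAB (gk n) gH) size_del //.
    by rewrite (mulS_subl _ _ gH) ?vu.
  rewrite (eq_nsum E) nsumZ //.
  (* The finiteness of the sums over edges is read off from E: its left side vanishes for large n,
     and the sign in front of the right side is invertible. *)
  have [N bN] := br_poly (a i) (a k); exists N => n Nn.
  apply: (can_inj (signrZK (size v))); rewrite scaler0.
  have := E n; rewrite bN // => <-.
  by rewrite /cw chw0_slot ?(bil0l brP.1) // ?del_uniq // mem_del ki.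
move=> [tA Gs] udu.
rewrite (bracket_good brP _ udu uAB _ gH) ?size_del //; last exact: good_actS.
by rewrite (mulS_actl _ gH) ?vu ?AB.
Qed.

(** The source label must be moved past s, with sign (-1)^(size s), which reduces the sign
    (-1)^(size s).+1 of the bracket to -1. *)
Lemma br_edgeopr s A G v B H a e : uniq (s ++ v) -> uniq (A ++ B) -> good s A G -> good v B H ->
  valid v B H e ->
  br (cw s a G) (edgeop e cw v a H) =
    - edgeop e (fun w' a' G' => \sum_(e' <- edges s A (del e.1 v) B) edgeop e' cw w' a' G')
      (s ++ v) a (mulS G H).
Proof.
move=> usv uAB gG gH [iv eP].
have [us uv vs] : [/\ uniq s, uniq v & forall l, l \in v -> l \notin s].
  by move: usv; rewrite cat_uniq => /and3P[-> /hasPn H' ->]; split.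
have [uB BA] : uniq B /\ forall l, l \in B -> l \notin A.
  by move: uAB; rewrite cat_uniq => /and3P[_ /hasPn H' ->]; split.
have usd : uniq (s ++ del e.1 v).
  by have := del_uniq e.1 usv; rewrite del_cat (del_notin (vs _ iv)).
rewrite /edgeop (bilZr brP.1) sg_catr ?vs // mulrC -scalerA -scalerN.
rewrite del_cat (del_notin (vs _ iv)); congr (_ *: _).
rewrite -scaleN1r scalerA -exprS.
case: e iv eP usd => i [k|t] /= iv.
  move=> [kv ki] usd; have ik : i != k by rewrite eq_sym.
  have gk n : good (del i v) B (subS i k (derSn i n H)) by apply: good_opS.
  rewrite (bil_nsumr brP.1); last exact: edgeop_poly.
  have E n : br (cw s a G) (cw (del i v) (upd a k (lc_br (a i) (a k) n)) (subS i k (derSn i n H))) =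
     (-1) ^+ (size s).+1 *: \sum_(e' <- edges s A (del i v) B)
       edgeop e' cw (s ++ del i v) (upd a k (lc_br (a i) (a k) n)) (subS i k (derSn i n (mulS G H))).
    have -> : cw s a G = cw s (upd a k (lc_br (a i) (a k) n)) G.
      by apply: cw_eq => l ls; rewrite upd_neq //; apply: contraTneq ls => ->; apply: vs.
    rewrite (bracket_good brP _ usd uAB gG (gk n)).
    by rewrite (mulS_subr _ _ gG) ?vs.
  rewrite (eq_nsum E) nsumZ //.
  have [N bN] := br_poly (a i) (a k); exists N => n Nn.
  apply: (can_inj (signrZK (size s).+1)); rewrite scaler0.
  have := E n; rewrite bN // => <-.
  by rewrite /cw chw0_slot ?(bil0r brP.1) // ?del_uniq // mem_del ki.
move=> [tB Hs] usd.
rewrite (bracket_good brP _ usd uAB gG) //; last exact: good_actS.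
by rewrite (mulS_actr _ gG) ?vs ?BA.
Qed.

End Bracket.

End EdgeLinearity.

Lemma sum_pick (I : eqType) (V : nmodType) (r : seq I) x (f : I -> V) : uniq r -> x \in r ->
  (forall y, y \in r -> y != x -> f y = 0) -> \sum_(y <- r) f y = f x.
Proof.
move=> ur xr f0; rewrite (bigD1_seq x) //= big1_seq ?addr0 // => y /andP[yx yr].
exact: f0.
Qed.

Lemma sum0_seq (I : eqType) (V : nmodType) (r : seq I) (f : I -> V) :
  (forall y, y \in r -> f y = 0) -> \sum_(y <- r) f y = 0.
Proof. by move=> f0; rewrite big1_seq // => y /andP[_ /f0]. Qed.

Lemma add0E (V : nmodType) (x y : V) : x = 0 -> y = 0 -> x + y = 0.
Proof. by move=> -> ->; rewrite addr0. Qed.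

Lemma edges_sum (V : nmodType) s A t B (f : edge -> V) :
  \sum_(e <- edges s A t B) f e =
  \sum_(i <- s) \sum_(tau <- targets t B) f (i, tau) + \sum_(j <- t) \sum_(al <- A) f (j, inr al).
Proof. by rewrite big_cat !big_allpairs_dep. Qed.

Lemma targets_sum (V : nmodType) t B (f : nat + nat -> V) :
  \sum_(tau <- targets t B) f tau = \sum_(k <- t) f (inl k) + \sum_(al <- B) f (inr al).
Proof. by rewrite big_cat !big_map. Qed.

(** * The Jacobi identity *)

Section TriangleSum.
Variables (V : zmodType) (s t u : seq nat) (P : edge -> edge -> V).
Hypothesis uw : uniq (s ++ t ++ u).
Let w := s ++ t ++ u.

Definition blk l := if l \in s then 0%N else if l \in t then 1%N else 2%N.

(* A legal target: another label, or a coefficient function of another chain. *)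
Definition okt i (tau : nat + nat) := match tau with
  | inl k => (k \in w) && (k != i)
  | inr al => (al < 3)%N && (blk i != al)
  end.

(** Excludes two sources that act each on the coefficient function of the chain of the other, where
    no bound uniform in both exponents is at hand. Such edges belong to the same pair of chains, so
    the sums below, over edges of two different pairs, never meet them. *)
Definition sep i l (tau tau' : nat + nat) := match tau, tau' with
  | inr al, inr be => (blk l != al) || (blk i != be)
  | _, _ => true
  end.

Hypothesis Pcomm : forall i l tau tau', i \in w -> l \in w -> i != l -> tau != tau' ->
  tau != inl l -> tau' != inl i -> okt i tau -> okt l tau' -> sep i l tau tau' ->
  P (i, tau) (l, tau') + P (l, tau') (i, tau) = 0.

Hypothesis Pjacobi : forall i j tau, i \in w -> j \in w -> i != j -> okt i tau -> okt j tau ->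
  P (i, tau) (j, tau) + P (j, tau) (i, tau) + P (i, inl j) (j, tau) = 0.

(* The pairs left out are those in which the first edge has deleted an end of the second. *)
Definition Q (e e' : edge) := if (e'.1 != e.1) && (e'.2 != inl e.1) then P e e' else 0.
Definition Z e e' := Q e e' + Q e' e.

Let su : uniq s. Proof. by move: uw; rewrite cat_uniq => /and3P[]. Qed.
Let tu : uniq t. Proof. by move: uw; rewrite !cat_uniq => /and3P[_ _ /and3P[]]. Qed.
Let uu : uniq u. Proof. by move: uw; rewrite !cat_uniq => /and3P[_ _ /and3P[]]. Qed.

Let Nst l : l \in t -> (l \in s) = false.
Proof.
move: uw; rewrite cat_uniq has_cat negb_or => /and3P[_ /andP[/hasPn H _] _] lt.
exact/negbTE/H.
Qed.
Let Nsu l : l \in u -> (l \in s) = false.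
Proof.
move: uw; rewrite cat_uniq has_cat negb_or => /and3P[_ /andP[_ /hasPn H] _] lt.
exact/negbTE/H.
Qed.
Let Ntu l : l \in u -> (l \in t) = false.
Proof.
move: uw; rewrite !cat_uniq => /and3P[_ _ /and3P[_ /hasPn H _]] lt.
exact/negbTE/H.
Qed.

Let ws l : l \in s -> l \in w. Proof. by rewrite mem_cat => ->. Qed.
Let wt l : l \in t -> l \in w. Proof. by rewrite !mem_cat => ->; rewrite orbT. Qed.
Let wu l : l \in u -> l \in w. Proof. by rewrite !mem_cat => ->; rewrite !orbT. Qed.

Let bs l : l \in s -> blk l = 0%N. Proof. by rewrite /blk => ->. Qed.
Let bt l : l \in t -> blk l = 1%N. Proof. by move=> lt; rewrite /blk Nst // lt. Qed.
Let bu l : l \in u -> blk l = 2%N. Proof. by move=> lu; rewrite /blk Nsu // Ntu. Qed.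

Let neq_st i j : i \in s -> j \in t -> i != j.
Proof. by move=> is' jt; apply: contraTneq is' => ->; rewrite Nst. Qed.
Let neq_su i j : i \in s -> j \in u -> i != j.
Proof. by move=> is' jt; apply: contraTneq is' => ->; rewrite Nsu. Qed.
Let neq_tu i j : i \in t -> j \in u -> i != j.
Proof. by move=> is' jt; apply: contraTneq is' => ->; rewrite Ntu. Qed.

Lemma Z_src i tau tau' : Z (i, tau) (i, tau') = 0.
Proof. by rewrite /Z /Q /= eqxx addr0. Qed.

Lemma Z_comm i l tau tau' : i \in w -> l \in w ->
  (i != l -> [&& tau != tau', tau != inl l, tau' != inl i & sep i l tau tau']) ->
  okt i tau -> okt l tau' ->
  Z (i, tau) (l, tau') = 0.
Proof.
move=> iw lw; have [-> _ _ _|il] := eqVneq i l; first exact: Z_src.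
move=> /(_ isT)/and4P[tt' tl t'i st] oki okl.
by rewrite /Z /Q /= [l == i]eq_sym il tl t'i /=; apply: Pcomm.
Qed.

Lemma Z_ij i j tau : i != j -> tau != inl i -> Z (i, inl j) (j, tau) = P (i, inl j) (j, tau).
Proof. by move=> ij ti; rewrite /Z /Q /= [j == i]eq_sym ij ti eqxx /= addr0. Qed.

Lemma Z_same i j tau : i != j -> tau != inl i -> tau != inl j ->
  Z (i, tau) (j, tau) = P (i, tau) (j, tau) + P (j, tau) (i, tau).
Proof. by move=> ij ti tj; rewrite /Z /Q /= [j == i]eq_sym ij ti tj. Qed.

Lemma ZC e e' : Z e e' = Z e' e. Proof. exact: addrC. Qed.

Let ea := edges s [:: 0%N] t [:: 1%N].
Let eb := edges s [:: 0%N] u [:: 2%N].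
Let ec := edges t [:: 1%N] u [:: 2%N].
Let tgu := targets u [:: 2%N].

Let inl_eq (x y : nat) : (inl x == inl y :> nat + nat) = (x == y). Proof. by []. Qed.
Let inr_eq (x y : nat) : (inr x == inr y :> nat + nat) = (x == y). Proof. by []. Qed.
Let inlr_eq (x y : nat) : (inl x == inr y :> nat + nat) = false. Proof. by []. Qed.
Let inrl_eq (x y : nat) : (inr x == inl y :> nat + nat) = false. Proof. by []. Qed.

Let tgu_uniq : uniq tgu.
Proof.
rewrite cat_uniq map_inj_uniq ?uu //=; last by move=> x y [].
by rewrite orbF andbT; apply/mapP => -[].
Qed.

Let tguP tau : tau \in tgu -> (exists2 k, k \in u & tau = inl k) \/ tau = inr 2%N.
Proof.
rewrite mem_cat => /orP[/mapP[k ku ->]|]; first by left; exists k.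
by rewrite inE => /eqP->; right.
Qed.

Ltac blkE := repeat match goal with
  | H : is_true (?l \in s) |- context [blk ?l] => rewrite (bs H)
  | H : is_true (?l \in t) |- context [blk ?l] => rewrite (bt H)
  | H : is_true (?l \in u) |- context [blk ?l] => rewrite (bu H)
  end.

Ltac inwE := repeat match goal with
  | H : is_true (?l \in s) |- context [?l \in w] => rewrite (ws H)
  | H : is_true (?l \in t) |- context [?l \in w] => rewrite (wt H)
  | H : is_true (?l \in u) |- context [?l \in w] => rewrite (wu H)
  end.

Ltac neqE := repeat match goal with
  | H : is_true (?x != ?y) |- context [?x == ?y] => rewrite (negPf H)
  | H : is_true (?y != ?x) |- context [?x == ?y] => rewrite [x == y]eq_sym (negPf H)
  | H : is_true (?x \in s), K : is_true (?y \in t) |- context [?x == ?y] =>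
      rewrite (negPf (neq_st H K))
  | H : is_true (?x \in s), K : is_true (?y \in u) |- context [?x == ?y] =>
      rewrite (negPf (neq_su H K))
  | H : is_true (?x \in t), K : is_true (?y \in u) |- context [?x == ?y] =>
      rewrite (negPf (neq_tu H K))
  | H : is_true (?x \in s), K : is_true (?y \in t) |- context [?y == ?x] =>
      rewrite [y == x]eq_sym (negPf (neq_st H K))
  | H : is_true (?x \in s), K : is_true (?y \in u) |- context [?y == ?x] =>
      rewrite [y == x]eq_sym (negPf (neq_su H K))
  | H : is_true (?x \in t), K : is_true (?y \in u) |- context [?y == ?x] =>
      rewrite [y == x]eq_sym (negPf (neq_tu H K))
  end.

Ltac edge_side := rewrite /okt /sep ?inl_eq ?inr_eq ?inlr_eq ?inrl_eq; inwE; blkE; neqE; by [].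
Ltac zsolve := apply: Z_comm; [edge_side|edge_side|move=> ?; edge_side|edge_side|edge_side].

(** What survives cancellation: paths from s through a label j of t to a target in u, and pairs of
    sources in s and u acting on the coefficient function of the middle chain. *)
Lemma sum_ac : \sum_(e <- ea) \sum_(e' <- ec) Z e e' =
  \sum_(i <- s) \sum_(j <- t) \sum_(tau <- tgu) Z (i, inl j) (j, tau)
  + \sum_(i <- s) \sum_(k <- u) Z (i, inr 1%N) (k, inr 1%N).
Proof.
rewrite edges_sum [X in _ + X]sum0_seq ?addr0 => [|j jt]; last first.
  rewrite big_seq1 edges_sum; apply: add0E; apply: sum0_seq => k kw; last first.
    by rewrite big_seq1; zsolve.
  by apply: sum0_seq => tau /tguP[[k' k'u ->]|->]; zsolve.
rewrite -big_split; apply: eq_big_seq => i is' /=.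
rewrite targets_sum big_seq1; congr (_ + _).
  apply: eq_big_seq => j jt; rewrite edges_sum [X in _ + X]sum0_seq ?addr0 => [|k ku].
    apply: (sum_pick (x := j)) => // j' j't j'j.
    by apply: sum0_seq => tau /tguP[[k' k'u ->]|->]; zsolve.
  by rewrite big_seq1; zsolve.
rewrite edges_sum sum0_seq ?add0r => [|j jt].
  by apply: eq_bigr => k _; rewrite big_seq1.
by apply: sum0_seq => tau /tguP[[k' k'u ->]|->]; zsolve.
Qed.

(** Two edges interact here only when a label of t and a label of u act on the coefficient function
    of the first chain. *)
Lemma sum_ab : \sum_(e <- ea) \sum_(e' <- eb) Z e e' =
  \sum_(j <- t) \sum_(k <- u) Z (j, inr 0%N) (k, inr 0%N).
Proof.
have tgtP tau : tau \in targets t [:: 1%N] -> (exists2 k, k \in t & tau = inl k) \/ tau = inr 1%N.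
  rewrite mem_cat => /orP[/mapP[k ku ->]|]; first by left; exists k.
  by rewrite inE => /eqP->; right.
rewrite edges_sum [X in X + _]sum0_seq ?add0r => [|i is']; last first.
  apply: sum0_seq => tau /tgtP tauP; rewrite edges_sum; apply: add0E; apply: sum0_seq => l lw; last first.
    by rewrite big_seq1; case: tauP => [[j jt ->]|->]; zsolve.
  have [<-|il] := eqVneq i l; first by apply: sum0_seq => tau' _; apply: Z_src.
  apply: sum0_seq => tau' /tguP[[k' k'u ->]|->]; case: tauP => [[j jt ->]|->]; zsolve.
apply: eq_big_seq => j jt; rewrite big_seq1 edges_sum sum0_seq ?add0r => [|i is'].
  by apply: eq_bigr => k _; rewrite big_seq1.
by apply: sum0_seq => tau /tguP[[k ku ->]|->]; zsolve.
Qed.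

(** Three interactions remain: sources in s and t with a common target in the third chain, and two
    kinds of paths through a label k of u, ending at the coefficient function of the second or of
    the first chain. *)
Lemma sum_bc : \sum_(e <- eb) \sum_(e' <- ec) Z e e' =
  \sum_(i <- s) \sum_(j <- t) \sum_(tau <- tgu) Z (i, tau) (j, tau)
  + \sum_(i <- s) \sum_(k <- u) Z (i, inl k) (k, inr 1%N)
  + \sum_(j <- t) \sum_(k <- u) Z (j, inl k) (k, inr 0%N).
Proof.
rewrite edges_sum; congr (_ + _).
  rewrite -big_split; apply: eq_big_seq => i is' /=.
  rewrite [X in _ = X + _]exchange_big /=.
  transitivity (\sum_(tau <- tgu) (\sum_(j <- t) Z (i, tau) (j, tau) + \sum_(k <- u) Z (i, tau) (k, inr 1%N))).
    apply: eq_big_seq => tau tauu; have tauP := tguP tauu.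
    rewrite edges_sum; congr (_ + _); last first.
      by apply: eq_bigr => k _; rewrite big_seq1.
    apply: eq_big_seq => j jt; apply: (sum_pick (x := tau)) => // tau' /tguP.
    move=> [[k' k'u ->]|->] tau't; case: tauP tau't => [[k ku ->]|->]; 
      rewrite ?inl_eq ?inr_eq // => kk; zsolve.
  rewrite big_split; congr (_ + _); rewrite targets_sum big_seq1 [X in _ + X]sum0_seq ?addr0.
    apply: eq_big_seq => k ku; apply: (sum_pick (x := k)) => // k' k'u k'k; zsolve.
  by move=> k ku; zsolve.
rewrite [RHS]exchange_big /=; apply: eq_big_seq => k ku; rewrite big_seq1 edges_sum.
rewrite [X in _ + X]sum0_seq ?addr0 => [|k' k'u]; last first.
  rewrite big_seq1; have [<-|kk] := eqVneq k k'; first exact: Z_src.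
  zsolve.
apply: eq_big_seq => j jt; rewrite targets_sum big_seq1 [X in _ + X](_ : _ = 0) ?addr0.
  rewrite ZC; apply: (sum_pick (x := k) (f := fun k' => Z (k, inr 0%N) (j, inl k'))) => // k' k'u k'k; zsolve.
zsolve.
Qed.

(** The six surviving sums pair off into a family of common targets and a family of paths, with
    vertices in the same three places; each triangle is an instance of [Pjacobi]. *)
Lemma triangle_sum0 : \sum_(e <- ea) \sum_(e' <- eb) Z e e' +
  \sum_(e <- ea) \sum_(e' <- ec) Z e e' + \sum_(e <- eb) \sum_(e' <- ec) Z e e' = 0.
Proof.
rewrite sum_ab sum_ac sum_bc.
set X1 := \sum_(j <- t) _; set X2 := \sum_(i <- s) _; set X3 := \sum_(i <- s) _.
set X4 := \sum_(i <- s) _; set X5 := \sum_(i <- s) _; set X6 := \sum_(j <- t) _.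
have E1 : X4 + X2 = 0.
  rewrite -big_split sum0_seq // => i is' /=.
  rewrite -big_split sum0_seq // => j jt /=.
  rewrite -big_split sum0_seq // => tau /tguP tauP /=.
  have ij := neq_st is' jt.
  case: tauP => [[k ku ->]|->]; rewrite Z_ij ?Z_same; try edge_side; apply: Pjacobi; edge_side.
have E2 : X3 + X5 = 0.
  rewrite -big_split sum0_seq // => i is' /=.
  rewrite -big_split sum0_seq // => k ku /=.
  have ik := neq_su is' ku.
  rewrite Z_ij ?Z_same; try edge_side; apply: Pjacobi; edge_side.
have E3 : X1 + X6 = 0.
  rewrite -big_split sum0_seq // => j jt /=.
  rewrite -big_split sum0_seq // => k ku /=.
  have jk := neq_tu jt ku.
  rewrite Z_ij ?Z_same; try edge_side; apply: Pjacobi; edge_side.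
rewrite -(addr0_eq E1) -(addr0_eq E2) -(addr0_eq E3).
by rewrite -{2}[X4]opprK -!opprD [- X4 + X3 + X1]addrC subrr.
Qed.

End TriangleSum.

(** No polynomiality is assumed, since a sequence and its opposite have the same support. In this
    form it applies to an arbitrary K in [alt_edgeop]. *)
Lemma nsum_opp (V : zmodType) (z : nat -> V) : nsum (fun n => - z n) = - nsum z.
Proof.
rewrite /nsum -sumrN.
have -> // : finite_support 0 [set: nat]%classic (fun n => - z n) = finite_support 0 [set: nat]%classic z.
rewrite /finite_support !unlock; congr (finmap.enum_fset (fset_set _)).
by apply/seteqP; split => n [_ /= zn]; split=> //= zn0; apply: zn; apply/eqP; move/eqP: zn0; rewrite oppr_eq0.
Qed.

(** * The Jacobi identity for chains over words *)

Section ChainJacobi.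
Variables (F : fieldType) (R : lieConformal F) (M : lcModAlgebra R).
Local Notation LM := {linear M -> M}.
Local Notation ser := ((nat -> LM) -> (nat -> nat) -> M).
Local Notation edgeop := (@edgeop F R M).
Local Notation cw := (@cw F R M).
Implicit Types (w A B : seq nat) (a : nat -> R) (G H : ser) (e : edge).

Lemma alt_edgeop e K : (forall a G, alt (fun w => K w a G)) ->
  forall a G, alt (fun w => edgeop e K w a G).
Proof.
move=> Ka a G.
pose K' v : chain_space M := match e.2 with
  | inl k => nsum (fun n => K v (upd a k (lc_br (a e.1) (a k) n))
      (subS e.1 k (derSn e.1 n G)))
  | inr t => K v a (actS (a e.1) e.1 t G)
  end.
have K'a : alt K'.
  move=> u x y v uv; rewrite /K'; case: (e.2) => [k|t]; last exact: Ka.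
  by rewrite -nsum_opp; apply: eq_nsum => n; apply: Ka.
exact: (alt_op e.1 K'a).
Qed.

Lemma edgeop_congr K K' e w A a G : uniq w -> uniq A -> good w A G -> valid w A G e ->
  (forall a' G', good (del e.1 w) A G' -> K (del e.1 w) a' G' = K' (del e.1 w) a' G') ->
  edgeop e K w a G = edgeop e K' w a G.
Proof.
move=> uw uA gG; case: e => i [k|t] [/= iw] [e1 e2] KK; rewrite /edgeop /=; congr (_ *: _).
  by apply: eq_nsum => n; apply: KK; apply: good_opS.
by apply: KK; apply: good_actS.
Qed.

Lemma edgesP s A t B e : e \in edges s A t B ->
  [\/ exists i k, [/\ i \in s, k \in t & e = (i, inl k)],
      exists i be, [/\ i \in s, be \in B & e = (i, inr be)]
    | exists j al, [/\ j \in t, al \in A & e = (j, inr al)] ].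
Proof.
rewrite mem_cat => /orP[/allpairsP[[i tau] /= [is' tauP ->]]|/allpairsP[[j al] /= [jt alA ->]]].
  move: tauP; rewrite mem_cat => /orP[/mapP[k kt ->]|/mapP[be beB ->]].
    by constructor 1; exists i, k.
  by constructor 2; exists i, be.
by constructor 3; exists j, al.
Qed.

Lemma uniq_catP (T : eqType) (s t : seq T) : uniq (s ++ t) ->
  [/\ uniq s, uniq t & forall l, l \in s -> l \notin t].
Proof.
rewrite cat_uniq => /and3P[-> /hasPn H ->]; split=> // l ls.
by apply: contraL ls => /H.
Qed.

Lemma valid_edges s A t B G H e : uniq (s ++ t) -> uniq (A ++ B) -> good s A G -> good t B H ->
  e \in edges s A t B -> valid (s ++ t) (A ++ B) (mulS G H) e.
Proof.
move=> /uniq_catP[us ut st] /uniq_catP[uA uB AB] gG gH.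
have ts l : l \in t -> l \notin s by apply: contraTN; apply: st.
have BA l : l \in B -> l \notin A by apply: contraTN; apply: AB.
case/edgesP => [[i [k [is' kt ->]]]|[i [be [is' beB ->]]]|[j [al [jt alA ->]]]]; split => /=; rewrite ?mem_cat.
- by rewrite is'.
- by rewrite kt orbT; split=> //; apply: contraTneq kt => ->; apply: st.
- by rewrite is'.
- rewrite beB orbT; split=> //; apply: sfin_mulSr gG (BA _ beB) _.
  by apply: good_sfin gH beB _ => l; rewrite inE => /eqP->; apply: st.
- by rewrite jt orbT.
rewrite alA; split=> //; apply: sfin_mulSl gH (AB _ alA) _.
by apply: good_sfin gG alA _ => l; rewrite inE => /eqP->; apply: ts.
Qed.

Section Bracket.
Variable br : chain_space M -> chain_space M -> chain_space M.
Hypothesis brP : is_bracket br.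

Lemma br_edgel_sum v A G u B H a e : uniq (v ++ u) -> uniq (A ++ B) -> good v A G -> good u B H ->
  valid v A G e ->
  br (edgeop e cw v a G) (cw u a H) = (-1) ^+ size v *:
    \sum_(e' <- edges (del e.1 v) A u B) edgeop e (edgeop e' cw) (v ++ u) a (mulS G H).
Proof.
move=> uvu uAB gG gH eP; rewrite (br_edgeopl brP _ uvu uAB gG gH eP); congr (_ *: _).
have [uv uu vu] := uniq_catP uvu; have [uA uB AB] := uniq_catP uAB.
have [iv eP2] := eP.
apply: (@edgeop_sum _ _ _ _ _ _ (A ++ B)) => //; first exact: good_mulS.
  split; first by rewrite mem_cat iv.
  case: (e.2) eP2 => [k [kv ki]|t [tA Gs]]; first by rewrite mem_cat kv.
  rewrite mem_cat tA; split=> //; apply: sfin_mulSl gH _ Gs.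
  exact: AB.
move=> e' n k e'E ek; rewrite ek in eP2; case: eP2 => kv ki.
rewrite -(mulS_subl _ _ gH) ?vu // del_cat (del_notin (vu _ iv)).
apply: valid_edges => //; last exact: good_opS.
by have := del_uniq e.1 uvu; rewrite del_cat (del_notin (vu _ iv)).
Qed.

Lemma br_edger_sum s A G v B H a e : uniq (s ++ v) -> uniq (A ++ B) -> good s A G -> good v B H ->
  valid v B H e ->
  br (cw s a G) (edgeop e cw v a H) =
    - \sum_(e' <- edges s A (del e.1 v) B) edgeop e (edgeop e' cw) (s ++ v) a (mulS G H).
Proof.
move=> usv uAB gG gH eP; rewrite (br_edgeopr brP _ usv uAB gG gH eP); congr (- _).
have [us uv sv] := uniq_catP usv; have [uA uB AB] := uniq_catP uAB.
have vs l : l \in v -> l \notin s by apply: contraTN; apply: sv.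
have BA l : l \in B -> l \notin A by apply: contraTN; apply: AB.
have [iv eP2] := eP.
apply: (@edgeop_sum _ _ _ _ _ _ (A ++ B)) => //; first exact: good_mulS.
  split; first by rewrite mem_cat iv orbT.
  case: (e.2) eP2 => [k [kv ki]|t [tA Hs]]; first by rewrite mem_cat kv orbT.
  rewrite mem_cat tA orbT; split=> //; apply: sfin_mulSr gG _ Hs.
  exact: BA.
move=> e' n k e'E ek; rewrite ek in eP2; case: eP2 => kv ki.
rewrite -(mulS_subr _ _ gG) ?vs // del_cat (del_notin (vs _ iv)).
apply: valid_edges => //; last exact: good_opS.
by have := del_uniq e.1 usv; rewrite del_cat (del_notin (vs _ iv)).
Qed.

Variables (s t u : seq nat) (a : nat -> R) (f g h : (nat -> nat) -> M).
Hypotheses (uw : uniq (s ++ t ++ u)) (fl : wloc s f) (gl : wloc t g) (hl : wloc u h).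
Hypothesis fi : forall al, \sum_(l <- s) der l f al = lm_d M (f al).
Hypothesis gi : forall al, \sum_(l <- t) der l g al = lm_d M (g al).
Hypothesis hi : forall al, \sum_(l <- u) der l h al = lm_d M (h al).

Let G1 : ser := primS 0%N f.
Let G2 : ser := primS 1%N g.
Let G3 : ser := primS 2%N h.
Let G : ser := mulS G1 (mulS G2 G3).
Let w := s ++ t ++ u.
Let A := [:: 0%N; 1%N; 2%N].
Let g1 : good s [:: 0%N] G1. Proof. exact: good_primS. Qed.
Let g2 : good t [:: 1%N] G2. Proof. exact: good_primS. Qed.
Let g3 : good u [:: 2%N] G3. Proof. exact: good_primS. Qed.

Let Nst l : l \in s -> l \notin t.
Proof. by have [_ _ H] := uniq_catP uw; move=> /H; rewrite mem_cat negb_or => /andP[]. Qed.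
Let Nsu l : l \in s -> l \notin u.
Proof. by have [_ _ H] := uniq_catP uw; move=> /H; rewrite mem_cat negb_or => /andP[]. Qed.
Let Ntu l : l \in t -> l \notin u.
Proof. by have [_ H _] := uniq_catP uw; have [_ _] := uniq_catP H; apply. Qed.
Let ust : uniq (s ++ t). Proof. by move: uw; rewrite catA cat_uniq => /andP[]. Qed.
Let utu : uniq (t ++ u). Proof. by move: uw; rewrite cat_uniq => /and3P[]. Qed.
Let usu : uniq (s ++ u).
Proof.
have [us uu _] := uniq_catP uw; have [_ uu' _] := uniq_catP uu.
rewrite cat_uniq us uu' andbT; apply/hasPn => l lu; apply: contraL lu; exact: Nsu.
Qed.

Let g12 : good (s ++ t) [:: 0%N; 1%N] (mulS G1 G2).
Proof. by apply: (good_mulS Nst _ g1 g2) => p; rewrite !inE => /eqP->. Qed.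
Let g23 : good (t ++ u) [:: 1%N; 2%N] (mulS G2 G3).
Proof. by apply: (good_mulS Ntu _ g2 g3) => p; rewrite !inE => /eqP->. Qed.
Let g13 : good (s ++ u) [:: 0%N; 2%N] (mulS G1 G3).
Proof. by apply: (good_mulS Nsu _ g1 g3) => p; rewrite !inE => /eqP->. Qed.
Let gG : good w A G.
Proof.
apply: (good_mulS _ _ g1 g23) => l; first by have [_ _] := uniq_catP uw; apply.
by rewrite !inE => /eqP->.
Qed.

Let P e e' := edgeop e (edgeop e' cw) w a G.

Let slotG S al : (al < 3)%N -> (forall l, l \in S -> blk s t l != al) ->
  (forall l, l \in S -> l \in w) -> slot G S al.
Proof.
move=> al3 Sal Sw.
case: al al3 Sal => [|[|[|]]] // _ Sal.
- apply: (slot_mulSl g23) => //; apply: (slot_primS _ fl) => l lS.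
  by move: (Sal _ lS); rewrite /blk; case: ifP.
- apply: (slot_mulSr g1) => //; apply: (slot_mulSl g3) => //; apply: (slot_primS _ gl) => l lS.
  move: (Sal _ lS); rewrite /blk; case: ifP => [ls _|_]; first exact: Nst.
  by case: ifP.
apply: (slot_mulSr g1) => //; apply: (slot_mulSr g2) => //; apply: (slot_primS _ hl) => l lS.
move: (Sal _ lS); rewrite /blk; case: ifP => [ls _|_]; first exact: Nsu.
by case: ifP => // lt _; apply: Ntu.
Qed.

Let Pcomm i l tau tau' : i \in w -> l \in w -> i != l -> tau != tau' ->
  tau != inl l -> tau' != inl i -> okt s t u i tau -> okt s t u l tau' -> sep s t i l tau tau' ->
  P (i, tau) (l, tau') + P (l, tau') (i, tau) = 0.
Proof.
have sf1 x al : x \in w -> (al < 3)%N && (blk s t x != al) -> sfin G [:: x] al.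
  move=> xw /andP[al3 xal]; apply: slot_sfin; apply: slotG => // l'; rewrite inE => /eqP-> //.
(* This covers all pairs except an edge to a coefficient function followed by an edge to a label; as
   the claim is symmetric in the two edges, the exception follows. *)
have main i' l' tt tt' : i' \in w -> l' \in w -> i' != l' -> tt != tt' ->
  tt != inl l' -> tt' != inl i' -> okt s t u i' tt -> okt s t u l' tt' -> sep s t i' l' tt tt' ->
  (if (tt, tt') is (inr _, inl _) then false else true) ->
  P (i', tt) (l', tt') + P (l', tt') (i', tt) = 0.
  move=> iw lw il tt0 tl t'i oki okl st ttt; rewrite /P.
  case: tt tt' tt0 tl t'i oki okl st ttt => [k|al] [k'|be] // kk' kl k'i /=.
  - move=> /andP[kw ki] /andP[k'w k'l] _ _; rewrite edge_comm_LL ?addNr //.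
    have {}kk' : k != k' by apply: contraNneq kk' => ->.
    have {}kl : k != l' by apply: contraNneq kl => ->.
    have {}k'i : k' != i' by apply: contraNneq k'i => ->.
    by rewrite /= !inE !negb_or il [i' == k]eq_sym ki [i' == k']eq_sym k'i [l' == k]eq_sym kl [l' == k']eq_sym k'l kk'.
  - move=> /andP[kw ki] okl _ _; rewrite edge_comm_LT ?addNr //; last exact: sf1.
    have {}kl : k != l' by apply: contraNneq kl => ->.
    by rewrite /= !inE !negb_or il [i' == k]eq_sym ki [l' == k]eq_sym kl.
  move=> oki okl st _; have albe : al != be by apply: contraNneq kk' => ->.
  rewrite edge_comm_TT ?addNr //.
  have [/andP[al3 ial] /andP[be3 lbe]] := (oki, okl).
  case/orP: st => [lal|ibe]; [left|right]; split; try exact: sf1.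
    by apply: slot_sfin; apply: slotG => // z; rewrite !inE => /orP[]/eqP->.
  by apply: slot_sfin; apply: slotG => // z; rewrite !inE => /orP[]/eqP->.
move=> iw lw il tt tl t'i oki okl st.
case: tau tau' tt tl t'i oki okl st => [k|al] [k'|be] tt tl t'i oki okl st; try exact: main.
by rewrite addrC; apply: main => //; rewrite eq_sym.
Qed.

Let Pjacobi i j tau : i \in w -> j \in w -> i != j -> okt s t u i tau -> okt s t u j tau ->
  P (i, tau) (j, tau) + P (j, tau) (i, tau) + P (i, inl j) (j, tau) = 0.
Proof.
move=> iw jw ij; case: tau => [k|al] /=.
  move=> /andP[kw ki] /andP[_ kj]; apply: (edge_jacobi_slot _ _ _ _ _ _ gG) => //.
  by rewrite /= !inE !negb_or ij [i == k]eq_sym ki [j == k]eq_sym kj.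
move=> /andP[al3 ial] /andP[_ jal]; apply: (edge_jacobi_tag _ _ _ _ _ _ _ gG) => //.
  by case: al al3 {ial jal} => [|[|[|]]].
by apply: slotG => // z; rewrite !inE => /orP[]/eqP->.
Qed.

Let ea := edges s [:: 0%N] t [:: 1%N].
Let eb := edges s [:: 0%N] u [:: 2%N].
Let ec := edges t [:: 1%N] u [:: 2%N].

Lemma jacobi_sum0 : \sum_(e <- ea) \sum_(e' <- eb) Z P e e' +
  \sum_(e <- ea) \sum_(e' <- ec) Z P e e' + \sum_(e <- eb) \sum_(e' <- ec) Z P e e' = 0.
Proof. exact: triangle_sum0. Qed.

Lemma sum_delE (V : nmodType) x (r : seq nat) (k : nat -> V) :
  \sum_(l <- del x r) k l = \sum_(l <- r) (if l != x then k l else 0).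
Proof. by rewrite big_filter big_mkcond. Qed.

Let QE e l tt : tt != inl e.1 -> (if l != e.1 then P e (l, tt) else 0) = Q P e (l, tt).
Proof. by rewrite /Q /= => ->; rewrite andbT. Qed.

Let QE1 e l tt : l != e.1 -> tt != inl e.1 -> P e (l, tt) = Q P e (l, tt).
Proof. by rewrite /Q /= => -> ->. Qed.

Let edge_src v B v' B' e : e \in edges v B v' B' -> e.1 \in v ++ v'.
Proof.
by case/edgesP => [[i [k [iv _ ->]]]|[i [be [iv _ ->]]]|[j [al [jv _ ->]]]] /=; rewrite mem_cat ?iv ?jv ?orbT.
Qed.

(** After the edge e the outer bracket joins u to what remains of s and t. Its edges are those of
    the pairs (s, u) and (t, u) whose source is still present, which is the condition in [Q]. *)
Let sum_a e : e \in ea ->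
  \sum_(e' <- edges (del e.1 (s ++ t)) [:: 0%N; 1%N] u [:: 2%N]) P e e' =
  \sum_(e' <- eb) Q P e e' + \sum_(e' <- ec) Q P e e'.
Proof.
move=> /edge_src est.
have nu k : k \in u -> k != e.1.
  by move=> ku; apply: contraTneq ku => ->; move: est; rewrite mem_cat => /orP[/Nsu|/Ntu].
have tgt tt : tt \in targets u [:: 2%N] -> tt != inl e.1.
  rewrite mem_cat => /orP[/mapP[k ku ->]|]; last by rewrite inE => /eqP->.
  by have := nu k ku.
rewrite !edges_sum sum_delE big_cat /= addrACA -addrA.
rewrite -!big_split /= addrA; congr (_ + _ + _).
- apply: eq_bigr => i _; case: ifP => [ix|/negbFE/eqP->].
    by apply: eq_big_seq => tt /tgt tx; apply: QE1.
  by rewrite big1_seq // => tt /andP[_ /tgt tx]; rewrite -QE // eqxx.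
- apply: eq_bigr => i _; case: ifP => [ix|/negbFE/eqP->].
    by apply: eq_big_seq => tt /tgt tx; apply: QE1.
  by rewrite big1_seq // => tt /andP[_ /tgt tx]; rewrite -QE // eqxx.
by apply: eq_big_seq => k /nu kx; rewrite !big_cons !big_nil !addr0 -!QE1.
Qed.

Let sum_c e : e \in ec ->
  \sum_(e' <- edges s [:: 0%N] (del e.1 (t ++ u)) [:: 1%N; 2%N]) P e e' =
  \sum_(e' <- ea) Q P e e' + \sum_(e' <- eb) Q P e e'.
Proof.
move=> /edge_src etu.
have ns i : i \in s -> i != e.1.
  by move=> is'; apply: contraTneq etu => <-; rewrite mem_cat negb_or Nst ?Nsu.
rewrite !edges_sum addrACA -!big_split /=; congr (_ + _).
  apply: eq_big_seq => i /ns ix; rewrite !targets_sum sum_delE big_cat /= addrACA.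
  rewrite !big_cons !big_nil !addr0; congr (_ + _ + (_ + _)).
  - apply: eq_bigr => k _; rewrite /Q /= ix /=; case: eqVneq => [->|kx]; rewrite ?eqxx //.
    by rewrite (_ : inl k != inl e.1).
  - apply: eq_bigr => k _; rewrite /Q /= ix /=; case: eqVneq => [->|kx]; rewrite ?eqxx //.
    by rewrite (_ : inl k != inl e.1).
  - exact: QE1.
  exact: QE1.
rewrite sum_delE big_cat /=; congr (_ + _); apply: eq_bigr => l _; rewrite !big_seq1; exact: QE.
Qed.

(** The outer bracket with t on the left directs its edges between t and s from t to s; they must be
    reversed to be counted among [ea]. *)
Let Pflip e i j : e \in eb -> i \in s -> i != e.1 -> j \in t -> P e (j, inl i) = P e (i, inl j).
Proof.
move=> eeb is' ix jt.
have xsu := edge_src eeb.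
have jx : j != e.1.
  apply: contraTneq xsu => <-; rewrite mem_cat negb_or (Ntu jt) andbT.
  by apply/negP => /Nst; rewrite jt.
have ij : i != j by apply: contraTneq jt => <-; exact: Nst.
have eP : valid w A G e.
  case/edgesP: eeb => [[i' [k [i's ku ->]]]|[i' [al [i's alP ->]]]|[k [al [ku alP ->]]]]; split => /=;
    rewrite ?mem_cat ?i's ?ku ?orbT //.
  - by split=> //; apply: contraTneq ku => ->; exact: Nsu.
  - move: alP; rewrite inE => /eqP->; split=> //; apply: slot_sfin; apply: slotG => // l.
      by rewrite inE => /eqP->; rewrite /blk i's.
    by rewrite inE => /eqP->; rewrite mem_cat i's.
  move: alP; rewrite inE => /eqP->; split=> //; apply: slot_sfin; apply: slotG => // l.
    rewrite inE => /eqP->; rewrite /blk; case: ifP => [/Nsu|_]; first by rewrite ku.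
    by case: ifP.
  by rewrite inE => /eqP->; rewrite !mem_cat ku !orbT.
apply: (edgeop_congr _ _ _ gG eP) => // a' G' gG'.
apply: (edge_flip _ _ _ _ _ gG'); rewrite ?del_uniq ?mem_del ?jx ?ix //.
- by rewrite eq_sym.
- by rewrite /w !mem_cat jt orbT.
by rewrite /w mem_cat is'.
Qed.

Let sum_b e : e \in eb ->
  \sum_(e' <- edges t [:: 1%N] (del e.1 (s ++ u)) [:: 0%N; 2%N]) P e e' =
  \sum_(e' <- ea) Q P e e' + \sum_(e' <- ec) Q P e e'.
Proof.
move=> eeb; have esu := edge_src eeb.
have nt j : j \in t -> j != e.1.
  move=> jt; apply: contraTneq esu => <-; rewrite mem_cat negb_or (Ntu jt) andbT.
  by apply/negP => /Nst; rewrite jt.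
rewrite !edges_sum.
have -> : \sum_(i <- s) \sum_(tau <- targets t [:: 1%N]) Q P e (i, tau) =
    \sum_(j <- t) \sum_(i <- s) Q P e (i, inl j) + \sum_(i <- s) Q P e (i, inr 1%N).
  rewrite [X in _ = X + _]exchange_big -big_split; apply: eq_bigr => i _ /=.
  by rewrite targets_sum big_seq1.
have E1 j : j \in t -> \sum_(tau <- targets (del e.1 (s ++ u)) [:: 0%N; 2%N]) P e (j, tau) =
    \sum_(i <- s) Q P e (i, inl j) + \sum_(k <- u) Q P e (j, inl k)
    + (Q P e (j, inr 0%N) + Q P e (j, inr 2%N)).
  move=> jt; have jx := nt j jt.
  rewrite targets_sum sum_delE big_cat big_cons big_seq1; congr (_ + _ + (_ + _)).
  - apply: eq_big_seq => i is'; rewrite /Q /=; case: ifP => //= ix.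
    rewrite Pflip // ifT //; exact: nt.
  - apply: eq_bigr => k _; rewrite /Q /= jx /=; case: eqVneq => [->|kx]; rewrite ?eqxx //.
    by rewrite (_ : inl k != inl e.1).
  - exact: QE1.
  exact: QE1.
rewrite (eq_big_seq _ E1) !big_split /= sum_delE big_cat /=.
have -> : \sum_(i <- s) (if i != e.1 then \sum_(al <- [:: 1%N]) P e (i, inr al) else 0) =
    \sum_(i <- s) Q P e (i, inr 1%N).
  by apply: eq_bigr => i _; rewrite big_seq1; exact: QE.
have -> : \sum_(i <- u) (if i != e.1 then \sum_(al <- [:: 1%N]) P e (i, inr al) else 0) =
    \sum_(i <- u) Q P e (i, inr 1%N).
  by apply: eq_bigr => i _; rewrite big_seq1; exact: QE.
have -> : \sum_(j <- t) \sum_(al <- [:: 0%N]) Q P e (j, inr al) = \sum_(j <- t) Q P e (j, inr 0%N).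
  by apply: eq_bigr => j _; rewrite big_seq1.
have -> : \sum_(j <- u) \sum_(al <- [:: 1%N]) Q P e (j, inr al) = \sum_(j <- u) Q P e (j, inr 1%N).
  by apply: eq_bigr => j _; rewrite big_seq1.
have -> : \sum_(j <- t) \sum_(tau <- targets u [:: 2%N]) Q P e (j, tau) =
   \sum_(j <- t) \sum_(k <- u) Q P e (j, inl k) + \sum_(j <- t) Q P e (j, inr 2%N).
  by rewrite -big_split; apply: eq_bigr => j _ /=; rewrite targets_sum big_seq1.
by rewrite [LHS](AC (2*2*2)%AC (1*5*3*(2*4*6))%AC).
Qed.

Let Z_sum (x y : seq edge) : \sum_(e <- x) \sum_(e' <- y) Z P e e' =
  \sum_(e <- x) \sum_(e' <- y) Q P e e' + \sum_(e <- y) \sum_(e' <- x) Q P e e'.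
Proof.
rewrite [X in _ + X]exchange_big -big_split; apply: eq_bigr => e _.
by rewrite -big_split.
Qed.

(** Each double bracket applies the edge of the inner bracket first. Together the three contain
    every ordered pair of edges from two different pairs of chains once. *)
Lemma jacobi_words :
  br (cw s a G1) (br (cw t a G2) (cw u a G3)) =
  br (br (cw s a G1) (cw t a G2)) (cw u a G3) +
  (-1) ^+ ((size s).+1 * (size t).+1) *: br (cw t a G2) (br (cw s a G1) (cw u a G3)).
Proof.
have E2 : br (cw s a G1) (br (cw t a G2) (cw u a G3)) =
    (-1) ^+ size t *: \sum_(e <- ec) (\sum_(e' <- ea) Q P e e' + \sum_(e' <- eb) Q P e e').
  rewrite (bracket_good brP _ utu _ g2 g3) // (bilZr brP.1) // (bil_sumr brP.1) exprS mulN1r scaleNr -scalerN -sumrN.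
  congr (_ *: _); apply: eq_big_seq => e eec.
  have eP := @valid_edges t [:: 1%N] u [:: 2%N] _ _ _ utu isT g2 g3 eec.
  by rewrite (@br_edger_sum s [:: 0%N] _ (t ++ u) [:: 1%N; 2%N]) // opprK sum_c.
have E1 : br (br (cw s a G1) (cw t a G2)) (cw u a G3) =
    - ((-1) ^+ size t *: \sum_(e <- ea) (\sum_(e' <- eb) Q P e e' + \sum_(e' <- ec) Q P e e')).
  rewrite (bracket_good brP _ ust _ g1 g2) // (bilZl brP.1) // (bil_suml brP.1).
  rewrite -scaleN1r scalerA -exprS.
  transitivity (((-1) ^+ (size s).+1 * (-1) ^+ size (s ++ t)) *:
     \sum_(e <- ea) (\sum_(e' <- eb) Q P e e' + \sum_(e' <- ec) Q P e e')).
    rewrite -scalerA; congr (_ *: _); rewrite scaler_sumr; apply: eq_big_seq => e eea.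
    have eP := @valid_edges s [:: 0%N] t [:: 1%N] _ _ _ ust isT g1 g2 eea.
    rewrite (@br_edgel_sum (s ++ t) [:: 0%N; 1%N] _ u [:: 2%N]) -?catA //.
    by rewrite -mulSA sum_a.
  congr (_ *: _); rewrite -exprD size_cat addSn addnA addnn -signr_odd /= oddD odd_double addFb.
  by rewrite -[RHS]signr_odd.
have E3 : br (cw t a G2) (br (cw s a G1) (cw u a G3)) =
    (-1) ^+ (size s + size s * size t) *:
      \sum_(e <- eb) (\sum_(e' <- ea) Q P e e' + \sum_(e' <- ec) Q P e e').
  rewrite (bracket_good brP _ usu _ g1 g3) // (bilZr brP.1) // (bil_sumr brP.1) exprS mulN1r scaleNr -scalerN -sumrN.
  rewrite exprD -scalerA; congr (_ *: _); rewrite scaler_sumr; apply: eq_big_seq => e eeb.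
  have eP := @valid_edges s [:: 0%N] u [:: 2%N] _ _ _ usu isT g1 g3 eeb.
  have utsu : uniq (t ++ (s ++ u)).
    rewrite -(perm_uniq (s1 := w)) // /w; exact: permEl (perm_catCA s t u).
  rewrite (@br_edger_sum t [:: 1%N] _ (s ++ u) [:: 0%N; 2%N]) // opprK -sum_b // scaler_sumr.
  apply: eq_bigr => e' _.
  have -> : mulS G2 (mulS G1 G3) = G by rewrite mulSA [mulS G2 G1]mulSC -mulSA.
  (* This double bracket is computed over t ++ s ++ u; alternation brings the word to s ++ t ++ u
     with the sign (-1)^(size s * size t). *)
  have K : alt (fun v => edgeop e (edgeop e' cw) v a G).
    by apply: alt_edgeop => a' G'; apply: alt_edgeop => a'' G''; apply: chw_alt.
  by have := @alt_swap F _ _ [::] t s u K utsu; rewrite /= mulnC.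
rewrite E1 E2 E3 scalerA -exprD.
have -> : ((-1) ^+ ((size s).+1 * (size t).+1 + (size s + size s * size t)) = - (-1) ^+ size t :> F).
  rewrite mulSn mulnS !addSn exprS mulN1r; congr (- _).
  rewrite -signr_odd -[RHS]signr_odd !oddD !oddM /=; congr (_ ^+ nat_of_bool _).
  by case: (odd (size s)); case: (odd (size t)).
rewrite scaleNr -opprD -scalerDr; apply/eqP; rewrite -subr_eq0 opprK -scalerDr; apply/eqP.
have := jacobi_sum0; rewrite !Z_sum => J0.
rewrite [X in _ *: X](_ : _ = 0) ?scaler0 // !big_split /= -[RHS]J0.
by rewrite [LHS](AC (2*(2*2))%AC (3*5*(4*1)*(6*2))%AC).
Qed.

End Bracket.

End ChainJacobi.

(** * Commutation and Leibniz rules *)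

Section WordLaws.
Variables (F : fieldType) (R : lieConformal F) (M : lcModAlgebra R).
Local Notation LM := {linear M -> M}.
Local Notation ser := ((nat -> LM) -> (nat -> nat) -> M).
Local Notation edgeop := (@edgeop F R M).
Local Notation cw := (@cw F R M).
Implicit Types (s t u v w A B C : seq nat) (a : nat -> R) (G H K : ser) (e : edge).

Lemma edges_swap (V : nmodType) s A t B (f : edge -> V) :
  (forall i j, i \in s -> j \in t -> f (i, inl j) = f (j, inl i)) ->
  \sum_(e <- edges t B s A) f e = \sum_(e <- edges s A t B) f e.
Proof.
move=> fC; rewrite !edges_sum.
under eq_bigr do rewrite targets_sum.
under [in RHS]eq_bigr do rewrite targets_sum.
rewrite !big_split /= exchange_big /= -!addrA; congr (_ + _); last exact: addrC.
by apply: eq_big_seq => i is'; apply: eq_big_seq => j jt; rewrite [RHS]fC.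
Qed.

Lemma edges_cat (V : nmodType) s A t B u C (f : edge -> V) :
  \sum_(e <- edges s A (t ++ u) (B ++ C)) f e =
  \sum_(e <- edges s A t B) f e + \sum_(e <- edges s A u C) f e.
Proof.
rewrite !edges_sum big_cat /= addrACA; congr (_ + _).
rewrite -big_split; apply: eq_bigr => i _ /=; rewrite !targets_sum !big_cat /=.
exact: addrACA.
Qed.

Definition bsum s A t B w a G : chain_space M := \sum_(e <- edges s A t B) edgeop e cw w a G.

Lemma alt_bsum s A t B a G : alt (fun w => bsum s A t B w a G).
Proof.
move=> u x y v uxy; rewrite /bsum -sumrN; apply: eq_bigr => e _.
by apply: (@alt_edgeop F R M e cw) => // a' G'; apply: chw_alt.
Qed.

(** Edges to coefficient functions occur symmetrically and edges between labels are reversed by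
    [edge_flip], so only the exchange of the two blocks of the word gives a sign. *)
Lemma bsumC s A t B a G H : uniq (s ++ t) -> uniq (A ++ B) -> good s A G -> good t B H ->
  bsum t B s A (t ++ s) a (mulS H G) =
  (-1 : F) ^+ (size s * size t) *: bsum s A t B (s ++ t) a (mulS G H).
Proof.
move=> ust uAB gG gH; have [us ut st] := uniq_catP ust; have [_ _ AB] := uniq_catP uAB.
have := @alt_swap F _ _ [::] t s [::] (@alt_bsum t B s A a (mulS H G)).
rewrite /= !cats0 uniq_catC => -> //; rewrite mulnC mulSC; congr (_ *: _).
apply: edges_swap => i j is' jt.
apply: (@edge_flip _ _ _ _ _ _ (A ++ B)) => //; rewrite ?mem_cat ?is' ?jt ?orbT //.
  by apply: contraTneq jt => <-; apply: st.
exact: good_mulS.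
Qed.

Section Wedge.
Variable w : chain_space M -> chain_space M -> chain_space M.
Hypothesis wP : is_wedge w.

Lemma wedge_edgel v A G u B H a e : uniq (v ++ u) -> uniq (A ++ B) -> good v A G -> good u B H ->
  valid v A G e ->
  w (edgeop e cw v a G) (cw u a H) = edgeop e cw (v ++ u) a (mulS G H).
Proof.
move=> uvu uAB gG gH [iv eP].
have [uv uu vu] := uniq_catP uvu; have [uA uB AB] := uniq_catP uAB.
have udu : uniq (del e.1 v ++ u).
  by have := del_uniq e.1 uvu; rewrite del_cat (del_notin (vu _ iv)).
rewrite /edgeop (bilZl wP.1) sg_cat //; congr (_ *: _).
rewrite del_cat (del_notin (vu _ iv)).
case: e iv eP udu => i [k|t] /= iv.
  move=> [kv ki] udu; have ik : i != k by rewrite eq_sym.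
  have gk n : good (del i v) A (subS i k (derSn i n G)) by apply: good_opS.
  rewrite (bil_nsuml wP.1); last exact: edgeop_poly.
  apply: eq_nsum => n; rewrite -(mulS_subl _ _ gH) ?vu //.
  rewrite -(wedge_good wP _ udu (gk n) gH).
  congr (w _ _); apply: cw_eq => l lu; rewrite upd_neq //.
  by apply: contraTneq lu => ->; apply: vu.
move=> [tA Gs] udu; have ga : good (del i v) A (actS (a i) i t G) by apply: good_actS.
rewrite (wedge_good wP _ udu ga gH).
by rewrite (mulS_actl _ gH) ?vu ?AB.
Qed.

Lemma wedge_edger s A G v B H a e : uniq (s ++ v) -> uniq (A ++ B) -> good s A G -> good v B H ->
  valid v B H e ->
  w (cw s a G) (edgeop e cw v a H) = (-1) ^+ size s *: edgeop e cw (s ++ v) a (mulS G H).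
Proof.
move=> usv uAB gG gH [iv eP].
have [us uv sv] := uniq_catP usv; have [uA uB AB] := uniq_catP uAB.
have vs l : l \in v -> l \notin s by apply: contraTN; apply: sv.
have BA l : l \in B -> l \notin A by apply: contraTN; apply: AB.
have usd : uniq (s ++ del e.1 v).
  by have := del_uniq e.1 usv; rewrite del_cat (del_notin (vs _ iv)).
rewrite /edgeop (bilZr wP.1) sg_catr ?vs // scalerA signrMK; congr (_ *: _).
rewrite del_cat (del_notin (vs _ iv)).
case: e iv eP usd => i [k|t] /= iv.
  move=> [kv ki] usd; have ik : i != k by rewrite eq_sym.
  have gk n : good (del i v) B (subS i k (derSn i n H)) by apply: good_opS.
  rewrite (bil_nsumr wP.1); last exact: edgeop_poly.
  apply: eq_nsum => n; rewrite -(mulS_subr _ _ gG) ?vs //.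
  rewrite -(wedge_good wP _ usd gG (gk n)).
  congr (w _ _); apply: cw_eq => l ls; rewrite upd_neq //.
  by apply: contraTneq ls => ->; apply: vs.
move=> [tB Hs] usd; have ga : good (del i v) B (actS (a i) i t H) by apply: good_actS.
rewrite (wedge_good wP _ usd gG ga).
by rewrite (mulS_actr _ gG) ?vs ?BA.
Qed.

Section Bracket.
Variable br : chain_space M -> chain_space M -> chain_space M.
Hypothesis brP : is_bracket br.

(** By [edges_cat] the edges split by the factor they touch. For those between s and u the block s
    must be moved past t, which accounts for the sign together with that of [wedge_edger]. *)
Lemma leibniz_good s A G t B H u C K a : uniq (s ++ t ++ u) -> uniq (A ++ B ++ C) ->
  good s A G -> good t B H -> good u C K ->
  br (cw s a G) (w (cw t a H) (cw u a K)) =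
  w (br (cw s a G) (cw t a H)) (cw u a K) +
  (-1) ^+ ((size s).+1 * size t) *: w (cw t a H) (br (cw s a G) (cw u a K)).
Proof.
move=> ustu uABC gG gH gK.
have ust : uniq (s ++ t) by move: ustu; rewrite catA cat_uniq => /andP[].
have [us utu s_tu] := uniq_catP ustu; have [_ uu tu] := uniq_catP utu.
have uAB : uniq (A ++ B) by move: uABC; rewrite catA cat_uniq => /andP[].
have [uA uBC A_BC] := uniq_catP uABC; have [_ uC BC] := uniq_catP uBC.
have utsu : uniq (t ++ s ++ u) by rewrite -(perm_uniq (permEl (perm_catCA s t u))).
have uBAC : uniq (B ++ A ++ C) by rewrite -(perm_uniq (permEl (perm_catCA A B C))).
have [_ usu t_su] := uniq_catP utsu; have [_ uAC B_AC] := uniq_catP uBAC.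
have gHK := good_mulS tu BC gH gK.
rewrite (wedge_good wP _ utu gH gK) (bracket_good brP _ ustu uABC gG gHK).
rewrite (bracket_good brP _ ust uAB gG gH) (bracket_good brP _ usu uAC gG gK).
rewrite edges_cat scalerDr; congr (_ + _).
  rewrite (bilZl wP.1) (bil_suml wP.1); congr (_ *: _); apply: eq_big_seq => e eE.
  have eP := valid_edges ust uAB gG gH eE.
  rewrite (@wedge_edgel (s ++ t) (A ++ B) _ u C) -?catA -?mulSA //.
  by apply: good_mulS => //; have [] := uniq_catP ust; have [] := uniq_catP uAB.
rewrite (bilZr wP.1) (bil_sumr wP.1) scalerA -exprD scaler_sumr.
rewrite scaler_sumr; apply: eq_big_seq => e eE.
have eP := valid_edges usu uAC gG gK eE.
have gsu : good (s ++ u) (A ++ C) (mulS G K).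
  by apply: good_mulS => //; have [] := uniq_catP usu; have [] := uniq_catP uAC.
rewrite (@wedge_edger t B _ (s ++ u) (A ++ C)) // [RHS]scalerA -exprD.
have -> : mulS H (mulS G K) = mulS G (mulS H K) by rewrite !mulSA [mulS H G]mulSC.
have alt_e : alt (fun v => edgeop e cw v a (mulS G (mulS H K))).
  by apply: alt_edgeop => a' G'; apply: chw_alt.
have := @alt_swap F _ _ [::] t s u alt_e utsu; rewrite /= => ->.
rewrite [RHS]scalerA -exprD; congr (_ *: _); rewrite -signr_odd -[RHS]signr_odd; congr (_ ^+ nat_of_bool _).
by rewrite !oddD !oddM /=; case: (odd (size s)); case: (odd (size t)).
Qed.

End Bracket.

End Wedge.

End WordLaws.

(** * Relations satisfied by the operations on generators *)

Section Labels.
Variables (F : fieldType) (R : lieConformal F) (M : lcModAlgebra R).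
Local Notation LM := {linear M -> M}.
Local Notation ser := ((nat -> LM) -> (nat -> nat) -> M).
Local Notation edgeop := (@edgeop F R M).
Local Notation cw := (@cw F R M).
Local Notation bsum := (@bsum F R M).
Implicit Types (h k l : nat).

Definition lw k (la : 'I_k -> nat) := [seq la i | i <- enum 'I_k].
Definition lser k (la : 'I_k -> nat) (phi : mseries M k) al : M := phi (fun i => al (la i)).

Lemma size_lw k (la : 'I_k -> nat) : size (lw la) = k.
Proof. by rewrite size_map size_enum_ord. Qed.

Lemma mem_lw k (la : 'I_k -> nat) i : la i \in lw la.
Proof. by rewrite map_f ?mem_enum. Qed.

Lemma lw_inj k (la : 'I_k -> nat) : uniq (lw la) -> injective la.
Proof.
move=> u i j ij; have n p : nth 0%N (lw la) (nat_of_ord p) = la p.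
  by rewrite (nth_map p) ?size_enum_ord // nth_ord_enum.
by move/eqP: ij; rewrite -!n nth_uniq ?size_lw // => /eqP/val_inj.
Qed.

Lemma lser_wloc k (la : 'I_k -> nat) phi : wloc (lw la) (lser la phi).
Proof.
move=> al be ab; rewrite /lser; congr (mseries_val phi _); apply: funext => i.
exact/ab/mem_lw.
Qed.

Lemma lser_inv k (la : 'I_k -> nat) phi : uniq (lw la) ->
  forall al, \sum_(p <- lw la) der p (lser la phi) al = lm_d M (lser la phi al).
Proof.
move=> u al; rewrite big_map big_enum /= -mseriesP ftotalE; apply: eq_bigr => i _.
by rewrite (der_lab i (lw_inj u) (phi := phi)).
Qed.

Lemma good_lab k (la : 'I_k -> nat) phi t : uniq (lw la) ->
  good (lw la) [:: t] (primS t (lser la phi)).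
Proof. by move=> u; apply: good_primS; [apply: lser_wloc|apply: lser_inv]. Qed.

Lemma chain_lab k (a : 'I_k -> R) (phi : mseries M k) (la : 'I_k -> nat) (a' : nat -> R) t :
  uniq (lw la) -> (forall i, a' (la i) = a i) ->
  chain a phi = cw (lw la) a' (primS t (lser la phi)).
Proof. by move=> u aE; apply: chain_chw => //; apply: lw_inj. Qed.

Definition joinl h l (la : 'I_h -> nat) (lb : 'I_l -> nat) (p : 'I_(h + l)) :=
  match fintype.split p with inl i => la i | inr j => lb j end.

Lemma joinl_l h l (la : 'I_h -> nat) (lb : 'I_l -> nat) i : joinl la lb (lshift l i) = la i.
Proof. by rewrite /joinl; case: split_ordP => j /eqP; rewrite ?eq_lshift ?eq_lrshift // => /eqP->. Qed.

Lemma joinl_r h l (la : 'I_h -> nat) (lb : 'I_l -> nat) j : joinl la lb (rshift h j) = lb j.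
Proof. by rewrite /joinl; case: split_ordP => i /eqP; rewrite ?eq_rshift ?eq_rlshift // => /eqP->. Qed.

Section TwoChains.
Variables (h l : nat) (a : 'I_h -> R) (phi : mseries M h) (b : 'I_l -> R) (psi : mseries M l).
Variables (la : 'I_h -> nat) (lb : 'I_l -> nat) (a' : nat -> R) (x y : nat).
Hypotheses (ulab : uniq (lw la ++ lw lb)) (aE : forall i, a' (la i) = a i)
  (bE : forall j, a' (lb j) = b j).
Let G := primS x (lser la phi).
Let H := primS y (lser lb psi).

Let lab_inj : injective (joinl la lb).
Proof.
have [ua ub lab] := uniq_catP ulab.
move=> p q; case: (split_ordP p) => i ->; case: (split_ordP q) => j ->;
  rewrite ?joinl_l ?joinl_r => E.
- by rewrite (lw_inj ua E).
- by move: (lab _ (mem_lw la i)); rewrite E mem_lw.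
- by move: (lab _ (mem_lw la j)); rewrite -E mem_lw.
- by rewrite (lw_inj ub E).
Qed.

Let labE p : a' (joinl la lb p) = catf a b p.
Proof. by rewrite /joinl /catf; case: (fintype.split p). Qed.

Let lE : [seq joinl la lb (lshift l i) | i <- enum 'I_h] = lw la.
Proof. by apply: eq_map => i; rewrite joinl_l. Qed.

Let rE : [seq joinl la lb (rshift h j) | j <- enum 'I_l] = lw lb.
Proof. by apply: eq_map => j; rewrite joinl_r. Qed.

Let fE al : lser la phi al = phi (fun i => al (joinl la lb (lshift l i))).
Proof. by congr (mseries_val phi _); apply: funext => i; rewrite joinl_l. Qed.

Let gE al : lser lb psi al = psi (fun i => al (joinl la lb (rshift h i))).
Proof. by congr (mseries_val psi _); apply: funext => i; rewrite joinl_r. Qed.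

Lemma wedge_lab : wedge_chain a phi b psi = cw (lw la ++ lw lb) a' (mulS G H).
Proof. by rewrite (wedge_chain_word lab_inj labE fE gE) lE rE. Qed.

Lemma bracket_lab : x != y -> bracket_chain a phi b psi = (-1) ^+ h.+1 *:
  bsum (lw la) [:: x] (lw lb) [:: y] (lw la ++ lw lb) a' (mulS G H).
Proof.
move=> xy; have [ua ub lab] := uniq_catP ulab.
have uxy : uniq ([:: x] ++ [:: y]) by rewrite /= inE xy.
rewrite (bracket_chain_word lab_inj labE fE gE) lE rE; congr (_ *: _).
exact: (@good_bracket_sum _ _ _ _ [:: x] _ [:: y] G H a' ulab uxy
  (good_lab _ _ ua) (good_lab _ _ ub)).
Qed.

End TwoChains.

(** Three consecutive intervals of integers serve as labels; as they are disjoint, the three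
    families of vectors combine into one. *)
Lemma labels_ex h k l (a : 'I_h -> R) (b : 'I_k -> R) (c : 'I_l -> R) :
  exists la lb lc (a' : nat -> R), [/\ uniq (lw la ++ lw lb ++ lw lc),
    forall i, a' (la i) = a i, forall j, a' (lb j) = b j & forall p, a' (lc p) = c p].
Proof.
pose sh n m (i : 'I_m) := (n + i)%N.
exists (sh 0%N h), (sh h k), (sh (h + k)%N l), (fun n =>
  if insub n is Some i then a i else if insub (n - h)%N is Some j then b j
  else if insub (n - (h + k))%N is Some p then c p else 0); split.
- have E n m : lw (sh n m) = iota n m by rewrite /lw -[in RHS](addn0 n) iotaDl -val_enum_ord -map_comp.
  by rewrite !E -!iotaD iota_uniq.
- by move=> i; rewrite /sh add0n valK.
- by move=> i; rewrite /sh insubF ?addKn ?valK // ltnNge leq_addr.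
- move=> i; rewrite /sh insubF; last by rewrite ltnNge -addnA leq_addr.
  by rewrite insubF ?addKn ?valK // -addnA addKn ltnNge leq_addr.
Qed.

Lemma labels_ex2 h k (a : 'I_h -> R) (b : 'I_k -> R) :
  exists la lb (a' : nat -> R), [/\ uniq (lw la ++ lw lb),
    forall i, a' (la i) = a i & forall j, a' (lb j) = b j].
Proof.
have [la [lb [lc [a' [u aE bE _]]]]] := labels_ex a b (fun _ : 'I_0 => 0).
by exists la, lb, a'; split=> //; move: u; rewrite catA cat_uniq => /andP[].
Qed.

Lemma wedge_chainC h l a (phi : mseries M h) b (psi : mseries M l) :
  wedge_chain a phi b psi = (-1) ^+ (h * l) *: wedge_chain b psi a phi.
Proof.
have [la [lb [a' [u aE bE]]]] := labels_ex2 a b.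
have u' : uniq (lw lb ++ lw la) by rewrite uniq_catC.
rewrite (wedge_lab phi psi 0 1 u aE bE) (wedge_lab psi phi 1 0 u' bE aE) mulSC /cw.
by have := @alt_swap F _ _ [::] (lw la) (lw lb) [::] (@chw_alt F R M a' _); rewrite /= !cats0 !size_lw => ->.
Qed.

Lemma bracket_chainC h l a (phi : mseries M h) b (psi : mseries M l) :
  bracket_chain a phi b psi = - ((-1) ^+ (h.+1 * l.+1) *: bracket_chain b psi a phi).
Proof.
have [la [lb [a' [u aE bE]]]] := labels_ex2 a b; have [ua ub lab] := uniq_catP u.
have := bsumC a' u (isT : uniq ([:: 0%N] ++ [:: 1%N])) (good_lab phi 0 ua) (good_lab psi 1 ub).
have u' : uniq (lw lb ++ lw la) by rewrite uniq_catC.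
rewrite (@bracket_lab _ _ _ phi _ psi _ _ _ 0 1 u aE bE) //.
rewrite (@bracket_lab _ _ _ psi _ phi _ _ _ 1 0 u' bE aE) // => ->.
rewrite !scalerA -scaleNr !size_lw; congr (_ *: _).
rewrite -[RHS]mulN1r -?mulrA -!exprD -exprS -signr_odd -[RHS]signr_odd; congr (_ ^+ nat_of_bool _).
by rewrite /= !oddD /= !oddM /=; case: (odd h); case: (odd l).
Qed.

End Labels.

Lemma alt_swap_pos (F : fieldType) (V : lmodType F) (K : seq nat -> V) p x m y v : alt K ->
  uniq (p ++ x :: m ++ y :: v) ->
  K (p ++ x :: m ++ y :: v) = - K (p ++ y :: m ++ x :: v).
Proof.
move=> Ka u; have := alt_swap1 (r := p) (s := x :: m) (v := v) Ka u.
rewrite /= => ->; rewrite exprS mulN1r scaleNr; congr (- _).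
have u' : uniq (p ++ y :: x :: m ++ v).
  rewrite -(perm_uniq (s1 := p ++ x :: m ++ y :: v)) // perm_cat2l.
  by have := perm_catCA (x :: m) [:: y] v; rewrite /= => E; apply: permEl.
have := alt_swap1 (r := p ++ [:: y]) (s := m) (x := x) (v := v) Ka.
rewrite -!catA /= => -> //.
rewrite -(perm_uniq (s1 := p ++ y :: x :: m ++ v)) // perm_cat2l perm_cons.
by have := perm_catCA [:: x] m v; rewrite /= => E; apply: permEl.
Qed.

Lemma perm_lw k (la : 'I_k -> nat) (s : 'S_k) : perm_eq (lw (la \o s)) (lw la).
Proof.
have -> : lw (la \o s) = map la (map s (enum 'I_k)) by rewrite -map_comp.
apply: perm_map; apply: uniq_perm; rewrite ?(map_inj_uniq perm_inj) ?enum_uniq // => i.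
by rewrite -[i](permKV s) mem_map ?mem_enum //; apply: perm_inj.
Qed.

(** The passage from interchanges of neighbours to all permutations, by a decomposition into
    transpositions; it yields the full skewsymmetry relation of chains. *)
Lemma alt_perm (F : fieldType) (V : lmodType F) (K : seq nat -> V) k (la : 'I_k -> nat) v (s : 'S_k) :
  alt K -> uniq (lw la ++ v) -> K (lw (la \o s) ++ v) = (-1 : F) ^+ s *: K (lw la ++ v).
Proof.
move=> Ka u; have [ts -> ts_d] := prod_tpermP s.
have -> : (-1 : F) ^+ (\prod_(t <- ts) tperm t.1 t.2)%g = (-1) ^+ size ts.
  elim: ts ts_d => [|[x y] ts IH] /=; first by rewrite big_nil odd_perm1.
  move=> /andP[xy tsd]; rewrite big_cons odd_permM signr_addb IH // exprS odd_tperm.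
  by rewrite (_ : x != y = true) // expr1.
elim: ts ts_d {s} => [|[x y] ts IH] /=.
  rewrite big_nil scale1r => _; congr (K (_ ++ v)); apply: eq_map => i /=.
  by rewrite perm1.
move=> /andP[/= xy tsd]; rewrite big_cons exprS mulN1r scaleNr -IH //=.
set s := (\prod_(t <- ts) _)%g; have {IH u} us : uniq (lw (la \o s) ++ v).
  by apply: etrans u; apply: perm_uniq; rewrite perm_cat2r perm_lw.
(* One transposition, for x' before y' in the enumeration; the other order follows from [tpermC]. *)
have main x' y' p1 p2 p3 : enum 'I_k = p1 ++ x' :: p2 ++ y' :: p3 ->
    K (lw (la \o (tperm x' y' * s)%g) ++ v) = - K (lw (la \o s) ++ v).
  move=> kE; have := enum_uniq 'I_k; rewrite kE => ue.
  have fixq q : x' \notin q -> y' \notin q ->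
      map (la \o (tperm x' y' * s)%g) q = map (la \o s) q.
    move=> xq yq; apply/eq_in_map => i iq /=; rewrite permM tpermD //.
      by apply: contraNneq xq => ->.
    by apply: contraNneq yq => ->.
  move: ue; rewrite cat_uniq /= mem_cat inE !negb_or cat_uniq /= !negb_or.
  case/and3P=> _ /andP[xp1 /hasPn p1e] /andP[/and3P[xp2 _ xp3] /and3P[_ /andP[yp2 _] /andP[yp3 _]]].
  have yp1 : y' \notin p1 by apply: p1e; rewrite mem_cat inE eqxx orbT.
  have E : lw (la \o (tperm x' y' * s)%g) =
      map (la \o s) p1 ++ la (s y') :: map (la \o s) p2 ++ la (s x') :: map (la \o s) p3.
    by rewrite /lw kE map_cat /= map_cat /= !fixq // !permM tpermL tpermR.
  have E' : lw (la \o s) =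
      map (la \o s) p1 ++ la (s x') :: map (la \o s) p2 ++ la (s y') :: map (la \o s) p3.
    by rewrite /lw kE map_cat /= map_cat.
  rewrite E E' -!catA /= -!catA /= [in RHS]alt_swap_pos ?opprK //.
  by move: us; rewrite E' -!catA /= -!catA.
have: x \in enum 'I_k by rewrite mem_enum.
have: y \in enum 'I_k by rewrite mem_enum.
move=> + xe; case/splitPr: xe (main) => p1 p2 {}main; rewrite mem_cat inE eq_sym (negPf xy) /=.
case/orP=> yp; last by case/splitPr: yp main => p3 p4; apply; reflexivity.
rewrite tpermC; case/splitPr: yp main => p3 p4; rewrite -catA /=; apply; reflexivity.
Qed.

Section EdgeSlots.
Variables (F : fieldType) (R : lieConformal F) (M : lcModAlgebra R).
Local Notation LM := {linear M -> M}.
Local Notation ser := ((nat -> LM) -> (nat -> nat) -> M).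
Local Notation edgeop := (@edgeop F R M).
Local Notation cw := (@cw F R M).
Implicit Types (w A B : seq nat) (a : nat -> R) (G H : ser) (e : edge).

Lemma mu_linear_op c G G1 G2 i k n U al : (forall U al, G U al = c *: G1 U al + G2 U al) ->
  subS i k (derSn i n G) U al = c *: subS i k (derSn i n G1) U al + subS i k (derSn i n G2) U al.
Proof.
move=> GE; rewrite /subS /derSn /sub scaler_sumr -big_split; apply: eq_bigr => q _.
elim: n {U}(G U) {GE}(G1 U) (G2 U) (GE U) (upd _ _ _) => [|n IHn] g g1 g2 gE be /=; first exact: gE.
by rewrite /der (IHn _ _ _ gE) mulrnDl scalerMnr.
Qed.

Lemma edge_Glinear w A a c G G1 G2 e : uniq w -> uniq A ->
  good w A G -> good w A G1 -> good w A G2 ->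
  valid w A G e -> valid w A G1 e -> valid w A G2 e ->
  (forall U al, G U al = c *: G1 U al + G2 U al) ->
  edgeop e cw w a G = c *: edgeop e cw w a G1 + edgeop e cw w a G2.
Proof.
move=> uw uA gG g1 g2; case: e => i [k|t] [/= iw] [e1 e2] [_ [_ e3]] [_ [_ e4]] GE;
  apply: scale_linear => /=.
  have ik : i != k by rewrite eq_sym.
  apply: nsum_linear; try exact: edgeop_poly.
  move=> n; rewrite /cw -chw_linear ?del_uniq //; last 2 first.
  - by apply: (@good_winv _ _ _ _ A); apply: good_opS.
  - by apply: (@good_winv _ _ _ _ A); apply: good_opS.
  by congr (chw _ _ _); apply: funext => al; apply: mu_linear_op.
rewrite /cw -chw_linear ?del_uniq //; last 2 first.
- by apply: (@good_winv _ _ _ _ A); apply: good_actS.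
- by apply: (@good_winv _ _ _ _ A); apply: good_actS.
congr (chw _ _ _); apply: funext => al; apply: nsum_linear; try exact: sfin_poly.
by move=> n; rewrite GE mulrnDl scalerMnr.
Qed.

Lemma chwN_slot w a f l (x : R) : uniq w -> l \in w ->
  chw (M := M) w (upd a l (- x)) f = - chw w (upd a l x) f.
Proof.
move=> uw lw'; have := chw_multilinear a f (-1) x 0 uw lw'.
by rewrite scaleN1r addr0 chw0_slot // addr0 scaleN1r.
Qed.

Lemma chwN w a (f : (nat -> nat) -> M) : uniq w -> winv w f ->
  chw w a (fun al => - f al) = - chw w a f.
Proof.
move=> uw fP; have := chw_linear a (-1) uw fP (@winv0 _ _ _ w).
rewrite chw0 // addr0 scaleN1r => <-; congr (chw _ _ _); apply: funext => al.
by rewrite scaleN1r addr0.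
Qed.

(** The derivation of R acts as - lambda, which shifts the order n by one; together with the factor
    n! the corresponding shift of the exponent of x_i is a derivative. *)
Lemma actS_d x i t w A G al : good w A G -> t \in A -> sfin G [:: i] t ->
  mu (actS (lc_d R x) i t G) al = - mu (actS x i t (derS i G)) al.
Proof.
move=> gG tA Gs; rewrite /mu /actS nsum_recl; last exact: sfin_poly.
have -> : G (upd (fun _ => @idL F R M) t (compL (@idL F R M) (actL M (lc_d R x) 0))) (upd al i 0%N) = 0.
  by apply: (good_zero _ _ gG tA) => m; rewrite compidL actL_d oppr0.
rewrite mul0rn add0r -nsum_opp; apply: eq_nsum => n.
rewrite (@good_lin _ _ _ _ _ _ gG t _ (-1) (actL M x n) (actL M 0 0)) // => [|m]; last first.
  by rewrite compidL actL_d actL0l scaleN1r addr0.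
rewrite [X in _ + X](@good_zero _ _ _ w A) // => [|m]; last by rewrite actL0l.
by rewrite addr0 scaleN1r mulNrn compidL /derS /der upd_eq upd_upd factS mulrnA.
Qed.

(** At the source of the edge this is the sesquilinearity of the bracket or of the action; a target
    label is made a source by [edge_flip]; at any other label it is the relation of chains. *)
Lemma edge_sesqui w A a G e l : uniq w -> uniq A -> good w A G -> valid w A G e -> l \in w ->
  edgeop e cw w (upd a l (lc_d R (a l))) G = - edgeop e cw w a (derS l G).
Proof.
move=> uw uA gG; case: e => i [k|t] [/= iw].
  move=> [kw ki] lw'; have ik : i != k by rewrite eq_sym.
  have src i' k' : i' \in w -> k' \in w -> i' != k' ->
      edgeop (i', inl k') cw w (upd a i' (lc_d R (a i'))) G = - edgeop (i', inl k') cw w a (derS i' G).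
    move=> {ki ik}iw {}kw ik; rewrite /edgeop /= -scalerN; congr (_ *: _).
    have uw' := del_uniq i' uw.
    have kw' : k' \in del i' w by rewrite mem_del kw eq_sym ik.
    rewrite upd_eq upd_neq 1?eq_sym // nsum_recl; last first.
      have [N bN] := br_poly (lc_d R (a i')) (a k'); exists N => n Nn.
      by rewrite bN // /cw chw0_slot.
    rewrite {1}br_d oppr0 {1}/cw chw0_slot // add0r -nsum_opp; apply: eq_nsum => n.
    rewrite br_d /cw chwN_slot //; congr (- _).
    apply: chw_eq => [p|al _]; last by rewrite /mu /subS /derSn /derS -iterSr.
    by rewrite mem_del => /andP[pi _]; rewrite upd_comm // upd_neq.
  have [->|il] := eqVneq l i; first exact: src.
  have [->|kl] := eqVneq l k.
    by rewrite (edge_flip _ uw ik iw kw gG) (edge_flip _ uw ik iw kw (good_derS kw gG)) src.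
  rewrite /edgeop /= -scalerN; congr (_ *: _); rewrite -nsum_opp; apply: eq_nsum => n.
  have [il' kl'] : i != l /\ k != l by rewrite ![_ == l]eq_sym.
  rewrite ![upd a l _ _]upd_neq // upd_comm //.
  set z := lc_br _ _ _; have := @chw_sesquilinear _ _ _ (del i w) (upd a k z) (mu (subS i k (derSn i n G))) l.
  rewrite upd_neq // /cw => ->; rewrite ?del_uniq ?mem_del ?il //; last first.
    by apply: (@good_winv _ _ _ _ A); apply: good_opS.
  congr (- chw _ _ _); rewrite /mu /subS der_sub_neq //; congr (sub _ _ _).
  by rewrite /derSn /derS -[der l (iter n _ _)]/(iter 1 (der l) _) iter_derC.
move=> [tA Gs] lw'; rewrite /edgeop /= -scalerN; congr (_ *: _).
have act_winv x G' : good w A G' -> sfin G' [:: i] t -> winv (del i w) (mu (actS x i t G')).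
  by move=> gG' Gs'; apply: (@good_winv _ _ _ _ A); apply: good_actS.
have [il|il] := eqVneq i l.
  rewrite -{l}il upd_eq in lw' *.
  transitivity (cw (del i w) a (actS (lc_d R (a i)) i t G)).
    by apply: cw_eq => p; rewrite mem_del => /andP[pi _]; rewrite upd_neq.
  have gd := good_derS iw gG.
  have Gds : sfin (derS i G) [:: i] t.
    move=> x al; have [N GN] := Gs x al; exists N => n be U Nn albe.
    rewrite /derS /der GN ?mul0rn // => l'; rewrite inE => l'i.
    by rewrite upd_neq // albe // inE.
  rewrite -[RHS]chwN ?del_uniq //; last exact: act_winv.
  by congr (chw _ _ _); apply: funext => al; apply: actS_d gG tA Gs.
rewrite upd_neq // /cw chw_sesquilinear ?del_uniq ?mem_del ?(eq_sym l) ?il //; last exact: act_winv.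
congr (- chw _ _ _).
by rewrite -derS_actS // eq_sym.
Qed.

End EdgeSlots.

Section ChainRel.
Variables (F : fieldType) (R : lieConformal F) (M : lcModAlgebra R).
Local Notation LM := {linear M -> M}.
Local Notation ser := ((nat -> LM) -> (nat -> nat) -> M).
Local Notation edgeop := (@edgeop F R M).
Local Notation cw := (@cw F R M).
Local Notation bsum := (@bsum F R M).
Implicit Types (s t w A B : seq nat) (G H : ser) (e : edge).

(** The defining relations of chains, imposed on a function of generators; by [chain_univ] they are
    enough to extend it linearly. *)
Definition chain_rel (W : lmodType F) (f : forall k, ('I_k -> R) -> mseries M k -> W) :=
  [/\ forall k (a : 'I_k -> R) phi i c u v, f k [eta a with i |-> c *: u + v] phi =
        c *: f k [eta a with i |-> u] phi + f k [eta a with i |-> v] phi,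
      forall k a, linear (f k a),
      forall k (a : 'I_k -> R) phi i,
        f k [eta a with i |-> lc_d R (a i)] phi = - f k a (mderiv i phi)
    & forall k (a : 'I_k -> R) phi (s : 'S_k),
        f k (fun i => a ((s^-1)%g i)) (mperm s phi) = (-1) ^+ s *: f k a phi].

Lemma chain_relZ (W : lmodType F) (eps : nat -> F) (f : forall k, ('I_k -> R) -> mseries M k -> W) :
  chain_rel f -> chain_rel (fun k a phi => eps k *: f k a phi).
Proof.
move=> [f1 f2 f3 f4]; split=> [k a phi i c u v|k a c phi psi|k a phi i|k a phi s].
- by apply: scale_linear; apply: f1.
- by apply: scale_linear; apply: f2.
- by rewrite f3 scalerN.
- by rewrite f4 !scalerA mulrC.
Qed.

Section WordOperation.
Variables (op : seq nat -> seq nat -> seq nat -> (nat -> R) -> ser -> chain_space M).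
Variables (l : nat) (b : 'I_l -> R) (psi : mseries M l).
Variable f : forall k, ('I_k -> R) -> mseries M k -> chain_space M.
Hypothesis fE : forall h a phi (la : 'I_h -> nat) (lb : 'I_l -> nat) a',
  uniq (lw la ++ lw lb) -> (forall i, a' (la i) = a i) -> (forall j, a' (lb j) = b j) ->
  f a phi = op (lw la) (lw lb) (lw la ++ lw lb) a'
    (mulS (primS 0%N (lser la phi)) (primS 1%N (lser lb psi))).
Hypothesis op_perm : forall s s' t w a G, perm_eq s s' -> op s t w a G = op s' t w a G.
Hypothesis op_alt : forall s t a G, alt (fun w => op s t w a G).
Hypothesis op_slot : forall s t a G H p c x y, uniq (s ++ t) -> good s [:: 0%N] G ->
  good t [:: 1%N] H -> p \in s -> op s t (s ++ t) (upd a p (c *: x + y)) (mulS G H) =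
  c *: op s t (s ++ t) (upd a p x) (mulS G H) + op s t (s ++ t) (upd a p y) (mulS G H).
Hypothesis op_lin : forall s t a G G1 G2 H c, uniq (s ++ t) -> good s [:: 0%N] G ->
  good s [:: 0%N] G1 -> good s [:: 0%N] G2 -> good t [:: 1%N] H ->
  (forall U al, G U al = c *: G1 U al + G2 U al) -> op s t (s ++ t) a (mulS G H) =
  c *: op s t (s ++ t) a (mulS G1 H) + op s t (s ++ t) a (mulS G2 H).
Hypothesis op_sesqui : forall s t a G H p, uniq (s ++ t) -> good s [:: 0%N] G ->
  good t [:: 1%N] H -> p \in s -> op s t (s ++ t) (upd a p (lc_d R (a p))) (mulS G H) =
  - op s t (s ++ t) a (mulS (derS p G) H).

Let updE h (la : 'I_h -> nat) (a : 'I_h -> R) a' i z : uniq (lw la) -> (forall i, a' (la i) = a i) ->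
  forall j, upd a' (la i) z (la j) = [eta a with i |-> z] j.
Proof.
move=> ua aE j /=; have [->|ji] := eqVneq j i; first by rewrite upd_eq.
by rewrite upd_neq ?aE // (inj_eq (lw_inj ua)).
Qed.

Let updE' h (la : 'I_h -> nat) (lb : 'I_l -> nat) (a' : nat -> R) i z :
  uniq (lw la ++ lw lb) -> (forall j, a' (lb j) = b j) ->
  forall j, upd a' (la i) z (lb j) = b j.
Proof.
move=> /uniq_catP[_ _ lab] bE j; rewrite upd_neq ?bE //.
by apply: contraTneq (mem_lw lb j) => ->; apply/lab/mem_lw.
Qed.

(** A common treatment of product and bracket. A relation in the first argument is a property of
    [op] under one labelling, except for skewsymmetry, which compares two labellings. *)
Lemma word_chain_rel : chain_rel f.
Proof.
split=> [h a phi i c x y|h a c phi phi'|h a phi i|h a phi s].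
all: have [la [lb [a' [u aE bE]]]] := labels_ex2 a b.
all: have [ua ub lab] := uniq_catP u.
- rewrite !(fE _ u (updE _ _ ua aE) (updE' _ _ u bE)).
  by apply: op_slot; rewrite ?mem_lw //; apply: good_lab.
- rewrite !(fE _ u aE bE); apply: op_lin; try exact: good_lab; first exact: u.
  by move=> U al; rewrite /primS /lser linearP.
- rewrite (fE _ u (updE _ _ ua aE) (updE' _ _ u bE)) (fE _ u aE bE) -aE.
  rewrite op_sesqui ?mem_lw //; try exact: good_lab.
  congr (- op _ _ _ _ (mulS _ _)); apply: funext => U; apply: funext => al.
  rewrite /derS /primS {1}/der -raddfMn; congr (U _ _).
  by rewrite -[LHS]/(der (la i) (lser la phi) al) (der_lab i (lw_inj ua) (phi := phi)).
(* The permuted chain is the original one read along the labelling composed with the inverse of s.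
   As [op] sees s only up to order and is alternating in the full word, the sign of the permutation
   results. *)
have uS : uniq (lw (la \o (s^-1)%g) ++ lw lb).
  by apply: etrans u; apply: perm_uniq; rewrite perm_cat2r perm_lw.
rewrite (fE _ uS _ bE) => [|i]; last exact: aE.
rewrite (fE _ u aE bE) (op_perm _ _ _ _ (perm_lw la _)) -(odd_permV s).
rewrite -(@alt_perm F _ (fun w => op (lw la) (lw lb) w a' _)) //.
congr (op _ _ _ _ (mulS (primS 0 _) _)); apply: funext => al.
by rewrite /lser; congr (mseries_val phi _); apply: funext => p /=; rewrite permK.
Qed.

End WordOperation.

Lemma derS_mulSl p t B G H : good t B H -> p \notin t ->
  derS p (mulS G H) = mulS (derS p G) H.
Proof.
move=> gH pt; apply: funext => U; apply: funext => al.
by rewrite /derS /mulS /der mulMnl (good_updL _ _ _ gH).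
Qed.

Lemma wedge_chain_rell l (b : 'I_l -> R) (psi : mseries M l) :
  chain_rel (fun h a phi => @wedge_chain F R M h l a phi b psi).
Proof.
apply: (@word_chain_rel (fun _ _ => cw) l b psi).
- by move=> h a phi la lb a' u aE bE; rewrite (wedge_lab phi psi 0 1 u aE bE).
- by [].
- by move=> s t a G; apply: chw_alt.
- by move=> s t a G H p c x y u _ _ ps; rewrite /cw chw_multilinear // mem_cat ps.
- move=> s t a G G1 G2 H c u gG g1 g2 gH GE; have [us ut st] := uniq_catP u.
  have AB x : x \in [:: 0%N] -> x \notin [:: 1%N] by rewrite !inE => /eqP->.
  rewrite /cw -chw_linear //; last 2 first.
  + exact: (good_winv (good_mulS st AB g1 gH)).
  + exact: (good_winv (good_mulS st AB g2 gH)).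
  congr (chw _ _ _); apply: funext => al; rewrite /mu /mulS GE.
  exact: la_mul_linl.
move=> s t a G H p u gG gH ps; have [us ut st] := uniq_catP u.
have AB x : x \in [:: 0%N] -> x \notin [:: 1%N] by rewrite !inE => /eqP->.
rewrite /cw chw_sesquilinear ?mem_cat ?ps //; last exact: (good_winv (good_mulS st AB gG gH)).
congr (- chw _ _ _); apply: funext => al.
rewrite -[LHS]/(derS p (mulS G H) _ al) (derS_mulSl _ gH) //; exact: st.
Qed.

Lemma bracket_chain_rell l (b : 'I_l -> R) (psi : mseries M l) :
  chain_rel (fun h a phi => @bracket_chain F R M h l a phi b psi).
Proof.
have uAB : uniq ([:: 0%N] ++ [:: 1%N]) by [].
pose op s t w a G := (-1 : F) ^+ (size s).+1 *: bsum s [:: 0%N] t [:: 1%N] w a G.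
apply: (@word_chain_rel op l b psi); rewrite /op.
- by move=> h a phi la lb a' u aE bE; rewrite (@bracket_lab F R M h l a phi b psi la lb a' 0 1 u aE bE isT) size_lw.
- move=> s s' t w a G ss'; rewrite (perm_size ss'); congr (_ *: _).
  by rewrite /bsum !edges_sum (perm_big _ ss').
- by move=> s t a G u x y v uxy; rewrite alt_bsum // scalerN.
- move=> s t a G H p c x y u gG gH ps; apply: scale_linear.
  have [us ut st] := uniq_catP u.
  rewrite /bsum scaler_sumr -big_split /=; apply: eq_big_seq => e eE.
  apply: (@cw_edge_linear _ _ _ _ ([:: 0%N] ++ [:: 1%N])); rewrite ?mem_cat ?ps //.
    by apply: good_mulS => // q; rewrite !inE => /eqP->.
  exact: valid_edges eE.
- move=> s t a G G1 G2 H c u gG g1 g2 gH GE; apply: scale_linear.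
  have [us ut st] := uniq_catP u.
  have AB x : x \in [:: 0%N] -> x \notin [:: 1%N] by rewrite !inE => /eqP->.
  rewrite /bsum scaler_sumr -big_split /=; apply: eq_big_seq => e eE.
  apply: (@edge_Glinear _ _ _ _ ([:: 0%N] ++ [:: 1%N])) => //; try exact: good_mulS; try exact: valid_edges eE.
  by move=> U al; rewrite /mulS GE; apply: la_mul_linl.
move=> s t a G H p u gG gH ps; have [us ut st] := uniq_catP u.
rewrite -scalerN; congr (_ *: _).
rewrite /bsum -sumrN; apply: eq_big_seq => e eE; rewrite -(derS_mulSl _ gH) ?st //.
apply: (@edge_sesqui _ _ _ _ ([:: 0%N] ++ [:: 1%N])); rewrite ?mem_cat ?ps //.
  by apply: good_mulS => // q; rewrite !inE => /eqP->.
exact: valid_edges eE.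
Qed.

Lemma wedge_chain_relr h (a : 'I_h -> R) (phi : mseries M h) :
  chain_rel (fun l b psi => @wedge_chain F R M h l a phi b psi).
Proof.
have [f1 f2 f3 f4] := chain_relZ (fun l => (-1) ^+ (h * l)) (wedge_chain_rell a phi).
split=> [l b psi i c u v|l b c psi psi'|l b psi i|l b psi s]; rewrite ![wedge_chain a phi _ _]wedge_chainC.
- exact: f1.
- exact: f2.
- exact: f3.
- exact: f4.
Qed.

Lemma bracket_chain_relr h (a : 'I_h -> R) (phi : mseries M h) :
  chain_rel (fun l b psi => @bracket_chain F R M h l a phi b psi).
Proof.
have [f1 f2 f3 f4] := chain_relZ (fun l => - (-1) ^+ (h.+1 * l.+1)) (bracket_chain_rell a phi).
split=> [l b psi i c u v|l b c psi psi'|l b psi i|l b psi s];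
  rewrite ![bracket_chain a phi _ _]bracket_chainC -!scaleNr.
- exact: f1.
- exact: f2.
- by rewrite [RHS]scaleNr; apply: f3.
- exact: f4.
Qed.

End ChainRel.

(** * Maps out of the space of chains *)

Section DirectSumMaps.
Variables (F : fieldType) (I : choiceType) (V : I -> lmodType F).
Implicit Types (u v : dsum V).

Definition dsupp u : seq I := finmap.enum_fset (fset_set [set i | u i != 0]%classic).

Lemma mem_dsupp u i : (i \in dsupp u) = (u i != 0).
Proof.
have -> : (i \in dsupp u) = (i \in [set i | u i != 0]%classic).
  exact: (in_fset_set (dsum_finite u)).
by apply/idP/idP; rewrite inE.
Qed.

Lemma dsupp_uniq u : uniq (dsupp u).
Proof. exact: finmap.fset_uniq. Qed.

Lemma dsum_eval (J : Type) (r : seq J) (f : J -> dsum V) i :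
  (\sum_(j <- r) f j) i = \sum_(j <- r) f j i.
Proof. exact: (big_morph (fun u : dsum V => u i)). Qed.

Lemma dsinj_eq i (v : V i) : dsinj v i = v.
Proof. by rewrite /= dfwith_in. Qed.

Lemma dsinj_neq i (v : V i) j : i != j -> dsinj v j = 0.
Proof. by move=> ij; rewrite /= dfwith_out. Qed.

Lemma dsum_sum u : u = \sum_(i <- dsupp u) dsinj (u i).
Proof.
apply: dsumP => j; rewrite dsum_eval.
have [ju|ju] := boolP (j \in dsupp u).
  rewrite (bigD1_seq j) ?dsupp_uniq // dsinj_eq big1 => [|i ij].
    exact/esym/addr0.
  exact: dsinj_neq.
rewrite big1_seq => [|i /andP[_ iu]]; last by rewrite dsinj_neq //; apply: contraNneq ju => <-.
by apply/eqP; rewrite mem_dsupp negbK in ju.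
Qed.

Section Lift.
Variables (W : lmodType F) (g : forall i, V i -> W).
Hypothesis g_lin : forall i, linear (@g i).

Lemma dsum_lift_g0 i : @g i 0 = 0.
Proof. by have := @g_lin i (-1) 0 0; rewrite scaler0 addr0 scaleN1r addNr. Qed.

Definition dsum_lift u : W := \sum_(i <- dsupp u) @g i (u i).

(** Any list containing the support may be used, so elements with different supports can be added
    over a common list. *)
Lemma dsum_liftE u (r : seq I) : uniq r -> {subset dsupp u <= r} ->
  dsum_lift u = \sum_(i <- r) @g i (u i).
Proof.
move=> ur sr; rewrite (bigID [in dsupp u]) /= [X in _ + X]big1 ?addr0.
  rewrite -big_filter; apply: perm_big; apply: uniq_perm; rewrite ?dsupp_uniq ?filter_uniq // => i.
  by rewrite mem_filter; case: (boolP (i \in dsupp u)) => // /sr.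
by move=> i; rewrite mem_dsupp negbK => /eqP->; apply: dsum_lift_g0.
Qed.

Lemma dsum_lift_linear : linear dsum_lift.
Proof.
move=> c u v; set r := undup (dsupp u ++ dsupp v).
have ur : uniq r by apply: undup_uniq.
rewrite (@dsum_liftE u r) // => [|i iu]; last by rewrite mem_undup mem_cat iu.
rewrite (@dsum_liftE v r) // => [|i iv]; last by rewrite mem_undup mem_cat iv orbT.
rewrite (@dsum_liftE _ r) // => [|i].
  by rewrite scaler_sumr -big_split; apply: eq_bigr => i _; apply: g_lin.
rewrite mem_undup mem_cat !mem_dsupp -negb_and; apply: contra => /andP[/eqP ui /eqP vi].
by rewrite -[X in X == 0]/(c *: u i + v i) ui vi scaler0 addr0.
Qed.

Lemma dsum_lift_inj i (v : V i) : dsum_lift (dsinj v) = @g i v.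
Proof.
rewrite (@dsum_liftE _ [:: i]) // => [|j]; first by rewrite big_seq1 dsinj_eq.
by rewrite mem_dsupp inE [j == i]eq_sym; apply: contraNT => ij; rewrite dsinj_neq.
Qed.
End Lift.
End DirectSumMaps.

Section QuotientMaps.
Variables (F : fieldType) (V W : lmodType F) (S : set V) (g : V -> W).
Hypotheses (g_lin : linear g) (gS : forall x, S x -> g x = 0).

Let g0 : g 0 = 0.
Proof. by have := g_lin (-1) 0 0; rewrite scaler0 addr0 scaleN1r addNr. Qed.

Definition quot_lift (x : quotmod S) : W := g (generic_quotient.repr x).

Lemma quot_lift_pi x : quot_lift (qpi S x) = g x.
Proof.
have : x - generic_quotient.repr (qpi S x) \in in_span S.
  by apply/qpiP; rewrite /qpi generic_quotient.reprK.
(* The kernel of g is a submodule containing S, hence it contains the whole span. *)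
move=> /asboolP/(_ [pred y | g y == 0]) xS; apply/esym.
have /eqP : x - generic_quotient.repr (qpi S x) \in [pred y | g y == 0].
  apply: xS => [|y /gS /eqP //]; split=> [|c y z]; rewrite !inE ?g0 //.
  by move=> /eqP y0 /eqP z0; rewrite g_lin y0 z0 scaler0 addr0.
rewrite addrC -scaleN1r g_lin scaleN1r => /eqP; rewrite addrC subr_eq0 => /eqP->; by [].
Qed.

Lemma quot_lift_linear : linear quot_lift.
Proof.
move=> c x y; have [x' ->] := qpi_surj x; have [y' ->] := qpi_surj y.
by rewrite -linearP !quot_lift_pi g_lin.
Qed.
End QuotientMaps.

Section Universal.
Variables (F : fieldType) (R : lieConformal F) (M : lcModAlgebra R).
Local Notation C := (@chain_space F R M).

(** The map is built along the construction of chains: on the free vector space, through the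
    multilinearity relations, through the two relations of chains, and finally on the direct sum
    over k. *)
Lemma chain_univ (W : lmodType F) (f : forall k, ('I_k -> R) -> mseries M k -> W) :
  chain_rel f -> exists Phi : C -> W, linear Phi /\
    forall k (a : 'I_k -> R) phi, Phi (chain a phi) = f k a phi.
Proof.
move=> [f1 f2 f3 f4].
pose g0 k := @dsum_lift F _ (fun _ : ('I_k -> R) * mseries M k => F^o : lmodType F) W
  (fun p c => c *: f k p.1 p.2).
have g0_lin k : linear (@g0 k).
  by apply: dsum_lift_linear => p c x y; rewrite scalerDl scalerA.
have g0E k a phi : @g0 k (pregen a phi) = f k a phi.
  rewrite /g0 dsum_lift_inj ?scale1r // => p c x y.
  by rewrite scalerDl scalerA.
have g0B k x y : @g0 k (x - y) = @g0 k x - @g0 k y.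
  by have := g0_lin k (-1) y x; rewrite !scaleN1r [- y + x]addrC => ->; apply: addrC.
pose g1 k := @quot_lift F _ W (@multilinear_rel F R M k) (@g0 k).
have g1S k x : @multilinear_rel F R M k x -> g0 k x = 0.
  case=> [[a [phi [i [c [u [v ->]]]]]]|[a [phi [psi [c ->]]]]]; rewrite g0B g0_lin !g0E.
    by rewrite f1 subrr.
  by rewrite f2 subrr.
have g1_lin k : linear (g1 k) by exact: (quot_lift_linear (@g0_lin k) (@g1S k)).
have g1E k a phi : g1 k (ptensor a phi) = f k a phi.
  by rewrite /g1 (quot_lift_pi (@g0_lin k) (@g1S k)) g0E.
pose g2 k := @quot_lift F _ W (@sesquilinear_rel F R M k `|` @skewsymmetric_rel F R M k)%classic (g1 k).
have g2S k x : (@sesquilinear_rel F R M k `|` @skewsymmetric_rel F R M k)%classic x -> g1 k x = 0.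
  case=> [[a [phi [i ->]]]|[a [phi [s ->]]]].
    by rewrite -[X in X + _]scale1r g1_lin scale1r !g1E f3 addNr.
  by rewrite addrC -scaleNr g1_lin !g1E f4 scaleNr addNr.
have g2_lin k : linear (g2 k) by exact: (quot_lift_linear (@g1_lin k) (@g2S k)).
exists (dsum_lift (V := @chains F R M) (W := W) g2); split; first exact: dsum_lift_linear.
move=> k a phi; rewrite /chain (dsum_lift_inj g2_lin) /g2 (quot_lift_pi (@g1_lin k) (@g2S k)); apply: g1E.
Qed.

(** The predicate [cond] on degrees makes the principle usable for elements of fixed parity, of
    fixed degree and, with [predT], for all chains. *)
Lemma chain_ind (P : C -> Prop) (cond : pred nat) :
  P 0 -> (forall c x y, P x -> P y -> P (c *: x + y)) ->
  (forall k (a : 'I_k -> R) phi, cond k -> P (chain a phi)) ->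
  forall x : C, (forall m, ~~ cond m -> x m = 0) -> P x.
Proof.
move=> P0 PL PC x xc; rewrite (dsum_sum x).
have : all cond (dsupp x).
  by apply/allP => m; rewrite mem_dsupp; apply: contraNT => /xc->.
elim: (dsupp x) => [|k r IHr] /=; first by rewrite big_nil.
move=> /andP[ck cr]; rewrite big_cons -[X in X + _]scale1r; apply: (PL); last exact: IHr.
have [t ->] := qpi_surj (x k); have [p ->] := qpi_surj t; rewrite (dsum_sum p).
elim: (dsupp p) => [|g q IHq].
  rewrite big_nil (_ : dsinj _ = 0) //; apply: dsumP => j /=.
  by case: dfwithP => // ; rewrite !linear0.
have E : dsinj (V := fun _ : ('I_k -> R) * mseries M k => F^o : lmodType F) (i := g) (p g) =
    (p g : F) *: (pregen g.1 g.2 : dsum (fun _ : ('I_k -> R) * mseries M k => F^o : lmodType F)).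
  case: g => a phi; rewrite /pregen -[RHS]dsinjZ /=.
  by have -> : (p (a, phi) : F) *: (1 : F^o) = p (a, phi) by apply: mulr1.
rewrite big_cons E !linearP dsinj_linear; apply: (PL) => //.
exact: PC.
Qed.

End Universal.

Section LinearMaps.
Variables (F : fieldType) (U V W : lmodType F).

Lemma lin_add (f g : U -> V) : linear f -> linear g -> linear (fun x => f x + g x).
Proof. by move=> fL gL c x y; rewrite fL gL scalerDr addrACA. Qed.

Lemma lin_scale d (f : U -> V) : linear f -> linear (fun x => d *: f x).
Proof. by move=> fL c x y; rewrite fL scalerDr !scalerA mulrC. Qed.

Lemma lin_comp (f : U -> V) (g : V -> W) : linear f -> linear g -> linear (fun x => g (f x)).
Proof. by move=> fL gL c x y; rewrite fL gL. Qed.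

End LinearMaps.

Section Extension.
Variables (F : fieldType) (R : lieConformal F) (M : lcModAlgebra R).
Local Notation C := (@chain_space F R M).

Lemma lin_chain_eq (W : lmodType F) (f g : C -> W) (cond : pred nat) : linear f -> linear g ->
  (forall k (a : 'I_k -> R) phi, cond k -> f (chain a phi) = g (chain a phi)) ->
  forall x : C, (forall m, ~~ cond m -> x m = 0) -> f x = g x.
Proof.
move=> fL gL fg; apply: chain_ind => //.
  by rewrite -[0](addNr 0) -scaleN1r fL gL !scaleN1r !addNr.
by move=> c x y fx fy; rewrite fL gL fx fy.
Qed.

Lemma bil_chain_eq (f g : C -> C -> C) (c1 c2 : pred nat) : bilinear_op f -> bilinear_op g ->
  (forall h l (a : 'I_h -> R) phi (b : 'I_l -> R) psi, c1 h -> c2 l ->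
     f (chain a phi) (chain b psi) = g (chain a phi) (chain b psi)) ->
  forall x y : C, (forall m, ~~ c1 m -> x m = 0) -> (forall m, ~~ c2 m -> y m = 0) -> f x y = g x y.
Proof.
move=> [f1 f2] [g1 g2] fg x y xc yc; move: x xc.
apply: lin_chain_eq => // h a phi ch; move: y yc; apply: lin_chain_eq => // l b psi cl.
exact: fg.
Qed.

Definition trilinear (f : C -> C -> C -> C) :=
  [/\ forall y z, linear (fun x => f x y z), forall x z, linear (fun y => f x y z)
    & forall x y, linear (f x y)].

(** The third argument carries no condition because the signs in the Jacobi and Leibniz identities
    involve only the parities of the first two. *)
Lemma tri_chain_eq (f g : C -> C -> C -> C) (c1 c2 : pred nat) : trilinear f -> trilinear g ->
  (forall h k l (a : 'I_h -> R) phi (b : 'I_k -> R) psi (c : 'I_l -> R) theta, c1 h -> c2 k ->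
     f (chain a phi) (chain b psi) (chain c theta) = g (chain a phi) (chain b psi) (chain c theta)) ->
  forall x y z : C, (forall m, ~~ c1 m -> x m = 0) -> (forall m, ~~ c2 m -> y m = 0) ->
    f x y z = g x y z.
Proof.
move=> [f1 f2 f3] [g1 g2 g3] fg x y z xc yc; move: x xc.
apply: lin_chain_eq => // h a phi ch; move: y yc.
apply: lin_chain_eq => // k b psi ck; apply: (@lin_chain_eq _ _ _ predT) => // l c theta _.
exact: fg.
Qed.

(** Extension in the second argument first, for each generator of the first; the resulting linear
    maps satisfy the relations of chains because they agree on generators. *)
Lemma chain_univ2 (f : forall h l, ('I_h -> R) -> mseries M h -> ('I_l -> R) -> mseries M l -> C) :
  (forall h a phi, chain_rel (fun l b psi => f h l a phi b psi)) ->
  (forall l b psi, chain_rel (fun h a phi => f h l a phi b psi)) ->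
  exists B : C -> C -> C, bilinear_op B /\
    forall h l (a : 'I_h -> R) phi (b : 'I_l -> R) psi,
      B (chain a phi) (chain b psi) = f h l a phi b psi.
Proof.
move=> fr fl.
have ex (p : {h : nat & (('I_h -> R) * mseries M h)%type}) : exists Phi : C -> C, linear Phi /\
    forall l (b : 'I_l -> R) psi, Phi (chain b psi) = f _ l (tagged p).1 (tagged p).2 b psi.
  exact: chain_univ (fr _ _ _).
have /boolp.choice[g gP] := ex.
pose g' h (a : 'I_h -> R) (phi : mseries M h) : (C -> C) :=
  g (existT (fun h => (('I_h -> R) * mseries M h)%type) h (a, phi)).
have g'_lin h a phi : linear (@g' h a phi) by case: (gP (existT _ h (a, phi))).
have g'E h a phi l b psi : @g' h a phi (@chain F R M l b psi) = f h l a phi b psi.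
  exact: (proj2 (gP (existT _ h (a, phi))) l b psi).
have lineq (p q : C -> C) : linear p -> linear q ->
    (forall l (b : 'I_l -> R) psi, p (chain b psi) = q (chain b psi)) -> p = q.
  by move=> pL qL pq; apply: funext => x; apply: (@lin_chain_eq _ p q predT).
(* The target is the space of all functions from C to C with pointwise operations; linearity of the
   values of Psi is recovered afterwards by [chain_ind]. *)
have [|Psi [Psi_lin PsiE]] := @chain_univ F R M (C -> C)%type g'.
  split=> [h a phi i c u v|h a c phi psi|h a phi i|h a phi s].
  - apply: lineq => // [|l b psi]; first exact: lin_add (lin_scale _ _) _.
    by rewrite [RHS]/(c *: g' _ _ _ _ + g' _ _ _ _) !g'E; case: (fl l b psi) => ->.
  - apply: lineq => // [|l b psi']; first exact: lin_add (lin_scale _ _) _.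
    by rewrite [RHS]/(c *: g' _ _ _ _ + g' _ _ _ _) !g'E; case: (fl l b psi') => _ ->.
  - apply: lineq => // [|l b psi'].
      move=> c u v; rewrite -[LHS]/(- g' _ _ _ _) g'_lin opprD -scalerN; by [].
    by rewrite [RHS]/(- g' _ _ _ _) !g'E; case: (fl l b psi') => _ _ ->.
  - apply: lineq => // [|l b psi']; first exact: lin_scale.
    by rewrite [RHS]/(_ *: g' _ _ _ _) !g'E; case: (fl l b psi') => _ _ _ ->.
exists Psi; split; last by move=> h l a phi b psi; rewrite PsiE.
split=> [y c x z|]; first by rewrite Psi_lin.
move=> x; apply: (@chain_ind _ _ _ (fun x => linear (Psi x)) predT) => //.
- have -> : Psi 0 = 0 by rewrite -[0](addNr 0) -scaleN1r Psi_lin scaleN1r addNr.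
  by move=> c u v; rewrite -[RHS]/(c *: 0 + 0) scaler0 addr0.
- by move=> c u v uL vL; rewrite Psi_lin; apply: lin_add (lin_scale _ _) _.
by move=> k a phi _; rewrite PsiE.
Qed.

Lemma bil_chain_uniq (f g : C -> C -> C) : bilinear_op f -> bilinear_op g ->
  (forall h l (a : 'I_h -> R) phi (b : 'I_l -> R) psi,
     f (chain a phi) (chain b psi) = g (chain a phi) (chain b psi)) -> f = g.
Proof.
move=> fB gB fg; apply: funext => x; apply: funext => y.
exact: (@bil_chain_eq f g predT predT).
Qed.

Lemma wedge_exists : exists! w, @is_wedge F R M w.
Proof.
have [w wP] := chain_univ2 (@wedge_chain_relr F R M) (@wedge_chain_rell F R M).
exists w; split=> // w' [w'B w'E]; apply: bil_chain_uniq => //; first by case: wP.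
by move=> h l a phi b psi; rewrite w'E wP.2.
Qed.

Lemma bracket_exists : exists! br, @is_bracket F R M br.
Proof.
have [w wP] := chain_univ2 (@bracket_chain_relr F R M) (@bracket_chain_rell F R M).
exists w; split=> // w' [w'B w'E]; apply: bil_chain_uniq => //; first by case: wP.
by move=> h l a phi b psi; rewrite w'E wP.2.
Qed.

End Extension.

(** * Gerstenhaber structure *)

Section Grading.
Variables (F : fieldType) (R : lieConformal F) (M : lcModAlgebra R).
Local Notation C := (@chain_space F R M).

Section Decomposition.
Variables (I : choiceType) (part : nat -> I).
(** Parity and grading are both groupings of the degrees, with [part] equal to [odd] and to the
    identity, so one decomposition result serves both. *)
Let P i : set C := [set c | forall m, part m != i -> c m = 0]%classic.

Fact component_subproof (x : C) i :
  finite_set [set m | (if part m == i then x m else 0) != 0]%classic.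
Proof.
refine (sub_finite_set _ (dsum_finite x)) => m; rewrite /mkset.
by case: (part m == i) => [|/eqP[]]; first exact.
Qed.

Definition component x i : C := DSum (component_subproof x i).

(** In degree m every f i with i other than part m vanishes. This determines the components and so
    gives the uniqueness of the decomposition. *)
Lemma component_sum (f : I -> C) m : finite_set [set i | f i != 0]%classic ->
  (forall i, P i (f i)) -> (\sum_(i \in [set: I]) f i)%classic m = f (part m) m.
Proof.
move=> fin fP; rewrite (@fsbigTE _ _ _ _ (fset_set [set i | f i != 0]%classic)) => [|i]; last first.
  move=> /negP iA; apply/eqP; apply: contra_notT iA => fi.
  by rewrite in_fset_set // inE.
set r := finmap.enum_fset _; have ur : uniq r by apply: finmap.fset_uniq.
have r0 i : i \notin r -> f i = 0.
  move=> /negP iA; apply/eqP; apply: contra_notT iA => fi.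
  have -> : (i \in r) = (i \in [set i | f i != 0]%classic) by apply: in_fset_set.
  by rewrite inE.
rewrite (dsum_eval (V := @chains F R M)).
have fi0 i : part m != i -> f i m = 0 by apply: fP.
have [mr|mr] := boolP (part m \in r).
  by rewrite (bigD1_seq (part m)) //= big1 ?addr0 // => i im; apply: fi0; rewrite eq_sym.
rewrite (r0 _ mr) big1_seq // => i /andP[_ ir]; apply: fi0.
by apply: contraNneq mr => ->.
Qed.

Lemma part_decomposition : direct_decomposition P.
Proof.
split=> [i|x].
  by split=> // c x y xP yP m mi; rewrite -[LHS]/(c *: x m + y m) xP // yP // scaler0 addr0.
have cP i : P i (component x i) by move=> m /negPf /= ->.
have fin : finite_set [set i | component x i != 0]%classic.
  apply: sub_finite_set (finite_image part (dsum_finite x)) => i /= xi.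
  apply: contrapT => Hi; case/eqP: xi; apply: dsumP => m /=; case: ifP => // /eqP mi.
  by apply/eqP/negP => /negP xm; apply: Hi; exists m.
exists (component x); split.
  split=> //; apply: dsumP => m; rewrite component_sum //= eqxx; by [].
move=> g [gP gfin xE]; apply: funext => i; apply: dsumP => m /=.
case: ifPn => [/eqP mi|mi]; last by rewrite gP.
by rewrite {1}xE component_sum // mi.
Qed.
End Decomposition.

Lemma chain_degree_chain k (a : 'I_k -> R) phi : @chain_degree F R M k (chain a phi).
Proof. by move=> m mk; rewrite /chain dsinj_neq // eq_sym. Qed.

Lemma chain_degreeD k (x y : C) :
  @chain_degree F R M k x -> @chain_degree F R M k y -> @chain_degree F R M k (x + y).
Proof. by move=> xk yk m mk; rewrite -[LHS]/(x m + y m) xk // yk // addr0. Qed.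

Lemma chain_degreeZ k c (x : C) : @chain_degree F R M k x -> @chain_degree F R M k (c *: x).
Proof. by move=> xk m mk; rewrite -[LHS]/(c *: x m) xk // scaler0. Qed.

Lemma bracket_chain_degree h l (a : 'I_h -> R) phi (b : 'I_l -> R) psi :
  @chain_degree F R M (h + l).-1 (bracket_chain a phi b psi).
Proof.
have D0 : @chain_degree F R M (h + l).-1 0 by [].
have DD := @chain_degreeD (h + l).-1.
apply: (DD); first apply: (DD).
- apply: big_ind => // i _; apply: big_ind => // j _; apply: chain_degreeZ.
  apply: big_ind => // n _; apply: chain_degree_chain.
- by apply: big_ind => // i _; apply: chain_degreeZ; apply: chain_degree_chain.
by apply: big_ind => // i _; apply: chain_degreeZ; apply: chain_degree_chain.
Qed.

(** The degree (h + l).-1 is 0 and not -1 when h = l = 0, so the vanishing of this bracket has to be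
    established separately. *)
Lemma bracket_chain00 (a b : 'I_0 -> R) phi psi : @bracket_chain F R M 0 0 a phi b psi = 0.
Proof. by rewrite /bracket_chain !big_ord0 !addr0. Qed.

Section Laws.
Variables w br : C -> C -> C.
Hypotheses (wP : is_wedge w) (brP : is_bracket br).
Let wB := wP.1.
Let brB := brP.1.

(** Formulated with predicates on degrees, so that compatibility with the parity and with the
    grading are two instances. *)
Lemma wedge_vanish (c1 c2 : pred nat) m : (forall h l, c1 h -> c2 l -> (h + l)%N != m) ->
  forall x y : C, (forall m, ~~ c1 m -> x m = 0) -> (forall m, ~~ c2 m -> y m = 0) -> w x y m = 0.
Proof.
move=> cm x y xc yc; move: x xc; apply: chain_ind.
- by rewrite (bil0l wB).
- by move=> c u v u0 v0; rewrite wB.1 -[LHS]/(c *: w u y m + w v y m) u0 v0 scaler0 addr0.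
move=> h a phi ch; move: y yc; apply: chain_ind.
- by rewrite (bil0r wB).
- by move=> c u v u0 v0; rewrite wB.2 -[LHS]/(c *: w _ u m + w _ v m) u0 v0 scaler0 addr0.
move=> l b psi cl; rewrite wP.2; apply: chain_degree_chain.
by rewrite eq_sym; apply: cm.
Qed.

(** The successor of m reflects that the bracket lowers the total degree by one. *)
Lemma bracket_vanish (c1 c2 : pred nat) m : (forall h l, c1 h -> c2 l -> (h + l)%N != m.+1) ->
  forall x y : C, (forall m, ~~ c1 m -> x m = 0) -> (forall m, ~~ c2 m -> y m = 0) -> br x y m = 0.
Proof.
move=> cm x y xc yc; move: x xc; apply: chain_ind.
- by rewrite (bil0l brB).
- by move=> c u v u0 v0; rewrite brB.1 -[LHS]/(c *: br u y m + br v y m) u0 v0 scaler0 addr0.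
move=> h a phi ch; move: y yc; apply: chain_ind.
- by rewrite (bil0r brB).
- by move=> c u v u0 v0; rewrite brB.2 -[LHS]/(c *: br _ u m + br _ v m) u0 v0 scaler0 addr0.
move=> l b psi cl; rewrite brP.2; have hl := cm _ _ ch cl.
have [/eqP|hl0] := posnP (h + l)%N.
  rewrite addn_eq0 => /andP[/eqP h0 /eqP l0]; rewrite {}h0 {}l0 in a b phi psi {ch cl hl} *.
  by rewrite bracket_chain00.
apply: bracket_chain_degree; apply: contra hl => /eqP->.
by rewrite prednK.
Qed.

Lemma wedge_assoc x y z : w x (w y z) = w (w x y) z.
Proof.
apply: (@tri_chain_eq _ _ _ (fun x y z => w x (w y z)) (fun x y z => w (w x y) z) predT predT) => //.
- split=> [y' z'|x' z'|x' y'].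
  + exact: wB.1.
  + exact: lin_comp (wB.1 z') (wB.2 x').
  + exact: lin_comp (wB.2 y') (wB.2 x').
- split=> [y' z'|x' z'|x' y'].
  + exact: lin_comp (wB.1 y') (wB.1 z').
  + exact: lin_comp (wB.2 x') (wB.1 z').
  + exact: wB.2.
move=> h k l a phi b psi c theta _ _.
have [la [lb [lc [a' [u aE bE cE]]]]] := labels_ex a b c.
have [ua ubc abc] := uniq_catP u; have [ub uc bc] := uniq_catP ubc.
have uab : uniq (lw la ++ lw lb) by move: u; rewrite catA cat_uniq => /andP[].
rewrite (chain_lab phi 0 ua aE) (chain_lab psi 1 ub bE) (chain_lab theta 2 uc cE).
have ga := good_lab phi 0 ua; have gb := good_lab psi 1 ub; have gc := good_lab theta 2 uc.
rewrite (wedge_good wP _ ubc gb gc) (wedge_good wP _ uab ga gb).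
rewrite (wedge_good wP _ u ga (good_mulS bc _ gb gc)); last by move=> p; rewrite !inE => /eqP->.
rewrite (wedge_good wP _ _ (good_mulS _ _ ga gb) gc) -?catA ?mulSA //.
  by have [] := uniq_catP uab.
by move=> p; rewrite !inE => /eqP->.
Qed.

Lemma wedge_comm (c1 c2 : bool) (x y : C) :
  (forall m, odd m != c1 -> x m = 0) -> (forall m, odd m != c2 -> y m = 0) ->
  w x y = (-1) ^+ (c1 && c2) *: w y x.
Proof.
apply: (@bil_chain_eq _ _ _ w (fun x y => (-1) ^+ (c1 && c2) *: w y x)
  (fun m => odd m == c1) (fun m => odd m == c2)) => //.
  by split=> z; apply: lin_scale; [apply: wB.2|apply: wB.1].
move=> h l a phi b psi /eqP<- /eqP<-; rewrite !wP.2 wedge_chainC.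
by rewrite -signr_odd oddM.
Qed.

Lemma bracket_anti (c1 c2 : bool) (x y : C) :
  (forall m, odd m != ~~ c1 -> x m = 0) -> (forall m, odd m != ~~ c2 -> y m = 0) ->
  br x y = - ((-1) ^+ (c1 && c2) *: br y x).
Proof.
move=> xc yc; rewrite -scaleNr; move: xc yc.
apply: (@bil_chain_eq _ _ _ br (fun x y => - (-1) ^+ (c1 && c2) *: br y x)
  (fun m => odd m == ~~ c1) (fun m => odd m == ~~ c2)) => //.
  by split=> z; apply: lin_scale; [apply: brB.2|apply: brB.1].
move=> h l a phi b psi /eqP hc /eqP lc; rewrite !brP.2 bracket_chainC.
by rewrite scaleNr -signr_odd oddM /= hc lc !negbK.
Qed.

Lemma bracket_jacobi (c1 c2 : bool) (x y z : C) :
  (forall m, odd m != ~~ c1 -> x m = 0) -> (forall m, odd m != ~~ c2 -> y m = 0) ->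
  br x (br y z) = br (br x y) z + (-1) ^+ (c1 && c2) *: br y (br x z).
Proof.
apply: (@tri_chain_eq _ _ _ (fun x y z => br x (br y z))
  (fun x y z => br (br x y) z + (-1) ^+ (c1 && c2) *: br y (br x z))
  (fun m => odd m == ~~ c1) (fun m => odd m == ~~ c2)) => //.
- split=> [y' z'|x' z'|x' y'].
  + exact: brB.1.
  + exact: lin_comp (brB.1 z') (brB.2 x').
  + exact: lin_comp (brB.2 y') (brB.2 x').
- split=> [y' z'|x' z'|x' y'].
  + apply: lin_add (lin_comp (brB.1 y') (brB.1 z')) (lin_scale _ (lin_comp (brB.1 z') (brB.2 y'))).
  + apply: lin_add (lin_comp (brB.2 x') (brB.1 z')) (lin_scale _ (brB.1 _)).
  + apply: lin_add (brB.2 _) (lin_scale _ (lin_comp (brB.2 x') (brB.2 y'))).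
move=> h k l a phi b psi c theta /eqP hc /eqP kc.
have [la [lb [lc [a' [u aE bE cE]]]]] := labels_ex a b c.
have [ua ubc abc] := uniq_catP u; have [ub uc bc] := uniq_catP ubc.
rewrite (chain_lab phi 0 ua aE) (chain_lab psi 1 ub bE) (chain_lab theta 2 uc cE).
rewrite (jacobi_words brP a' u (@lser_wloc _ _ _ _ la phi) (@lser_wloc _ _ _ _ lb psi)
  (@lser_wloc _ _ _ _ lc theta)); try exact: lser_inv.
by rewrite !size_lw -signr_odd oddM /= hc kc !negbK.
Qed.

Lemma bracket_leibniz (c1 c2 : bool) (x y z : C) :
  (forall m, odd m != c1 -> x m = 0) -> (forall m, odd m != c2 -> y m = 0) ->
  br x (w y z) = w (br x y) z + (-1) ^+ (~~ c1 && c2) *: w y (br x z).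
Proof.
apply: (@tri_chain_eq _ _ _ (fun x y z => br x (w y z))
  (fun x y z => w (br x y) z + (-1) ^+ (~~ c1 && c2) *: w y (br x z))
  (fun m => odd m == c1) (fun m => odd m == c2)) => //.
- split=> [y' z'|x' z'|x' y'].
  + exact: brB.1.
  + exact: lin_comp (wB.1 z') (brB.2 x').
  + exact: lin_comp (wB.2 y') (brB.2 x').
- split=> [y' z'|x' z'|x' y'].
  + apply: lin_add (lin_comp (brB.1 y') (wB.1 z')) (lin_scale _ (lin_comp (brB.1 z') (wB.2 y'))).
  + apply: lin_add (lin_comp (brB.2 x') (wB.1 z')) (lin_scale _ (wB.1 _)).
  + apply: lin_add (wB.2 _) (lin_scale _ (lin_comp (brB.2 x') (wB.2 y'))).
move=> h k l a phi b psi c theta /eqP hc /eqP kc.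
have [la [lb [lc [a' [u aE bE cE]]]]] := labels_ex a b c.
have [ua ubc abc] := uniq_catP u; have [ub uc bc] := uniq_catP ubc.
rewrite (chain_lab phi 0 ua aE) (chain_lab psi 1 ub bE) (chain_lab theta 2 uc cE).
rewrite (leibniz_good wP brP a' u _ (good_lab phi 0 ua) (good_lab psi 1 ub) (good_lab theta 2 uc)) //.
by rewrite !size_lw -signr_odd oddM /= hc kc.
Qed.

Lemma chain_gerstenhaber : gerstenhaber (@chain_parity F R M) w br.
Proof.
have par : superspace (@chain_parity F R M) := part_decomposition odd.
split.
- split=> //.
  + move=> p q x y xp yq m mpq.
    apply: (@wedge_vanish (fun m => odd m == p) (fun m => odd m == q)) => // h l /eqP hp /eqP lq.
    by apply: contraNneq mpq => <-; rewrite oddD hp lq.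
  + exact: wedge_assoc.
  + by move=> p q x y; apply: wedge_comm.
- split=> //.
  + have -> : reverse_parity (@chain_parity F R M) =
        (fun p => [set c | forall m, ~~ odd m != p -> c m = 0]%classic).
      by apply: funext => -[]; apply/seteqP; split=> c cP m;
        [have := cP m|have := cP m|have := cP m|have := cP m]; case: (odd m).
    exact: part_decomposition.
  + move=> p q x y xp yq m mpq.
    apply: (@bracket_vanish (fun m => odd m == ~~ p) (fun m => odd m == ~~ q)) => // h l /eqP hp /eqP lq.
    apply: contraNneq mpq => E; have := congr1 odd E; rewrite oddD hp lq /= => {}E.
    by rewrite -[odd m]negbK -E; case: (p); case: (q).
  + by move=> p q x y; apply: bracket_anti.
  + by move=> p q x y z; apply: bracket_jacobi.
by move=> p q x y z; apply: bracket_leibniz.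
Qed.

Lemma chain_graded_gerstenhaber : graded_gerstenhaber (@chain_degree F R M) w br.
Proof.
split; first exact: (part_decomposition id).
  move=> p q x y xp yq m mpq.
  apply: (@wedge_vanish (pred1 p) (pred1 q)) => // h l /eqP-> /eqP->.
  by rewrite eq_sym.
move=> p q x y xp yq.
have V m : (p + q)%N != m.+1 -> br x y m = 0.
  by move=> pqm; apply: (@bracket_vanish (pred1 p) (pred1 q)) => // h l /eqP-> /eqP->.
case E: (p + q)%N => [|k].
  by apply: dsumP => m; apply: V; rewrite E.
by move=> m mk; apply: V; rewrite E eqSS eq_sym.
Qed.

End Laws.

End Grading.

Theorem theorem4p8 (F : fieldType) (charF : [pchar F]%R =i pred0)
    (R : lieConformal F) (M : lcModAlgebra R) :
  (exists! w, @is_wedge F R M w) /\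
  (exists! br, @is_bracket F R M br) /\
  forall w br, is_wedge w -> is_bracket br ->
    gerstenhaber (@chain_parity F R M) w br /\
    graded_gerstenhaber (@chain_degree F R M) w br.
Proof.
split; first exact: wedge_exists; split; first exact: bracket_exists.
move=> w br wP brP; split; first exact: chain_gerstenhaber.
exact: chain_graded_gerstenhaber.
Qed.
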